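(* Consider the sequence of $N$-class single-server queues in conventional heavy traffic under the serve-the-longest-queue policy described in the context, with buffer sizes $\beta_i^n=\beta n^{1/2}+\varepsilon_i^n n^{1/2}$, where $\beta>0$ is a constant and $\varepsilon_i^n\to0$ as $n\to\infty$ for each $i$. Let $\hat X_i^n=n^{-1/2}X_i^n$, where $X_i^n(t)$ is the number of class-$i$ customers in the system at time $t$. Let $\alpha=\big(\sum_{i=1}^N\mu_i^{-1}\big)^{-1}$, and let $\tilde W$ be a one-dimensional $(\tilde m,\tilde A)$-Brownian motion with $$\tilde m=\alpha\sum_{i=1}^N\frac{\hat\lambda_i}{\mu_i},\qquad \tilde A=\alpha^2\sum_{i=1}^N\frac{\lambda_i}{\mu_i^2}(\sigma_i^2+\gamma_i^2).$$ Let $\tilde X=\Gamma_{[0,\beta]}(\tilde W)$, where $\Gamma_{[0,\beta]}$ is the Skorohod map on $[0,\beta]$ (so $\tilde X$ is a reflected Brownian motion on $[0,\beta]$). Then $$(\hat X_1^n,\ldots,\hat X_N^n)\Rightarrow(\tilde X,\ldots,\tilde X)\qquad\text{as } n\to\infty.$$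
   Context: **Notation.** $\iota(t)=t$ on $[0,\infty)$. $\Rightarrow$ is convergence in distribution; for processes it is in the space of cadlag functions on $[0,\infty)$ with the Skorohod $J_1$ topology. An $(m,A)$-Brownian motion starts from zero and has drift $m$ and infinitesimal (co)variance $A$. **Model (conventional heavy traffic).** Fix $N\ge2$. For each $n\in\mathbb{N}$ there is one server and $N$ buffers, buffer $i$ being dedicated to class-$i$ customers and having size $\beta_i^n$. Class-$i$ customers arrive according to a counting process $E_i^n$. Upon arrival a customer goes directly to service if the server is available; otherwise it is queued in buffer $i$ if that buffer is not full, and is lost if the buffer is full. The server is non-idling; when it becomes available and the buffers are not all empty, it picks a customer from the buffer with the most customers (serve-the-longest-queue), ties among maximal queue lengths being broken uniformly at random. The system is initially empty. Service times have general distributions: $S_i^n$ denotes the potential service counting process of class $i$, i.e. $S_i^n(t)$ is the number of class-$i$ service completions by the time the server has devoted $t$ units of time to class $i$. With $T_i^n(t)$ the service time devoted to class-$i$ customers up to time $t$, and $R_i^n(t)$ the number of class-$i$ arrivals lost up to time $t$, the number of class-$i$ customers in the system satisfies $$X_i^n(t)=E_i^n(t)-S_i^n(T_i^n(t))-R_i^n(t).$$ **Probabilistic assumptions.** For each $n$, the $2N$ processes $E_1^n,\ldots,E_N^n,S_1^n,\ldots,S_N^n$ are mutually independent. There are constants $\lambda_i,\mu_i>0$, $\hat\lambda_i\in\mathbb{R}$, $\sigma_i^2\ge0$, $\gamma_i\ge0$ and sequences $\lambda_i^n=\lambda_i n+n^{1/2}\hat\lambda_i+o(n^{1/2})$ such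 that for each $i$: - $n^{-1}E_i^n\Rightarrow\lambda_i\iota$, and $n^{-1/2}(E_i^n-\lambda_i^n\iota)\Rightarrow W_i^{\mathrm{arr}}$, a $(0,\lambda_i\sigma_i^2)$-Brownian motion; - $n^{-1}S_i^n\Rightarrow\mu_i\iota$, and $n^{-1/2}(S_i^n-n\mu_i\iota)\Rightarrow W_i^{\mathrm{ser}}$, a $(0,\mu_i\gamma_i^2)$-Brownian motion. The critical load condition $\sum_{i=1}^N\rho_i=1$ holds, where $\rho_i=\lambda_i/\mu_i$. **Skorohod map.** For $a>0$, $\Gamma_{[0,a]}$ maps a real-valued cadlag function $\psi$ on $[0,\infty)$ to $\varphi$, where $(\varphi,\eta_1,\eta_2)$ is the unique triplet of cadlag functions with $\varphi=\psi+\eta_1-\eta_2$; $\varphi(t)\in[0,a]$ for all $t$; $\eta_1,\eta_2$ nonnegative and nondecreasing with $\eta_i(0-)=0$; and $\int_{[0,\infty)}1_{(0,a]}(\varphi)\,d\eta_1=\int_{[0,\infty)}1_{[0,a)}(\varphi)\,d\eta_2=0$. *)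

(* Defs.v *)
From HB Require Import structures.
From Stdlib Require Import Relation_Operators.
From mathcomp Require Import all_boot all_order all_algebra.
From mathcomp Require Import all_classical all_reals all_analysis.

Set Implicit Arguments.
Unset Strict Implicit.
Unset Printing Implicit Defensive.

Import Order.TTheory GRing.Theory Num.Theory.
Import numFieldNormedType.Exports.

Local Open Scope classical_set_scope.
Local Open Scope ring_scope.

(** ** The Skorohod space *)

(* Paths are functions on R of which only the restriction to [0, +oo[ is ever
   looked at. *)
Definition skorohod (R : realType) (V : normedModType R) : Type := R -> V.

HB.instance Definition _ (R : realType) (V : normedModType R) :=
  gen_eqMixin (skorohod V).
HB.instance Definition _ (R : realType) (V : normedModType R) :=
  gen_choiceMixin (skorohod V).

Definition cadlag (R : realType) (V : normedModType R) : set (skorohod V) :=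
  [set x : R -> V | (forall t, 0 <= t -> x s @[s --> t^'+] --> x t) /\
           (forall t, 0 < t -> exists l : V, x s @[s --> t^'-] --> l)].

(* An increasing bijection of [0, +oo[ is automatically a homeomorphism fixing
   the origin. *)
Definition time_change (R : realType) (l : R -> R) : Prop :=
  set_bij `[0, +oo[ `[0, +oo[ l /\
  {in `[0, +oo[ &, {homo l : s t / s < t}}.

(* The paths y that are e-close to x on [0, h] up to a deformation of time by
   less than e. These sets form a neighbourhood basis at x of the J1
   topology on the cadlag paths: y_k --> x in J1 iff there are time
   changes l_k with sup_t |l_k t - t| --> 0 and
   sup_(t <= h) |y_k (l_k t) - x t| --> 0 for every h. *)
Definition J1_ball (R : realType) (V : normedModType R) (x : skorohod V)
    (he : R * R) : set (skorohod V) :=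
  [set y | exists l : R -> R, [/\ time_change l,
     forall t, 0 <= t -> `|l t - t| < he.2 &
     forall t, 0 <= t <= he.1 -> `|y (l t) - x t| < he.2]].

Definition J1_nbhs (R : realType) (V : normedModType R) (x : skorohod V) :
    set_system (skorohod V) :=
  filter_from [set he : R * R | 0 < he.2] (J1_ball x).

HB.instance Definition _ (R : realType) (V : normedModType R) :=
  hasNbhs.Build (skorohod V) (@J1_nbhs R V).

Section J1_topology.
Context (R : realType) (V : normedModType R).
Implicit Types (x y z : skorohod V) (A : set (skorohod V)).

Lemma time_change_id : time_change (@id R).
Proof. by split=> //; split=> [t //|t u _ _ //|t tT]; exists t. Qed.

Lemma time_change_comp (l m : R -> R) :
  time_change l -> time_change m -> time_change (m \o l).
Proof.
move=> [bl hl] [bm hm]; split; first exact: (set_bij_comp bl bm).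
have [fl _ _] := bl => s t s0 t0 st /=.
have {}fl u : u \in `[0, +oo[ -> l u \in `[0, +oo[.
  by move=> u0; have := fl u; rewrite /= => /(_ u0).
by apply: hm; [exact: fl|exact: fl|exact: hl].
Qed.

Lemma J1_ball_refl x he : 0 < he.2 -> J1_ball x he x.
Proof.
by move=> e0; exists id; split=> [|t _|t _]; rewrite ?subrr ?normr0//;
  exact: time_change_id.
Qed.

Lemma J1_nbhs_filter x : ProperFilter (nbhs x).
Proof.
apply: filter_from_proper => [|he e0]; last by exists x; exact: J1_ball_refl.
apply: filter_from_filter; first by exists (0, 1) => /=.
move=> [h e] [h' e'] /= e0 e'0; exists (Num.max h h', Num.min e e').
  by rewrite /= lt_min e0.
move=> y [l [tl l1 l2]]; split; exists l; split=> //= t.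
- by move=> /l1; rewrite lt_min => /andP[].
- move=> /andP[t0 th]; have := l2 t; rewrite /= t0 le_max th lt_min /=.
  by move=> /(_ isT)/andP[].
- by move=> /l1; rewrite lt_min => /andP[].
- move=> /andP[t0 th]; have := l2 t; rewrite /= t0 le_max th orbT lt_min /=.
  by move=> /(_ isT)/andP[].
Qed.

Lemma J1_nbhs_singleton x A : nbhs x A -> A x.
Proof. by case=> he e0; apply; exact: J1_ball_refl. Qed.

Lemma J1_nbhs_nbhs x A : nbhs x A -> nbhs x (nbhs^~ A).
Proof.
case=> -[h e] /= e0 sub; have e2 : 0 < e / 2 by rewrite divr_gt0.
exists (h, e / 2) => //= y [l [tl l1 l2]].
exists (h + e / 2, e / 2) => //= z [m [tm m1 m2]].
apply: sub; exists (m \o l); split=> [|t t0|t /andP[t0 th]] /=.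
- exact: time_change_comp.
- have lt0 : 0 <= l t.
    by have [[f _ _] _] := tl; have := f t; rewrite /= !in_itv /= !andbT => ->.
  rewrite -(subrK (l t) (m (l t))) -addrA [e]splitr.
  by rewrite (le_lt_trans (ler_normD _ _))// ltrD// ?m1 ?l1.
- have lt0 : 0 <= l t.
    by have [[f _ _] _] := tl; have := f t; rewrite /= !in_itv /= !andbT => ->.
  have lth : l t <= h + e / 2.
    have /= := l1 _ t0; rewrite ltr_norml => /andP[_].
    by rewrite ltrBlDl => /ltW/le_trans; apply; rewrite lerD2r.
  rewrite -(subrK (y (l t)) (z _)) -addrA [e]splitr.
  by rewrite (le_lt_trans (ler_normD _ _))// ltrD// ?m2 ?l2 ?lt0 ?t0.
Qed.

HB.instance Definition _ := Nbhs_isNbhsTopological.Build (skorohod V)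
  J1_nbhs_filter J1_nbhs_singleton J1_nbhs_nbhs.

End J1_topology.

(* The n-th process may live on its own probability space. *)
Definition cvg_in_distribution (R : realType) (V : normedModType R)
    (d : nat -> measure_display) (T : forall n, measurableType (d n))
    (P : forall n, probability (T n) R) (X : forall n, T n -> skorohod V)
    (d' : measure_display) (T' : measurableType d') (Q : probability T' R)
    (Y : T' -> skorohod V) : Prop :=
  forall f : skorohod V -> R,
    {within @cadlag R V, continuous f} ->
    (exists M : R, forall x, cadlag x -> `|f x| <= M) ->
    ('E_(P n)[f \o X n] @[n --> \oo] --> 'E_Q[f \o Y])%E.

(** ** Processes *)

Definition cadlag_process (R : realType) (d : measure_display)
    (T : measurableType d) (X : T -> R -> R) : Prop :=
  (forall w, cadlag (X w : skorohod R^o)) /\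
  (forall t, 0 <= t -> measurable_fun setT (X ^~ t)).

Definition counting_process (R : realType) (d : measure_display)
    (T : measurableType d) (X : T -> R -> nat) : Prop :=
  (forall w, [/\ X w 0 = 0%N,
     forall s t, 0 <= s -> s <= t -> (X w s <= X w t)%N &
     forall t, 0 <= t -> \forall s \near t^'+, X w s = X w t]) /\
  (forall t, 0 <= t -> measurable_fun setT (X ^~ t)).

Definition generated_sigma_algebra (R : realType) (d d' : measure_display)
    (T : measurableType d) (U : measurableType d') (I : set R)
    (X : T -> R -> U) : set (set T) :=
  <<s [set A | exists t B, [/\ I t, measurable B & A = (X ^~ t) @^-1` B]] >>.

Definition mutually_independent (R : realType) (d : measure_display)
    (T : measurableType d) (P : probability T R) (I : choiceType)
    (G : I -> set (set T)) : Prop :=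
  forall (s : seq I) (A : I -> set T), uniq s ->
    (forall i, i \in s -> G i (A i)) ->
    P (\bigcap_(i in [set` s]) A i) = (\prod_(i <- s) P (A i))%E.

(* The normal law of mean m and variance v; [normal_prob] takes the standard
   deviation and is not a Dirac mass when it vanishes. *)
Definition gaussian (R : realType) (m v : R) (B : set R) : \bar R :=
  if v == 0 then (\d_m B)%E else normal_prob m (Num.sqrt v) B.

Definition brownian_motion (R : realType) (d : measure_display)
    (T : measurableType d) (P : probability T R) (m A : R)
    (W : T -> R -> R) : Prop :=
  [/\ cadlag_process W,
      {ae P, forall w, W w 0 = 0 /\ {within `[0, +oo[, continuous (W w)}},
      forall s t (B : set R), 0 <= s -> s <= t -> measurable B ->
        P [set w | B (W w t - W w s)] =
          gaussian (m * (t - s)) (A * (t - s)) B &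
      forall s t (F : set T) (B : set R), 0 <= s -> s <= t ->
        generated_sigma_algebra `[0, s] W F -> measurable B ->
        P (F `&` [set w | B (W w t - W w s)]) =
          (P F * P [set w | B (W w t - W w s)%R])%E].

(* [skorohod_map a psi phi] means that phi is the image of psi under the
   Skorohod map on [0, a]. Elements of [cumulative R R] are nondecreasing and
   right-continuous on the whole of R; vanishing on the negatives encodes
   eta(0-) = 0, and makes an initial jump of eta an atom at 0 of the
   associated measure. *)
Definition skorohod_map (R : realType) (a : R) (psi phi : R -> R) : Prop :=
  cadlag (phi : skorohod R^o) /\
  exists eta1 eta2 : cumulative R R,
    [/\ forall t, t < 0 -> eta1 t = 0 /\ eta2 t = 0,
        forall t, 0 <= t -> phi t = psi t + eta1 t - eta2 t,
        forall t, 0 <= t -> 0 <= phi t <= a,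
        (\int[lebesgue_stieltjes_measure eta1]_(t in `[0%R, +oo[)
           (\1_(`]0, a] : set R) (phi t))%:E)%E = 0%E &
        (\int[lebesgue_stieltjes_measure eta2]_(t in `[0%R, +oo[)
           (\1_(`[0, a[ : set R) (phi t))%:E)%E = 0%E].

(** ** The queue *)

Record state (N : nat) := State {
  queue : {ffun 'I_N -> nat};      (* buffer contents *)
  server : option 'I_N;            (* class in service, None if available *)
  lost : {ffun 'I_N -> nat};
  completed : {ffun 'I_N -> nat} }.

Section queue.
Context (R : realType) (N : nat).
Implicit Types (z : state N) (i : 'I_N) (f : {ffun 'I_N -> nat}).

Definition empty_state : state N :=
  State [ffun=> 0%N] None [ffun=> 0%N] [ffun=> 0%N].

Definition customers z i : nat := queue z i + (server z == Some i).

Definition incr f i : {ffun 'I_N -> nat} := [ffun k => (f k + (k == i))%N].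
Definition decr f i : {ffun 'I_N -> nat} := [ffun k => (f k - (k == i))%N].

(* Buffer sizes are real numbers: a buffer of size b holds a further customer
   iff its content does not exceed b afterwards. *)
Definition arrive (b : 'I_N -> R) z i : state N :=
  if server z is None then State (queue z) (Some i) (lost z) (completed z)
  else if (queue z i).+1%:R <= b i then
    State (incr (queue z) i) (server z) (lost z) (completed z)
  else State (queue z) (server z) (incr (lost z) i) (completed z).

Definition longest z : {set 'I_N} :=
  [set i | [forall k, (queue z k <= queue z i)%N]].

(* [tie c M] is the class chosen in the set M of classes of maximal queue
   length, c being the number of services completed before. *)
Definition complete (tie : nat -> {set 'I_N} -> 'I_N) z i : state N :=
  let done := incr (completed z) i in
  if [forall k, queue z k == 0%N] then State (queue z) None (lost z) done
  else let j := tie (\sum_k completed z k)%N (longest z) in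
    State (decr (queue z) j) (Some j) (lost z) done.

Inductive step (b : 'I_N -> R) (tie : nat -> {set 'I_N} -> 'I_N) :
    state N -> state N -> Prop :=
| step_arrival z i : step b tie z (arrive b z i)
| step_completion z i : server z = Some i -> step b tie z (complete tie z i).

(* The time devoted to class i during [0, t]. *)
Definition service_time (Z : R -> state N) i (t : R) : R :=
  fine (lebesgue_measure [set s : R | 0 <= s <= t /\ server (Z s) = Some i]).

(* Z is piecewise constant. Arrivals and completions that occur at the same
   instant are processed one after the other, in any order. *)
Definition slq_path (b : 'I_N -> R) (tie : nat -> {set 'I_N} -> 'I_N)
    (E S : 'I_N -> R -> nat) (Z : R -> state N) : Prop :=
  [/\ Z 0 = empty_state,
      forall t, 0 <= t -> \forall s \near t^'+, Z s = Z t,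
      forall t, 0 < t -> exists2 z, (\forall s \near t^'-, Z s = z) &
        clos_refl_trans _ (step b tie) z (Z t),
      forall t i, 0 <= t -> completed (Z t) i = S i (service_time Z i t) &
      forall t i, 0 <= t -> (customers (Z t) i)%:Z =
        (E i t)%:Z - (S i (service_time Z i t))%:Z - (lost (Z t) i)%:Z].

Context (d : measure_display) (T : measurableType d) (P : probability T R).

Definition uniform_tie_breaking (tie : T -> nat -> {set 'I_N} -> 'I_N) :
    Prop :=
  forall c (M : {set 'I_N}) i, i \in M ->
    [/\ forall w, tie w c M \in M,
        measurable [set w | tie w c M = i] &
        P [set w | tie w c M = i] = ((#|M|%:R)^-1)%:E].

(* The sigma-algebras of the arrival processes, of the potential service
   processes, and of the tie-breaking variables. *)
Definition primitive_sigma_algebra (E S : 'I_N -> T -> R -> nat)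
    (tie : T -> nat -> {set 'I_N} -> 'I_N) (k : 'I_N + 'I_N + nat) :
    set (set T) :=
  match k with
  | inl (inl i) => generated_sigma_algebra `[0, +oo[ (E i)
  | inl (inr i) => generated_sigma_algebra `[0, +oo[ (S i)
  | inr c => <<s [set A | exists M i, A = [set w | tie w c M = i]] >>
  end.

Definition slq_system (b : 'I_N -> R) (E S : 'I_N -> T -> R -> nat)
    (tie : T -> nat -> {set 'I_N} -> 'I_N) (Z : T -> R -> state N) : Prop :=
  [/\ forall i, counting_process (E i) /\ counting_process (S i),
      uniform_tie_breaking tie,
      mutually_independent P (primitive_sigma_algebra E S tie),
      forall w, slq_path b (tie w) (fun i => E i w) (fun i => S i w) (Z w) &
      forall i t, 0 <= t -> measurable_fun setT (fun w => customers (Z w t) i)].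

End queue.

(* Main.v *)
Require Import Defs.
From HB Require Import structures.
From Stdlib Require Import Relation_Operators Operators_Properties.
From mathcomp Require Import all_boot all_order all_algebra.
From mathcomp Require Import all_classical all_reals all_analysis.
From mathcomp Require Import measurable_realfun zify ring lra.

Set Implicit Arguments.
Unset Strict Implicit.
Unset Printing Implicit Defensive.

Import Order.TTheory GRing.Theory Num.Theory.
Import numFieldNormedType.Exports.

Local Open Scope classical_set_scope.
Local Open Scope ring_scope.

(* On a finite mesh of times, the weighted sums of the scaled noises
   e_i - s_i(rho_i t) of arrivals and services converge to the values of W. On
   an event of high probability all noises have a small modulus of continuity,
   and there the rest is deterministic: since the longest queue is served, the
   excess workload of a set of classes over its share decreases at a rate of
   order n^(1/2) while positive, so that all scaled queues stay close to their
   weighted mean; this mean is the noise plus idleness, which accumulates only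
   near 0, minus losses, which occur only near beta, and is therefore close to
   the discrete reflection of the mesh values of the noise. The same comparison
   applies to the Skorohod map of W. Hence the expectation of a functional
   continuous in J1 is, on both sides, close to the same combination of tent
   functions of the mesh values. *)

(** * Expectations and independence *)

(** Two obstacles shape the argument. Nothing says that a test functional composed with the paths is
    measurable; its expectation is handled through the monotonicity of integrals of nonnegative
    functions only, squeezed between measurable functions of finitely many noise values. Moreover,
    evaluation at a fixed time is not continuous in J1; the convergence of the noises is exploited
    through suprema over moving times, which bound from one side, and the other side comes from the
    complement to 1.

    The laws of the limiting noises are prescribed one by one. Their joint effect comes from the
    independence of the primitives for each n, and it is matched with [W] by giving each primitive a
    share of every mesh interval proportional to its variance.

    The reflections are not compared through Lipschitz continuity of the Skorohod map. Two
    approximately regulated paths have net regulators that cannot drift apart: beyond a small gap,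
    the regulator that would widen it belongs to a path away from the barrier concerned. This
    tolerates regulators that act near the barriers instead of on them. *)

Lemma ler_norm_prodB (R : realType) (I : Type) (s : seq I) (x y : I -> R) :
  (forall i, 0 <= x i <= 1) -> (forall i, 0 <= y i <= 1) ->
  `|\prod_(i <- s) x i - \prod_(i <- s) y i| <= \sum_(i <- s) `|x i - y i|.
Proof.
move=> hx hy; elim: s => [|i s ih]; first by rewrite !big_nil subrr normr0.
rewrite !big_cons.
have px : 0 <= \prod_(j <- s) x j <= 1.
  apply/andP; split; first by apply: prodr_ge0 => j _; case/andP: (hx j).
  by apply: prodr_ile1 => j _; exact: hx.
have -> : x i * \prod_(j <- s) x j - y i * \prod_(j <- s) y j =
  (x i - y i) * \prod_(j <- s) x j
  + y i * (\prod_(j <- s) x j - \prod_(j <- s) y j) by ring.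
rewrite (le_trans (ler_normD _ _))// lerD//.
  by rewrite normrM ler_piMr// ger0_norm; case/andP: px.
rewrite normrM (le_trans _ ih)// ler_piMl// ger0_norm; case/andP: (hy i) => //.
Qed.

(* The integral of a nonnegative function is the supremum of those of the simple
   functions below it. *)
Lemma ge0_le_integral_nonmeasurable (R : realType) (d : measure_display)
    (T : measurableType d) (mu : {measure set T -> \bar R}) (f g : T -> \bar R) :
  (forall w, 0 <= f w)%E -> (forall w, f w <= g w)%E ->
  (\int[mu]_w f w <= \int[mu]_w g w)%E.
Proof.
move=> f0 fg; rewrite !ge0_integralTE//=; last first.
  by move=> w; rewrite (le_trans (f0 w)).
apply: ge_ereal_sup => _ [h hf <-]; apply: ereal_sup_ubound; exists h => // w.
exact: le_trans (hf w) _.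
Qed.

Section expectation.
Context (R : realType) (d : measure_display) (T : measurableType d)
  (P : probability T R).
Implicit Types (f g : T -> R).

Definition bounded_measurable f :=
  measurable_fun setT f /\ exists M : R, forall w, `|f w| <= M.

Lemma bm_integrable f : bounded_measurable f -> P.-integrable setT (EFin \o f).
Proof.
move=> [mf [M fM]]; apply: measurable_bounded_integrable => //.
- by apply: (@le_lt_trans _ _ 1%E); rewrite ?probability_le1// ltry.
- exists M; split; first exact: num_real.
  by move=> x Mx w _; exact: le_trans (fM w) (ltW Mx).
Qed.

Lemma bm_cst c : bounded_measurable (fun=> c).
Proof. by split; [exact: measurable_cst|exists `|c|]. Qed.

Lemma bm_indic A : measurable A -> bounded_measurable (\1_A).
Proof.
move=> mA; split; first exact: measurable_indic.
by exists 1 => w; rewrite indicE; case: (w \in A); rewrite ?normr1 ?normr0.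
Qed.

Lemma bmD f g : bounded_measurable f -> bounded_measurable g ->
  bounded_measurable (fun w => f w + g w).
Proof.
move=> [mf [M fM]] [mg [M' gM']]; split; first exact: measurable_funD.
by exists (M + M') => w; rewrite (le_trans (ler_normD _ _))// lerD.
Qed.

Lemma bmM f g : bounded_measurable f -> bounded_measurable g ->
  bounded_measurable (fun w => f w * g w).
Proof.
move=> [mf [M fM]] [mg [M' gM']]; split; first exact: measurable_funM.
by exists (M * M') => w; rewrite normrM ler_pM.
Qed.

Lemma bmN f : bounded_measurable f -> bounded_measurable (fun w => - f w).
Proof.
by move=> [mf [M fM]]; split; [exact: measurableT_comp|exists M => w;
  rewrite normrN].
Qed.

Lemma bmB f g : bounded_measurable f -> bounded_measurable g ->
  bounded_measurable (fun w => f w - g w).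
Proof. by move=> bf /bmN; exact: bmD. Qed.

Lemma bm_sum (I : Type) (s : seq I) (F : I -> T -> R) :
  (forall i, bounded_measurable (F i)) ->
  bounded_measurable (fun w => \sum_(i <- s) F i w).
Proof.
move=> bF; elim: s => [|i s ih].
  by under eq_fun do rewrite big_nil; exact: bm_cst.
by under eq_fun do rewrite big_cons; exact: bmD.
Qed.

Lemma bm_prod (I : Type) (s : seq I) (F : I -> T -> R) :
  (forall i, bounded_measurable (F i)) ->
  bounded_measurable (fun w => \prod_(i <- s) F i w).
Proof.
move=> bF; elim: s => [|i s ih].
  by under eq_fun do rewrite big_nil; exact: bm_cst.
by under eq_fun do rewrite big_cons; exact: bmM.
Qed.

(** Also applied to functions not known to be measurable; these are then bounded and nonnegative. *)
Definition Ex f : R := \int[P]_w f w.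

Lemma eq_Ex f g : f =1 g -> Ex f = Ex g.
Proof. by move=> /funext ->. Qed.

Lemma Ex_cst c : Ex (fun=> c) = c.
Proof. rewrite /Ex Rintegral_cst//; transitivity (c * fine (P setT)) => //.
by rewrite probability_setT mulr1. Qed.

Lemma ExD f g : bounded_measurable f -> bounded_measurable g ->
  Ex (fun w => f w + g w) = Ex f + Ex g.
Proof. by move=> bf bg; rewrite /Ex RintegralD//; exact: bm_integrable. Qed.

Lemma ExB f g : bounded_measurable f -> bounded_measurable g ->
  Ex (fun w => f w - g w) = Ex f - Ex g.
Proof. by move=> bf bg; rewrite /Ex RintegralB//; exact: bm_integrable. Qed.

Lemma ExZ c f : bounded_measurable f -> Ex (fun w => c * f w) = c * Ex f.
Proof. by move=> bf; rewrite /Ex RintegralZl//; exact: bm_integrable. Qed.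

Lemma Ex_sum (I : Type) (s : seq I) (F : I -> T -> R) :
  (forall i, bounded_measurable (F i)) ->
  Ex (fun w => \sum_(i <- s) F i w) = \sum_(i <- s) Ex (F i).
Proof.
move=> bF; elim: s => [|i s ih].
  by rewrite big_nil; under eq_Ex do rewrite big_nil; rewrite Ex_cst.
rewrite big_cons -ih -ExD//; last exact: bm_sum.
by apply: eq_Ex => w; rewrite big_cons.
Qed.

Lemma Ex_indic A : measurable A -> Ex (\1_A) = fine (P A).
Proof. by move=> mA; rewrite /Ex/Rintegral integral_indic// setIT. Qed.

Lemma Ex_ge0 f : (forall w, 0 <= f w) -> 0 <= Ex f.
Proof. by move=> f0; apply: Rintegral_ge0. Qed.

Lemma ge0_fin_num_integral M f : (forall w, 0 <= f w <= M) ->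
  (\int[P]_w (f w)%:E)%E \is a fin_num.
Proof.
move=> f0; rewrite ge0_fin_numE; last first.
  by apply: integral_ge0 => w _; rewrite lee_fin; case/andP: (f0 w).
apply: (@le_lt_trans _ _ (\int[P]_w M%:E)%E).
  by apply: ge0_le_integral_nonmeasurable => w; rewrite lee_fin; case/andP: (f0 w).
rewrite integral_cst//; apply: (@le_lt_trans _ _ (M%:E * P setT)%E) => //.
by rewrite probability_setT mule1 ltry.
Qed.

Lemma ge0_le_Ex M f g : (forall w, 0 <= f w) -> (forall w, f w <= g w) ->
  (forall w, g w <= M) -> Ex f <= Ex g.
Proof.
move=> f0 fg gM; rewrite /Ex /Rintegral fine_le//.
- by apply: (@ge0_fin_num_integral M) => w; rewrite f0 (le_trans (fg w)).
- by apply: (@ge0_fin_num_integral M) => w; rewrite (le_trans (f0 w))/=.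
- by apply: ge0_le_integral_nonmeasurable => w; rewrite lee_fin.
Qed.

Lemma le_Ex f g : bounded_measurable f -> bounded_measurable g ->
  (forall w, f w <= g w) -> Ex f <= Ex g.
Proof. by move=> bf bg fg; apply: le_Rintegral => //; exact: bm_integrable. Qed.

Lemma ler_norm_Ex f : bounded_measurable f -> `|Ex f| <= Ex (fun w => `|f w|).
Proof. by move=> bf; apply: le_normr_Rintegral => //; exact: bm_integrable. Qed.

Lemma bm_norm f : bounded_measurable f -> bounded_measurable (fun w => `|f w|).
Proof.
move=> [mf [M fM]]; split; first exact: measurableT_comp.
by exists M => w; rewrite normr_id.
Qed.

Lemma Ex_dist f g e : bounded_measurable f -> bounded_measurable g ->
  (forall w, `|f w - g w| <= e) -> `|Ex f - Ex g| <= e.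
Proof.
move=> bf bg fge; rewrite -ExB// (le_trans (ler_norm_Ex (bmB bf bg)))//.
rewrite -[leRHS]Ex_cst; apply: le_Ex => //; last exact: bm_cst.
by apply: bm_norm; exact: bmB.
Qed.

(** [f] may fail to be measurable, so [f - g] is not integrated: monotonicity is applied to
    [max 0 (g - e) <= f <= g + e], whose outer terms are measurable. *)
Lemma Ex_sandwich M f g e : bounded_measurable g -> bounded_measurable e ->
  (forall w, 0 <= f w <= M) -> (forall w, 0 <= g w) -> (forall w, 0 <= e w) ->
  (forall w, `|f w - g w| <= e w) -> `|Ex f - Ex g| <= Ex e.
Proof.
move=> bg be f0 g0 e0 fge.
have fM w : f w <= M by case/andP: (f0 w).
have {}f0 w : 0 <= f w by case/andP: (f0 w).
rewrite ler_norml; apply/andP; split.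
- suff : Ex (fun w => Num.max 0 (g w - e w)) <= Ex f.
    suff : Ex g - Ex e <= Ex (fun w => Num.max 0 (g w - e w)) by lra.
    rewrite -ExB//; apply: le_Ex; first exact: bmB.
      have [mB [M' hM']] := bmB bg be; split.
        by apply: measurable_maxr => //; exact: measurable_cst.
      exists `|M'| => w; rewrite ger0_norm ?le_max ?lexx// ge_max normr_ge0/=.
      by rewrite (le_trans (ler_norm _))// (le_trans (hM' w))// ler_norm.
    by move=> w; rewrite le_max lexx orbT.
  apply: (@ge0_le_Ex M) => // w; first by rewrite le_max lexx.
  by rewrite ge_max f0/=; have := fge w; rewrite ler_norml => /andP[]; lra.
- have [_ [M1 hM1]] := bg; have [_ [M2 hM2]] := be.
  rewrite lerBlDl -ExD//; apply: (@ge0_le_Ex (M1 + M2)) => // w.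
    by have := fge w; rewrite ler_norml => /andP[_]; lra.
  by rewrite lerD// (le_trans (ler_norm _)).
Qed.

Lemma Ex_cvg0 (f : nat -> T -> R) (M : R) : (forall k, bounded_measurable (f k)) ->
  (forall k w, `|f k w| <= M) -> {ae P, forall w, f k w @[k --> \oo] --> 0} ->
  Ex (f k) @[k --> \oo] --> 0.
Proof.
move=> bf fM f0.
have ifin k : (\int[P]_w (f k w)%:E)%E = (Ex (f k))%:E.
  by rewrite /Ex /Rintegral fineK//; apply: integrable_fin_num => //;
    exact: bm_integrable.
have h1 : {ae P, forall w, [set: T] w -> (f k w)%:E @[k --> \oo] --> 0%E}.
  by apply: filterS f0 => w fw0 _; apply/fine_cvgP; split; first exact: nearW.
have h2 : {ae P, forall w k, [set: T] w -> (`|(f k w)%:E| <= M%:E)%E}.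
  by apply: aeW => w k _ /=; rewrite lee_fin.
have [_ _] := @dominated_convergence _ _ _ P setT measurableT
  (fun k w => (f k w)%:E) (fun=> 0%E) (fun=> M%:E)
  (fun k => (measurable_EFinP _ _).2 (bf k).1) (measurable_cst 0%E) h1
  (bm_integrable (bm_cst M)) h2.
rewrite integral0; under eq_fun do rewrite ifin.
by move=> /fine_cvgP[].
Qed.

End expectation.

Arguments Ex {R d T} P f.

Lemma eq_law_Ex (R : realType) (d d' : measure_display) (T : measurableType d)
    (T' : measurableType d') (P : probability T R) (Q : probability T' R)
    (X : T -> R) (Y : T' -> R) (h : R -> R) :
  measurable_fun setT X -> measurable_fun setT Y -> measurable_fun setT h ->
  (forall x, 0 <= h x) ->
  (forall B, measurable B -> P (X @^-1` B) = Q (Y @^-1` B)) ->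
  Ex P (h \o X) = Ex Q (h \o Y).
Proof.
move=> mX mY mh h0 XY; rewrite /Ex /Rintegral; congr fine.
have mEh : measurable_fun [set: R] (EFin \o h) by exact/measurable_EFinP.
have := @ge0_integral_pushforward _ _ _ _ _ _ mX P setT _ measurableT mEh.
rewrite preimage_setT => <-; last by move=> y _; rewrite lee_fin.
have := @ge0_integral_pushforward _ _ _ _ _ _ mY Q setT _ measurableT mEh.
rewrite preimage_setT => <-; last by move=> y _; rewrite lee_fin.
by apply: eq_measure_integral => A mA _; exact: XY.
Qed.

Section product_rule.
Context (R : realType) (d : measure_display) (T : measurableType d)
  (P : probability T R) (I : finType).

Lemma indic_bigcap (A : I -> set T) w :
  \1_(\bigcap_i A i) w = \prod_i \1_(A i) w :> R.
Proof.
have [h|] := pselect (forall i, A i w).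
  rewrite big1 => [|i _]; last by rewrite indicE mem_set.
  by rewrite indicE mem_set.
move=> /existsNP[i hi]; rewrite (bigD1 i)//= [in RHS]indicE memNset// mul0r.
by rewrite indicE memNset// => /(_ i Logic.I).
Qed.

(** Independence speaks of sets. Each factor is replaced by a step function on cells of width
    [1 / m.+1]; the product of sums is expanded by distributivity, the rule for sets applies to
    every term, and the factors are reassembled. *)
Lemma Ex_prod_unit (g : I -> T -> R) : (forall i, measurable_fun setT (g i)) ->
  (forall i w, 0 <= g i w <= 1) ->
  (forall B : I -> set R, (forall i, measurable (B i)) ->
     fine (P (\bigcap_i (g i @^-1` B i))) = \prod_i fine (P (g i @^-1` B i))) ->
  Ex P (fun w => \prod_i g i w) = \prod_i Ex P (g i).
Proof.
move=> mg g01 gP.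
have bg i : bounded_measurable (g i).
  by split=> //; exists 1 => w; rewrite ger0_norm; case/andP: (g01 i w).
(* Replacing the [g i] by step functions costs [#|I| / m.+1] on each side of the identity. *)
suff h (m : nat) : `|Ex P (fun w => \prod_i g i w) - \prod_i Ex P (g i)|
    <= 2 * #|I|%:R / m.+1%:R.
  apply/eqP; rewrite -subr_eq0 -normr_eq0; apply/eqP/le_anti.
  rewrite normr_ge0 andbT; apply/ler_addgt0Pr => e e0; rewrite add0r.
  have [k hk] : exists k : nat, 2 * #|I|%:R / e < k.+1%:R.
    by exists (Num.truncn (2 * #|I|%:R / e)); exact: truncnS_gt.
  rewrite (le_trans (h k))// ler_pdivrMr// [e * _]mulrC -ler_pdivrMr// (ltW hk)//.
(* [m.+2] cells rather than [m.+1]: the last one catches the value 1. *)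
pose S i (a : 'I_m.+2) := g i @^-1` `[a%:R / m.+1%:R, a.+1%:R / m.+1%:R[.
have mS i a : measurable (S i a).
  by rewrite -[S i a]setTI; apply: mg => //; exact: measurable_itv.
pose q i w : R := \sum_(a < m.+2) a%:R / m.+1%:R * \1_(S i a) w.
have bq i : bounded_measurable (q i).
  by apply: bm_sum => a; apply: bmM; [exact: bm_cst|exact: bm_indic].
have qE i w : exists a : 'I_m.+2, q i w = a%:R / m.+1%:R /\
    a%:R / m.+1%:R <= g i w < a.+1%:R / m.+1%:R.
  have /andP[g0 g1] := g01 i w.
  have mg0 : 0 <= m.+1%:R * g i w by rewrite mulr_ge0.
  have /andP[t1 t2] := truncn_itv mg0.
  have tm : (Num.truncn (m.+1%:R * g i w) < m.+2)%N.
    rewrite -(@ltr_nat R) (le_lt_trans t1)//.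
    by rewrite (@le_lt_trans _ _ m.+1%:R) ?ltr_nat// ler_piMr.
  pose a := Ordinal tm; exists a.
  have ha : a%:R / m.+1%:R <= g i w < a.+1%:R / m.+1%:R.
    by rewrite ler_pdivrMr// ltr_pdivlMr// ![g i w * _]mulrC t1.
  split => //; rewrite /q (bigD1 a)//= big1 => [|b ba].
    by rewrite addr0 indicE mem_set ?mulr1// /S/= in_itv.
  rewrite indicE memNset ?mulr0// /S/= in_itv/= => /andP[b1 b2].
  case/andP: ha => a1 a2; move: ba; rewrite -val_eqE/= neq_ltn => /orP[].
    move=> ba; have : b.+1%:R / m.+1%:R <= a%:R / m.+1%:R :> R.
      by rewrite ler_pM2r ?invr_gt0// ler_nat.
    by move=> /(lt_le_trans b2)/lt_le_trans/(_ a1); rewrite ltxx.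
  move=> ba; have : a.+1%:R / m.+1%:R <= b%:R / m.+1%:R :> R.
    by rewrite ler_pM2r ?invr_gt0// ler_nat.
  by move=> /(lt_le_trans a2)/lt_le_trans/(_ b1); rewrite ltxx.
have gq i w : `|g i w - q i w| <= m.+1%:R^-1.
  have [a [-> /andP[a1 a2]]] := qE i w; rewrite ger0_norm ?subr_ge0//.
  by rewrite lerBlDl; move: a2; rewrite -[a.+1]addn1 natrD mulrDl mul1r => /ltW.
have q01 i w : 0 <= q i w <= 1.
  have [a [-> /andP[a1 a2]]] := qE i w; rewrite (le_trans a1) ?andbT.
    by rewrite divr_ge0.
  by case/andP: (g01 i w).
have Ex01 (f : T -> R) : bounded_measurable f -> (forall w, 0 <= f w <= 1) ->
    0 <= Ex P f <= 1.
  move=> bf f01; rewrite Ex_ge0 => [|w]; last by case/andP: (f01 w).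
  rewrite -[leRHS](Ex_cst P) le_Ex//; first exact: bm_cst.
  by move=> w; case/andP: (f01 w).
have Eq : Ex P (fun w => \prod_i q i w) = \prod_i Ex P (q i).
  transitivity (\sum_(f : {ffun I -> 'I_m.+2})
      (\prod_i ((f i)%:R / m.+1%:R)) * fine (P (\bigcap_i S i (f i)))).
    under eq_Ex => w.
      rewrite bigA_distr_bigA/=; under eq_bigr => f _.
        rewrite big_split/= -indic_bigcap; over.
      over.
    have mb (f : {ffun I -> 'I_m.+2}) : measurable (\bigcap_i S i (f i)).
      by apply: fin_bigcap_measurable => // i _.
    rewrite Ex_sum => [|f]; last by apply: bmM; [exact: bm_cst|exact: bm_indic].
    by apply: eq_bigr => f _; rewrite ExZ ?Ex_indic//; exact: bm_indic.
  under [RHS]eq_bigr => i _.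
    rewrite Ex_sum => [|a]; last by apply: bmM; [exact: bm_cst|exact: bm_indic].
    under eq_bigr => a _.
      rewrite ExZ ?Ex_indic//; last exact: bm_indic.
      over.
    over.
  rewrite bigA_distr_bigA/=; apply: eq_bigr => f _; rewrite [RHS]big_split/=.
  by congr (_ * _); apply: gP => i; exact: measurable_itv.
have sumI : \sum_(i : I) m.+1%:R^-1 = #|I|%:R / m.+1%:R :> R.
  by rewrite sumr_const mulr_natl.
have -> : Ex P (fun w => \prod_i g i w) - \prod_i Ex P (g i) =
  (Ex P (fun w => \prod_i g i w) - Ex P (fun w => \prod_i q i w)) +
  (\prod_i Ex P (q i) - \prod_i Ex P (g i)) by rewrite Eq; ring.
rewrite (le_trans (ler_normD _ _))// -mulrA mulr_natl mulr2n lerD//.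
  apply: Ex_dist; [exact: bm_prod|exact: bm_prod|move=> w].
  by rewrite (le_trans (ler_norm_prodB _ _ _))// -sumI ler_sum.
rewrite (le_trans (ler_norm_prodB _ _ _))// => [i|i|]; [exact: Ex01|exact: Ex01|].
by rewrite -sumI ler_sum// => i _; rewrite distrC; exact: Ex_dist.
Qed.

Lemma Ex_prod (X : I -> T -> R) (h : I -> R -> R) :
  (forall i, measurable_fun setT (X i)) ->
  (forall i, measurable_fun setT (h i)) -> (forall i x, 0 <= h i x <= 1) ->
  (forall B : I -> set R, (forall i, measurable (B i)) ->
     fine (P (\bigcap_i (X i @^-1` B i))) = \prod_i fine (P (X i @^-1` B i))) ->
  Ex P (fun w => \prod_i h i (X i w)) = \prod_i Ex P (fun w => h i (X i w)).
Proof.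
move=> mX mh h01 hX; apply: Ex_prod_unit => // [i|B mB].
  exact: measurableT_comp.
apply: (hX (fun i => h i @^-1` B i)) => i.
by rewrite -[X in measurable X]setTI; exact: mh.
Qed.

End product_rule.

(** * Moduli of continuity *)

Section near_sides.
Context (R : realType).

Lemma at_right_ball (t : R) (Q : R -> Prop) : (\forall s \near t^'+, Q s) ->
  exists2 r, 0 < r & forall s, t < s < t + r -> Q s.
Proof.
rewrite near_withinE => /nbhs_ballP[r /= r0 h]; exists r => // s /andP[ts sr].
by apply: h => //; rewrite /ball/= ltr_norml; apply/andP; split; lra.
Qed.

Lemma at_left_ball (t : R) (Q : R -> Prop) : (\forall s \near t^'-, Q s) ->
  exists2 r, 0 < r & forall s, t - r < s < t -> Q s.
Proof.
rewrite near_withinE => /nbhs_ballP[r /= r0 h]; exists r => // s /andP[ts sr].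
by apply: h => //; rewrite /ball/= ltr_norml; apply/andP; split; lra.
Qed.

Lemma ball_at_right (t r : R) (Q : R -> Prop) : 0 < r ->
  (forall s, t < s < t + r -> Q s) -> \forall s \near t^'+, Q s.
Proof.
move=> r0 h; near=> s; apply: h; apply/andP; split; first by near: s; exact: nbhs_right_gt.
by near: s; apply: nbhs_right_lt; lra.
Unshelve. all: by end_near. Qed.

Lemma ball_at_left (t r : R) (Q : R -> Prop) : 0 < r ->
  (forall s, t - r < s < t -> Q s) -> \forall s \near t^'-, Q s.
Proof.
move=> r0 h; near=> s; apply: h; apply/andP; split; last by near: s; exact: nbhs_left_lt.
by near: s; apply: nbhs_left_gt; lra.
Unshelve. all: by end_near. Qed.

Lemma cvg_at_right_dist (t l : R) (x : R -> R) (e : R) :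
  x s @[s --> t^'+] --> l -> 0 < e ->
  exists2 r, 0 < r & forall s, t < s < t + r -> `|l - x s| < e.
Proof.
by move=> h e0; apply: at_right_ball; move: h => /cvgrPdist_lt; exact.
Qed.

Definition right_continuous_path (x : R -> R) :=
  forall t, 0 <= t -> x s @[s --> t^'+] --> x t.

(* The modulus of continuity of [x] on [0, h[ is not below [e] at scale [del];
   for right-continuous paths rational times suffice, which makes the event
   measurable. *)
Definition rough (del e h : R) (x : R -> R) : Prop :=
  exists p q : rat, [/\ 0 <= (ratr p : R) < h, 0 <= (ratr q : R) < h,
    `|(ratr p : R) - ratr q| < del & e < `|x (ratr p) - x (ratr q)|].

(** A violation at real times [s], [t] persists at rational times slightly to their right, because
    [x] is right continuous and the conditions in [rough] survive small moves to the right. *)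
Lemma smooth_modulus (del e h : R) (x : R -> R) (s t : R) :
  right_continuous_path x -> ~ rough del e h x ->
  0 <= s < h -> 0 <= t < h -> `|s - t| < del -> `|x s - x t| <= e.
Proof.
move=> rx nx /andP[s0 sh] /andP[t0 th] st; rewrite leNgt; apply/negP => exst.
pose e' := (`|x s - x t| - e) / 2.
have e'0 : 0 < e' by rewrite divr_gt0// subr_gt0.
have [r r0 hr] := cvg_at_right_dist (rx _ s0) e'0.
have [r' r'0 hr'] := cvg_at_right_dist (rx _ t0) e'0.
(* Keeps both rational times below [h] and their distance below [del]; [r] and [r'] come from right
   continuity. *)
pose m := Num.min (Num.min r r') (Num.min (Num.min (h - s) (h - t)) ((del - `|s - t|) / 2)).
have m0 : 0 < m by rewrite !lt_min r0 r'0 !subr_gt0 sh th divr_gt0// subr_gt0.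
have [mr [mr' [ms [mt md]]]] : m <= r /\ m <= r' /\ m <= h - s /\ m <= h - t /\
    m <= (del - `|s - t|) / 2.
  by rewrite !ge_min !lexx ?orbT.
have /rat_in_itvoo[p] : s < s + m by rewrite ltrDl.
rewrite in_itv/= => /andP[sp ps].
have /rat_in_itvoo[q] : t < t + m by rewrite ltrDl.
rewrite in_itv/= => /andP[tq qt].
have xp : `|x s - x (ratr p)| < e' by apply: hr; rewrite sp/=; lra.
have xq : `|x t - x (ratr q)| < e' by apply: hr'; rewrite tq/=; lra.
apply: nx; exists p, q; split.
- by apply/andP; split; lra.
- by apply/andP; split; lra.
- have -> : ratr p - ratr q = (ratr p - s) - (ratr q - t) + (s - t) :> R by ring.
  rewrite (le_lt_trans (ler_normD _ _))//.
  suff : `|ratr p - s - (ratr q - t)| < (del - `|s - t|) / 2 *+ 2 by rewrite -mulr_natr; lra.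
  rewrite mulr2n (le_lt_trans (ler_normB _ _))// ltrD//.
    by rewrite ger0_norm; lra.
  by rewrite ger0_norm; lra.
- have : `|x s - x t| <= `|x s - x (ratr p)| + `|x (ratr p) - x (ratr q)| + `|x t - x (ratr q)|.
    rewrite [`|x t - _|]distrC.
    have -> : x s - x t = (x s - x (ratr p)) + (x (ratr p) - x (ratr q)) + (x (ratr q) - x t) by ring.
    by rewrite (le_trans (ler_normD _ _))// lerD2r ler_normD.
  move: xp xq; rewrite /e'; lra.
Qed.

Lemma rough_measurable (d : measure_display) (T : measurableType d)
    (X : T -> R -> R) (del e h : R) :
  (forall t, 0 <= t -> measurable_fun setT (X ^~ t)) ->
  measurable [set w | rough del e h (X w)].
Proof.
move=> mX.
rewrite (_ : [set w | _] = \bigcup_(p : rat) \bigcup_(q : rat)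
    [set w | [/\ 0 <= (ratr p : R) < h, 0 <= (ratr q : R) < h,
    `|(ratr p : R) - ratr q| < del & e < `|X w (ratr p) - X w (ratr q)|] ]); last first.
  apply/seteqP; split=> w /=.
    by move=> [p [q H]]; exists p => //; exists q.
  by move=> [p _ [q _ H]]; exists p, q.
apply: bigcupT_measurable_rat => p; apply: bigcupT_measurable_rat => q.
have [/andP[p0 ph]|np] := boolP (0 <= (ratr p : R) < h); last first.
  by rewrite (_ : [set w | _] = set0)//; apply/seteqP; split=> w //= -[].
have [/andP[q0 qh]|nq] := boolP (0 <= (ratr q : R) < h); last first.
  by rewrite (_ : [set w | _] = set0)//; apply/seteqP; split=> w //= -[].
have [pq|npq] := boolP (`|(ratr p : R) - ratr q| < del); last first.
  by rewrite (_ : [set w | _] = set0)//; apply/seteqP; split=> w //= -[].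
rewrite (_ : [set w | _] =
    (fun w => `|X w (ratr p) - X w (ratr q)|) @^-1` `]e, +oo[); last first.
  by apply/seteqP; split=> w /=; rewrite in_itv/= andbT; [case|].
rewrite -[X in measurable X]setTI.
have : measurable_fun setT (fun w => `|X w (ratr p) - X w (ratr q)|).
  by apply: measurableT_comp => //; apply: measurable_funB; exact: mX.
by apply => //; exact: measurable_itv.
Qed.

Lemma continuous_smooth (x : R -> R) (e h : R) :
  {within `[0, +oo[, continuous x} -> 0 < e ->
  exists2 del, 0 < del & ~ rough del e h x.
Proof.
move=> /subspace_continuousP cx e0.
(* Uniform continuity from compactness in covering form: the scale [del] runs along the auxiliary
   filter at 0 from the right. *)
have := @segment_compact R 0 h; rewrite compact_near_coveringP.
move=> /(_ _ (0^'+ : set_system R) (fun del s => 0 <= s ->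
  forall t, 0 <= t -> `|s - t| < del -> `|x s - x t| <= e) _).
case=> [s /=|].
  rewrite in_itv/= => /andP[s0 sh].
  have : `[0, +oo[%classic s by rewrite /= in_itv/= s0.
  move=> /cx /cvgrPdist_lt /(_ _ (divr_gt0 e0 (ltr0n _ 2))).
  rewrite near_withinE => /nbhs_ballP[r /= r0 hr].
  have r20 : 0 < r / 2 by rewrite divr_gt0.
  exists (ball s (r / 2), [set del | del < r / 2]) => /=.
    by split; [exact: nbhsx_ballx|exact: nbhs_right_lt].
  move=> [s' del] /= [ss' dr] s'0 t t0 s't.
  have h1 : `|x s - x s'| < e / 2.
    apply: hr; last by rewrite /= in_itv/= s'0.
    by apply: le_ball ss'; lra.
  have h2 : `|x s - x t| < e / 2.
    apply: hr; last by rewrite /= in_itv/= t0.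
    rewrite /ball/= (_ : s - t = (s - s') + (s' - t)); last by ring.
    rewrite (le_lt_trans (ler_normD _ _))// [r]splitr ltrD//.
    by rewrite (lt_trans s't).
  rewrite (_ : x s' - x t = (x s - x t) - (x s - x s')); last by ring.
  rewrite (le_trans (ler_normB _ _))// [e]splitr; lra.
move=> r /= r0 hr; exists (r / 2); first by rewrite divr_gt0.
move=> [p [q [/andP[p0 ph] /andP[q0 qh] pq]]]; apply/negP; rewrite -leNgt.
have := hr (r / 2); apply => //=.
- by rewrite sub0r normrN gtr0_norm; lra.
- by lra.
- by rewrite in_itv/= p0 ltW.
Qed.

End near_sides.

(** * Cut-offs and functionals continuous in J1 *)

Section ramp.
Context (R : realType).

Definition ramp (u : R) : R := Num.min 1 (Num.max 0 u).

Lemma ramp01 u : 0 <= ramp u <= 1.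
Proof. by rewrite /ramp le_min ler01 le_max lexx ge_min lexx. Qed.

Lemma ramp_ge1 u : 1 <= u -> ramp u = 1.
Proof. by move=> u1; apply/min_idPl; rewrite le_max u1 orbT. Qed.

Lemma ramp_le0 u : u <= 0 -> ramp u = 0.
Proof. by move=> u0; rewrite /ramp (max_idPl u0); apply/min_idPr. Qed.

Lemma rampP u : [\/ u <= 0 /\ ramp u = 0, 0 <= u <= 1 /\ ramp u = u |
  1 <= u /\ ramp u = 1].
Proof.
have [u0|u0] := leP u 0; first by apply: Or31; rewrite ramp_le0.
have [u1|u1] := leP 1 u; first by apply: Or33; rewrite ramp_ge1.
apply: Or32; rewrite (ltW u0) (ltW u1); split => //.
by rewrite /ramp (max_idPr (ltW u0)); apply/min_idPr; exact: ltW.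
Qed.

Lemma ramp_lip u v : `|ramp u - ramp v| <= `|u - v|.
Proof.
wlog uv : u v / v <= u.
  move=> h; have [/h//|/ltW/h] := leP v u.
  by rewrite distrC [leRHS]distrC.
rewrite [leRHS]ger0_norm ?subr_ge0//.
by rewrite ger0_norm; case: (rampP u) => -[? ->]; case: (rampP v) => -[? ->]; lra.
Qed.

Lemma ramp_measurable : measurable_fun setT ramp.
Proof.
by apply: measurable_minr => //; apply: measurable_maxr.
Qed.

End ramp.

Section supF.
Context (R : realType) (J : Type) (k G : (J -> R) -> R) (H C : R).
Hypothesis k01 : forall s, 0 <= k s <= 1.
Hypothesis G01 : forall s, 0 <= G s <= 1.
Hypothesis k_lip : forall s s' (e : R), 0 <= e -> (forall j, `|s j - s' j| <= e) ->
  `|k s - k s'| <= C * e.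
Hypothesis G_lip : forall s s' (e : R), 0 <= e -> (forall j, `|s j - s' j| <= e) ->
  `|G s - G s'| <= C * e.
Hypothesis k_supp : forall s, k s != 0 -> forall j, s j <= H.

(** The value at a fixed time is not continuous in J1. Here the times may move, weighted by [k]: a
    time change that distorts the path carries nearly optimal times along, and the Lipschitz bounds
    on [k] and [G] absorb the rest. *)
Definition supF (x : R -> R) : R :=
  sup [set k s * G (x \o s) | s in [set s : J -> R | forall j, 0 <= s j]].

Let kG01 s a : 0 <= k s * G a <= 1.
Proof.
have /andP[k0 k1] := k01 s; have /andP[g0 g1] := G01 a.
by rewrite mulr_ge0//= mulr_ile1.
Qed.

Lemma supF_ub x s : (forall j, 0 <= s j) -> k s * G (x \o s) <= supF x.
Proof.
move=> s0; apply: ub_le_sup; last by exists s.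
by exists 1 => _ [s' _ <-]; case/andP: (kG01 s' (x \o s')).
Qed.

Lemma supF_le x M : (forall s, (forall j, 0 <= s j) -> k s * G (x \o s) <= M) ->
  supF x <= M.
Proof.
move=> h; apply: ge_sup; last by move=> _ [s s0 <-]; exact: h.
by exists (k (fun=> 0) * G (x \o (fun=> 0))), (fun=> 0).
Qed.

Lemma supF01 x : 0 <= supF x <= 1.
Proof.
apply/andP; split; last first.
  by apply: supF_le => s _; case/andP: (kG01 s (x \o s)).
apply: le_trans (@supF_ub x (fun=> 0) _) => //.
by case/andP: (kG01 (fun=> 0) (x \o (fun=> 0))).
Qed.

Lemma kG_lip (e : R) s s' a a' : 0 <= e -> (forall j, `|s j - s' j| <= e) ->
  (forall j, `|a j - a' j| <= e) ->
  k s * G a <= k s' * G a' + 2 * C * e.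
Proof.
move=> e0 /(k_lip e0) ks /(G_lip e0) Ga.
have /andP[k0 k1] := k01 s; have /andP[g0 g1] := G01 a.
have /andP[k'0 k'1] := k01 s'; have /andP[g'0 g'1] := G01 a'.
have := ler_normlW (ks : `|k s - k s'| <= C * e).
have := ler_normlW (Ga : `|G a - G a'| <= C * e).
move=> h1 h2.
have h3 : (k s - k s') * G a <= C * e.
  have [c|c] := leP 0 (k s - k s'); first by rewrite (le_trans _ h2)// ler_piMr.
  rewrite (@le_trans _ _ 0) ?(le_trans _ ks)//.
  by rewrite nmulr_rle0.
have h4 : k s' * (G a - G a') <= C * e.
  have [c|c] := leP 0 (G a - G a'); first by rewrite (le_trans _ h1)// ler_piMl.
  rewrite (@le_trans _ _ 0) ?(le_trans _ Ga)//.
  by rewrite mulr_ge0_le0// ltW.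
lra.
Qed.

(** If [y] follows [x] through the time change [l], a tuple [s] for [x] is answered by [l \o s] for
    [y], and a tuple for [y] by its preimage under [l], both at a cost of order [e']. *)
Lemma supF_continuous : 0 <= C -> continuous (supF : skorohod R^o -> R).
Proof.
move=> C0 x.
apply/(@cvgrPdist_le _ _ _ _ (@filter_filter _ _ (J1_nbhs_filter x))) => e e0.
pose e' := Num.min 1 (e / (2 * C + 1)).
have C1 : 0 < 2 * C + 1 by lra.
have e'0 : 0 < e' by rewrite lt_min ltr01 divr_gt0.
have e'1 : e' <= 1 by rewrite ge_min lexx.
have Ce : 2 * C * e' <= e.
  rewrite (@le_trans _ _ ((2 * C + 1) * e'))//.
    by rewrite ler_pM2r//; lra.
  by rewrite mulrC -ler_pdivlMr// ge_min lexx orbT.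
(* Preimages of times up to [H] may exceed [H] by [e' <= 1], hence the horizon [H + 1]. *)
exists (H + 1, e') => //= y [l [tl l1 l2]].
have [[lf _ lsurj] _] := tl.
have l0 t : 0 <= t -> 0 <= l t.
  by move=> t0; have := lf t; rewrite /= !in_itv/= !andbT => ->.
have lex t : 0 <= t -> exists2 s, 0 <= s & l s = t.
  move=> t0; have [|s /= + <-] := lsurj t; first by rewrite /= in_itv/= t0.
  by rewrite in_itv/= andbT => s0; exists s.
rewrite ler_distlC; apply/andP; split.
- rewrite lerBlDr; apply: supF_le => s s0.
  have [->|ks] := eqVneq (k s) 0.
    by rewrite mul0r addr_ge0 ?(ltW e0)//; case/andP: (supF01 y).
  have sH := k_supp ks.
  apply: le_trans (@kG_lip e' s (l \o s) (x \o s) (y \o (l \o s)) (ltW e'0) _ _) _.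
  + by move=> j; rewrite distrC ltW// l1.
  + by move=> j; rewrite distrC ltW// l2//= s0 (le_trans (sH j))// lerDl.
  by rewrite lerD// supF_ub// => j; exact: l0.
- apply: supF_le => s s0.
  have [->|ks] := eqVneq (k s) 0.
    by rewrite mul0r addr_ge0 ?(ltW e0)//; case/andP: (supF01 x).
  have sH := k_supp ks.
  have [s' hs'] : {s' : J -> R & forall j, 0 <= s' j /\ l (s' j) = s j}.
    by apply: (@choice J R (fun j u => 0 <= u /\ l u = s j)) => j; have [u u0 <-] := lex _ (s0 j); exists u.
  have s'0 j : 0 <= s' j by case: (hs' j).
  have {hs'} ls' : s = l \o s' by apply/funext => j; case: (hs' j).
  have s'e j : `|s j - s' j| <= e' by rewrite ls' ltW// l1.
  have s'H j : s' j <= H + 1.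
    have := s'e j; rewrite ler_distlC => /andP[_ h].
    by rewrite (le_trans h)// lerD.
  apply: le_trans (@kG_lip e' s s' (y \o s) (x \o s') (ltW e'0) s'e _) _.
    by move=> j; rewrite ls' ltW// l2//= s'0 s'H.
  by rewrite lerD// supF_ub.
Qed.

End supF.

Lemma probability_fine_le (R : realType) (d : measure_display)
    (T : measurableType d) (P : probability T R) (A B : set T) :
  measurable A -> measurable B -> A `<=` B -> fine (P A) <= fine (P B).
Proof.
move=> mA mB AB; rewrite fine_le ?fin_num_measure//.
by apply: le_measure => //; rewrite inE.
Qed.

Lemma rough_le (R : realType) (del del' e e' h h' : R) (x : R -> R) :
  del <= del' -> e' <= e -> h <= h' ->
  rough del e h x -> rough del' e' h' x.
Proof.
move=> dd ee hh [p [q [/andP[p0 ph] /andP[q0 qh] pq xpq]]].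
exists p, q; split; rewrite ?p0 ?q0/=.
- exact: lt_le_trans ph hh.
- exact: lt_le_trans qh hh.
- exact: lt_le_trans pq dd.
- exact: le_lt_trans xpq.
Qed.

Section continuous_process.
Context (R : realType) (d : measure_display) (T : measurableType d)
  (Q : probability T R) (Y : T -> R -> R).
Hypothesis mY : forall t, 0 <= t -> measurable_fun setT (Y ^~ t).
Hypothesis cY : {ae Q, forall w, {within `[0, +oo[, continuous (Y w)}}.

(** As the scale vanishes, almost every path leaves the rough events, by uniform continuity on
    compacts; dominated convergence does the rest. *)
Lemma rough_prob_small (e h eta : R) : 0 < e -> 0 < eta ->
  exists2 del, 0 < del & fine (Q [set w | rough del e h (Y w)]) < eta.
Proof.
move=> e0 eta0.
have m k := rough_measurable (k.+1%:R^-1) e h mY.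
have : Ex Q (\1_[set w | rough k.+1%:R^-1 e h (Y w)] : T -> R) @[k --> \oo] --> (0 : R).
  apply: (@Ex_cvg0 _ _ _ _ _ 1) => [k|k w|].
  - exact: bm_indic.
  - by rewrite indicE; case: (_ \in _); rewrite ?normr1 ?normr0.
  - apply: filterS cY => w cw.
    have [r r0 hr] := continuous_smooth (e := e) h cw e0.
    apply: cvg_near_cst; near=> k; rewrite indicE memNset// => /=.
    apply: contra_not hr; apply: rough_le => //.
    by apply: ltW; near: k; exact: (near_infty_natSinv_lt (PosNum r0)).
move=> /cvgrPdist_lt /(_ _ eta0)[k _ /(_ k (leqnn _))] /=.
rewrite sub0r normrN Ex_indic// => h'; exists k.+1%:R^-1; rewrite ?invr_gt0//.
exact: le_lt_trans (ler_norm _) h'.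
Unshelve. all: by end_near. Qed.

End continuous_process.

(** * Moduli and values at fixed times along convergence in distribution *)

Section transfer.
Context (R : realType) (d : nat -> measure_display)
  (T : forall n, measurableType (d n)) (P : forall n, probability (T n) R)
  (X : forall n, T n -> R -> R)
  (d' : measure_display) (T' : measurableType d') (Q : probability T' R)
  (Y : T' -> R -> R).
Hypothesis XY : @cvg_in_distribution R R^o d T P (@X) d' T' Q Y.
Hypothesis rX : forall n w, right_continuous_path (@X n w).
Hypothesis mX : forall n t, 0 <= t -> measurable_fun setT (@X n ^~ t).
Hypothesis rY : forall w, right_continuous_path (Y w).
Hypothesis mY : forall t, 0 <= t -> measurable_fun setT (Y ^~ t).
Hypothesis cY : {ae Q, forall w, {within `[0, +oo[, continuous (Y w)}}.

Lemma cvg_in_distribution_Ex (F : (R -> R) -> R) :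
  continuous (F : skorohod R^o -> R) -> (forall x, 0 <= F x <= 1) ->
  Ex (P n) (fun w => F (@X n w)) @[n --> \oo] --> Ex Q (fun w => F (Y w)).
Proof.
move=> cF F01.
have F0 x : 0 <= F x by case/andP: (F01 x).
have : ('E_(P n)[F \o @X n] @[n --> \oo] --> 'E_Q[F \o Y])%E.
  apply: XY; first exact: continuous_subspaceT.
  by exists 1 => x _; rewrite ger0_norm//; case/andP: (F01 x).
have -> : ('E_Q[F \o Y] = (Ex Q (fun w => F (Y w)))%:E)%E.
  by rewrite unlock /Ex /Rintegral fineK//; apply: (@ge0_fin_num_integral _ _ _ _ 1).
move=> /fine_cvg; apply: cvg_trans.
rewrite (_ : (fun n => Ex _ _) = (fun n => fine ('E_(P n)[F \o @X n])%E))//.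
by apply/funext => n; rewrite unlock.
Qed.

(** Two moving times detect roughness. [supF k G] is at least the indicator of [rough (del / 2) e h]
    and at most that of [rough del (e / 2) (h + 1)]; its expectation converges, so smallness passes
    from the limit to the sequence. *)
Lemma rough_transfer (e h eta : R) : 0 < e -> 0 < h -> 0 < eta ->
  exists2 del, 0 < del &
    \forall n \near \oo, fine (P n [set w | rough del e h (@X n w)]) < eta.
Proof.
move=> e0 h0 eta0.
have e20 : 0 < e / 2 by rewrite divr_gt0.
have [del del0 hdel] := rough_prob_small mY cY (h + 1) e20 eta0.
exists (del / 2); first by rewrite divr_gt0.
(* [k] is 1 for times up to [h] at distance at most [del / 2], and vanishes for times beyond [h + 1]
   or at distance [del] or more; [G] climbs from 0 at oscillation [e / 2] to 1 at [e]. *)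
pose k (s : bool -> R) := ramp (2 - 2 / del * `|s true - s false|) *
  (ramp (h + 1 - s true) * ramp (h + 1 - s false)).
pose G (a : bool -> R) := ramp (2 / e * `|a true - a false| - 1).
pose C := Num.max (4 / del + 2) (4 / e).
have C0 : 0 <= C by rewrite le_max addr_ge0// divr_ge0// ltW.
have dp : 0 <= 2 / del by rewrite divr_ge0// ltW.
have ep : 0 <= 2 / e by rewrite divr_ge0// ltW.
have d4 : 4 / del + 2 <= C by rewrite le_max lexx.
have e4 : 4 / e <= C by rewrite le_max lexx orbT.
have diff (s s' : bool -> R) (u : R) : (forall j, `|s j - s' j| <= u) ->
    `| `|s true - s false| - `|s' true - s' false| | <= 2 * u.
  move=> ss; rewrite (le_trans (ler_dist_dist _ _))//.
  rewrite (_ : _ - _ = (s true - s' true) - (s false - s' false)); last by ring.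
  by rewrite (le_trans (ler_normB _ _))// mulr_natl mulr2n lerD.
have k01 s : 0 <= k s <= 1.
  have [/andP[a0 a1] /andP[b0 b1] /andP[c0 c1]] := And3
    (ramp01 (2 - 2 / del * `|s true - s false|))
    (ramp01 (h + 1 - s true)) (ramp01 (h + 1 - s false)).
  by rewrite !mulr_ge0//= !mulr_ile1// ?mulr_ge0// mulr_ile1.
have mul_dist (a b a' b' : R) : 0 <= a <= 1 -> 0 <= b' <= 1 ->
    `|a * b - a' * b'| <= `|a - a'| + `|b - b'|.
  move=> /andP[a0 a1] /andP[b0 b1].
  rewrite (_ : _ - _ = (a - a') * b' + a * (b - b')); last by ring.
  rewrite (le_trans (ler_normD _ _))// !normrM lerD//.
    by rewrite ler_piMr// ger0_norm.
  by rewrite ler_piMl// ger0_norm.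
have k_lip s s' (u : R) : 0 <= u -> (forall j, `|s j - s' j| <= u) ->
    `|k s - k s'| <= C * u.
  move=> u0 ss.
  have ramp2 (x y : R) : 0 <= ramp x * ramp y <= 1.
    have /andP[a0 a1] := ramp01 x; have /andP[b0 b1] := ramp01 y.
    by rewrite mulr_ge0//= mulr_ile1.
  apply: (@le_trans _ _ ((4 / del + 2) * u)); last by rewrite ler_wpM2r.
  rewrite /k (le_trans (mul_dist _ _ _ _ _ _))// ?ramp01//.
  rewrite [leRHS]mulrDl; apply: lerD.
    rewrite (le_trans (ramp_lip _ _))//.
    rewrite (_ : _ - _ = 2 / del * (`|s' true - s' false| - `|s true - s false|)); last by ring.
    rewrite normrM gtr0_norm ?divr_gt0// distrC.
    rewrite (_ : 4 / del * u = 2 / del * (2 * u)); last by field; rewrite gt_eqF.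
    by rewrite ler_wpM2l// diff.
  rewrite (le_trans (mul_dist _ _ _ _ _ _))// ?ramp01//.
  rewrite mulr_natl mulr2n lerD// (le_trans (ramp_lip _ _))//.
    by rewrite (_ : _ - _ = s' true - s true) 1?distrC//; ring.
  by rewrite (_ : _ - _ = s' false - s false) 1?distrC//; ring.
have G_lip s s' (u : R) : 0 <= u -> (forall j, `|s j - s' j| <= u) ->
    `|G s - G s'| <= C * u.
  move=> u0 ss.
  apply: (@le_trans _ _ (4 / e * u)); last by rewrite ler_wpM2r.
  rewrite (le_trans (ramp_lip _ _))//.
  rewrite (_ : _ - _ = 2 / e * (`|s true - s false| - `|s' true - s' false|)); last by ring.
  rewrite normrM gtr0_norm ?divr_gt0//.
  rewrite (_ : 4 / e * u = 2 / e * (2 * u)); last by field; rewrite gt_eqF.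
  by rewrite ler_wpM2l// diff.
have k_supp s : k s != 0 -> forall j, s j <= h + 1.
  move=> ks j; rewrite leNgt; apply: contra ks => sj; apply/eqP; rewrite /k.
  have rj : ramp (h + 1 - s j) = 0 by apply: ramp_le0; lra.
  by case: j rj {sj} => ->; rewrite !(mul0r, mulr0).
have F01 := supF01 k01 (fun a => ramp01 _ : 0 <= G a <= 1).
have cF := cvg_in_distribution_Ex
  (supF_continuous k01 (fun a => ramp01 _ : 0 <= G a <= 1) k_lip G_lip k_supp C0) F01.
have QF : Ex Q (fun w => supF k G (Y w)) < eta.
  apply: le_lt_trans hdel; rewrite -Ex_indic; last exact: rough_measurable.
  apply: (@ge0_le_Ex _ _ _ _ 1) => [w|w|w].
  - by case/andP: (F01 (Y w)).
  - rewrite indicE; have [h'|h'] := boolP (w \in _); first by case/andP: (F01 (Y w)).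
    apply: supF_le => s s0; have [->|ks] := eqVneq (k s) 0; first by rewrite mul0r.
    rewrite [G _]ramp_le0 ?mulr0//.
    have sh j : s j < h + 1.
      rewrite ltNge; apply: contra ks => sj; apply/eqP; rewrite /k.
      have rj : ramp (h + 1 - s j) = 0 by apply: ramp_le0; lra.
      by case: j rj {sj} => ->; rewrite !(mul0r, mulr0).
    have sd : `|s true - s false| < del.
      rewrite ltNge; apply: contra ks => sj; apply/eqP; rewrite /k.
      rewrite [ramp (2 - _)]ramp_le0 ?mul0r// subr_le0.
      rewrite -[leLHS](_ : 2 / del * del = 2); last by rewrite divfK// gt_eqF.
      by rewrite ler_wpM2l.
    rewrite subr_le0 -[leRHS](_ : 2 / e * (e / 2) = 1); last first.
      by field; rewrite gt_eqF.
    rewrite ler_wpM2l//.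
    apply: (@smooth_modulus _ del (e / 2) (h + 1)) => //; rewrite ?s0 ?sh//.
    by move=> hr; move: h'; rewrite notin_setE; apply.
  - by rewrite indicE; case: (_ \in _).
near=> n; apply: (@le_lt_trans _ _ (Ex (P n) (fun w => supF k G (@X n w)))); last first.
  by near: n; move: cF => /cvgr_lt; apply.
rewrite -Ex_indic; last exact: (rough_measurable _ _ _ (@mX n)).
apply: (@ge0_le_Ex _ _ _ _ 1) => [w|w|w].
- by rewrite indicE; case: (_ \in _).
- rewrite indicE; have [/set_mem/= [p [q [/andP[p0 ph] /andP[q0 qh] pq xpq]]]|_] :=
    boolP (w \in _); last by case/andP: (F01 (@X n w)).
  pose s (b : bool) : R := if b then ratr p else ratr q.
  apply: (le_trans _ (@supF_ub _ _ _ _ k01 (fun a => ramp01 _ : 0 <= G a <= 1) (@X n w) s _)); last by case.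
  have r1 : 1 <= 2 - 2 / del * `|s true - s false|.
    suff : 2 / del * `|(ratr p : R) - ratr q| <= 1 by rewrite /s; lra.
    rewrite -[leRHS](_ : 2 / del * (del / 2) = 1); last by field; rewrite gt_eqF.
    by rewrite ler_wpM2l// ltW.
  have r2 : 1 <= 2 / e * `|@X n w (s true) - @X n w (s false)| - 1.
    suff : 2 <= 2 / e * `|@X n w (ratr p) - @X n w (ratr q)| by rewrite /s; lra.
    rewrite -[leLHS](_ : 2 / e * e = 2); last by rewrite divfK// gt_eqF.
    by rewrite ler_wpM2l// ltW.
  have r3 : 1 <= h + 1 - s true by rewrite /s; lra.
  have r4 : 1 <= h + 1 - s false by rewrite /s; lra.
  by rewrite /k /G /= (ramp_ge1 r1) (ramp_ge1 r2) (ramp_ge1 r3) (ramp_ge1 r4) !mulr1.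
- by case/andP: (F01 (@X n w)).
Unshelve. all: by end_near. Qed.

Section finite_dimensional.
Context (J : finType) (t : J -> R) (G : (J -> R) -> R) (C : R).
Hypothesis t0 : forall j, 0 <= t j.

(** [k] is a bump around [t] with value 1 at [t], so [supF k K] dominates the value at [t]. For the
    limit, the times that [k] admits are within [del] of [t], and on a path that is not rough this
    changes [K] by at most [C * e]. *)
Let limsup (K : (J -> R) -> R) : (forall a, 0 <= K a <= 1) ->
  (forall a a' (e : R), 0 <= e -> (forall j, `|a j - a' j| <= e) -> `|K a - K a'| <= C * e) ->
  bounded_measurable (fun w => K (Y w \o t)) ->
  forall eta, 0 < eta -> \forall n \near \oo,
    Ex (P n) (fun w => K (@X n w \o t)) <= Ex Q (fun w => K (Y w \o t)) + eta.
Proof.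
move=> K01 K_lip bmK eta eta0.
(* A third of [eta] pays for the Lipschitz error, a third for the rough event; the last makes the
   bound strict, so that it holds for large [n]. *)
pose e := eta / 3 / (`|C| + 1).
have C1 : 0 < `|C| + 1 by rewrite ltr_wpDl.
have e0 : 0 < e by rewrite !divr_gt0.
have Ce : C * e <= eta / 3.
  rewrite (@le_trans _ _ ((`|C| + 1) * e))//.
    by rewrite ler_pM2r// (le_trans (ler_norm _))// lerDl.
  by rewrite /e mulrC divfK// gt_eqF.
pose h := \sum_j t j.
have th j : t j <= h by rewrite /h (bigD1 j)//= lerDl sumr_ge0.
have eta30 : 0 < eta / 3 by rewrite divr_gt0.
have [del' del'0 hdel'] := rough_prob_small mY cY (h + 2) e0 eta30.
pose del := Num.min del' 1.
have del0 : 0 < del by rewrite lt_min del'0 ltr01.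
have del1 : del <= 1 by rewrite ge_min lexx orbT.
have hdel : fine (Q [set w | rough del e (h + 2) (Y w)]) < eta / 3.
  apply: le_lt_trans hdel'; apply: probability_fine_le.
  - exact: rough_measurable.
  - exact: rough_measurable.
  - by move=> w; apply: rough_le => //; rewrite /del ge_min lexx.
have dp : 0 <= 2 / del by rewrite divr_ge0// ltW.
pose k (s : J -> R) := \prod_j ramp (2 - 2 / del * `|s j - t j|).
have k01 s : 0 <= k s <= 1.
  apply/andP; split; first by apply: prodr_ge0 => j _; case/andP: (ramp01 (2 - 2 / del * `|s j - t j|)).
  by apply: prodr_ile1 => j _; exact: ramp01.
have k1 : k t = 1.
  by rewrite /k big1// => j _; rewrite subrr normr0 mulr0 subr0 ramp_ge1// ler1n.
have k_near s j : k s != 0 -> `|s j - t j| < del.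
  move=> ks; rewrite ltNge; apply: contra ks => sj; apply/eqP.
  rewrite /k (bigD1 j)//= ramp_le0 ?mul0r// subr_le0.
  rewrite -[leLHS](_ : 2 / del * del = 2); last by rewrite divfK// gt_eqF.
  by rewrite ler_wpM2l.
pose C' := Num.max C (#|J|%:R * (2 / del)).
have C'0 : 0 <= C' by rewrite le_max [X in _ || X]mulr_ge0 ?orbT.
have [CC' dC'] : C <= C' /\ #|J|%:R * (2 / del) <= C' by rewrite !le_max !lexx orbT.
have K_lip' a a' (u : R) : 0 <= u -> (forall j, `|a j - a' j| <= u) ->
    `|K a - K a'| <= C' * u.
  by move=> u0 aa; rewrite (le_trans (K_lip _ _ _ u0 aa))// ler_wpM2r.
have k_lip s s' (u : R) : 0 <= u -> (forall j, `|s j - s' j| <= u) ->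
    `|k s - k s'| <= C' * u.
  move=> u0 ss; apply: (@le_trans _ _ (#|J|%:R * (2 / del) * u)); last first.
    by rewrite ler_wpM2r.
  rewrite (le_trans (ler_norm_prodB _ _ _))// => [j|j|]; rewrite ?ramp01//.
  rewrite [leRHS](_ : _ = \sum_(j : J) 2 / del * u); last first.
    by rewrite sumr_const -[RHS]mulr_natl -[LHS]mulrA.
  rewrite ler_sum// => j _.
  rewrite (le_trans (ramp_lip _ _))//.
  rewrite (_ : _ - _ = 2 / del * (`|s' j - t j| - `|s j - t j|)); last by ring.
  rewrite normrM ger0_norm// ler_wpM2l// (le_trans (ler_dist_dist _ _))//.
  by rewrite (_ : _ - _ = s' j - s j) 1?distrC//; ring.
have k_supp s : k s != 0 -> forall j, s j <= h + 1.
  move=> ks j; have := k_near s j ks; rewrite ltr_distl => /andP[_ sj].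
  have := th j; lra.
have F01 := supF01 k01 K01.
have cF := cvg_in_distribution_Ex (supF_continuous k01 K01 k_lip K_lip' k_supp C'0) F01.
have mr := rough_measurable del e (h + 2) mY.
have QF : Ex Q (fun w => supF k K (Y w)) < Ex Q (fun w => K (Y w \o t)) + eta.
  apply: (@le_lt_trans _ _ (Ex Q (fun w => (K (Y w \o t) + eta / 3) +
      \1_[set w | rough del e (h + 2) (Y w)] w))).
    apply: (@ge0_le_Ex _ _ _ _ (1 + eta / 3 + 1)) => [w|w|w].
    - by case/andP: (F01 (Y w)).
    - rewrite indicE; have [_|h'] := boolP (w \in _).
        have /andP[_ F1] := F01 (Y w); rewrite (le_trans F1)// lerDr.
        by rewrite addr_ge0 ?(ltW eta30)//; case/andP: (K01 (Y w \o t)).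
      rewrite addr0; apply: supF_le => s s0; have [->|ks] := eqVneq (k s) 0.
        by rewrite mul0r addr_ge0 ?(ltW eta30)//; case/andP: (K01 (Y w \o t)).
      have nr : ~ rough del e (h + 2) (Y w) by move: h'; rewrite notin_setE.
      have /andP[a0 a1] := k01 s; have /andP[b0 _] := K01 (Y w \o s).
      rewrite (@le_trans _ _ (K (Y w \o s)))//; first by rewrite ler_piMl.
      rewrite -lerBlDl (le_trans (ler_norm _))// (le_trans _ Ce)//.
      apply: K_lip => [|j /=]; first exact: ltW.
      apply: (@smooth_modulus _ del e (h + 2) (Y w) (s j) (t j)) => //.
      + by rewrite s0/=; have := k_supp s ks j; lra.
      + by rewrite t0/=; have := th j; lra.
      + exact: k_near.
    - apply: lerD; first by apply: lerD => //; case/andP: (K01 (Y w \o t)).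
      by rewrite indicE; case: (_ \in _).
  rewrite ExD; last 2 first.
  - by apply: bmD => //; exact: bm_cst.
  - exact: bm_indic.
  by rewrite ExD ?Ex_cst ?Ex_indic//; [lra|exact: bm_cst].
near=> n; apply: (@le_trans _ _ (Ex (P n) (fun w => supF k K (@X n w)))); last first.
  by apply: ltW; near: n; move: cF => /cvgr_lt; apply.
apply: (@ge0_le_Ex _ _ _ _ 1) => [w|w|w].
- by case/andP: (K01 (@X n w \o t)).
- have := supF_ub k01 K01 (@X n w) t0; rewrite k1 mul1r; exact.
- by case/andP: (F01 (@X n w)).
Unshelve. all: by end_near. Qed.

(** A supremum bounds from one side only; the other side is the same bound for [1 - G]. *)
Lemma fdd_transfer : (forall a, 0 <= G a <= 1) ->
  (forall a a' (e : R), 0 <= e -> (forall j, `|a j - a' j| <= e) ->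
    `|G a - G a'| <= C * e) ->
  bounded_measurable (fun w => G (Y w \o t)) ->
  (forall n, bounded_measurable (fun w => G (@X n w \o t))) ->
  Ex (P n) (fun w => G (@X n w \o t)) @[n --> \oo] -->
    Ex Q (fun w => G (Y w \o t)).
Proof.
move=> G01 G_lip bY bX; apply/cvgrPdist_le => e e0.
have bY' : bounded_measurable (fun w => 1 - G (Y w \o t)).
  by apply: bmB => //; exact: bm_cst.
have G01' a : 0 <= 1 - G a <= 1 by have := G01 a; lra.
have G_lip' a a' (u : R) : 0 <= u -> (forall j, `|a j - a' j| <= u) ->
    `|1 - G a - (1 - G a')| <= C * u.
  move=> u0 aa; rewrite (_ : _ - _ = G a' - G a) 1?distrC ?G_lip//; ring.
near=> n.
have h1 : Ex (P n) (fun w => G (@X n w \o t)) <= Ex Q (fun w => G (Y w \o t)) + e.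
  by near: n; exact: limsup.
have : Ex (P n) (fun w => 1 - G (@X n w \o t)) <=
    Ex Q (fun w => 1 - G (Y w \o t)) + e.
  by near: n; exact: (limsup (K := fun a => 1 - G a)).
rewrite !ExB ?Ex_cst//; [|exact: bm_cst|exact: bm_cst].
by move=> h2; rewrite ler_distl; apply/andP; split; lra.
Unshelve. all: by end_near. Qed.

End finite_dimensional.

End transfer.

(** * Partitions of unity on a grid *)

Section tents.
Context (R : realType).

(** The triangle of height 1 on the base [-1, 1], written as a difference of ramps so that the sum
    of its integer translates telescopes. *)
Definition tent (u : R) : R := ramp (u + 1) - ramp u.

Lemma tent01 u : 0 <= tent u <= 1.
Proof.
by rewrite /tent; case: (rampP u) => -[? ->]; case: (rampP (u + 1)) => -[? ->]; lra.
Qed.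

Lemma tent_supp u : tent u != 0 -> `|u| < 1.
Proof.
move=> t0; rewrite ltNge; apply: contra t0 => u1; apply/eqP; move: u1.
rewrite ler_normr /tent => /orP[u1|u1].
  by rewrite !ramp_ge1 ?subrr//; lra.
by rewrite !ramp_le0 ?subrr//; lra.
Qed.

Lemma tent_lip u v : `|tent u - tent v| <= 2 * `|u - v|.
Proof.
rewrite /tent (_ : _ - _ = (ramp (u + 1) - ramp (v + 1)) - (ramp u - ramp v)); last by ring.
rewrite (le_trans (ler_normB _ _))// mulr_natl mulr2n lerD ?ramp_lip//.
by rewrite (le_trans (ramp_lip _ _))// opprD addrACA subrr addr0.
Qed.

Lemma tent_measurable : measurable_fun setT tent.
Proof.
apply: measurable_funB; last exact: ramp_measurable.
apply: measurableT_comp; first exact: ramp_measurable.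
exact: measurable_funD.
Qed.

(* Grid of mesh 1 / m.+1 on [- m.+1, m.+1]. *)
Definition grid_size (m : nat) : nat := (m.+1 * m.+1).*2.+1.
Definition grid m (a : 'I_(grid_size m)) : R :=
  (a%:R - (m.+1 * m.+1)%:R) / m.+1%:R.
Definition hat m (a : 'I_(grid_size m)) (x : R) : R :=
  tent (m.+1%:R * (x - grid a)).
Definition pou m (x : R) : R := \sum_(a < grid_size m) hat a x.

Lemma hat01 m (a : 'I_(grid_size m)) x : 0 <= hat a x <= 1.
Proof. exact: tent01. Qed.

Lemma hat_supp m (a : 'I_(grid_size m)) x :
  hat a x != 0 -> `|x - grid a| <= m.+1%:R^-1.
Proof.
move=> /tent_supp; rewrite normrM ger0_norm// mulrC -ltr_pdivlMr// div1r.
exact: ltW.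
Qed.

Lemma hat_measurable m (a : 'I_(grid_size m)) : measurable_fun setT (hat a).
Proof.
apply: measurableT_comp; first exact: tent_measurable.
by apply: measurable_funM => //; exact: measurable_funB.
Qed.

Lemma hat_lip m (a : 'I_(grid_size m)) x y :
  `|hat a x - hat a y| <= 2 * m.+1%:R * `|x - y|.
Proof.
rewrite (le_trans (tent_lip _ _))// -mulrA ler_wpM2l//.
by rewrite -mulrBr normrM ger0_norm// opprD addrACA subrr addr0.
Qed.

Lemma pouE m x : pou m x =
  ramp (m.+1%:R * x + (m.+1 * m.+1)%:R + 1) - ramp (m.+1%:R * x - (m.+1 * m.+1)%:R).
Proof.
pose g (k : nat) : R := - ramp (m.+1%:R * x + (m.+1 * m.+1)%:R + 1 - k%:R).
rewrite /pou (eq_bigr (fun a : 'I_(grid_size m) => g a.+1 - g a)).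
  rewrite -(big_mkord xpredT (fun k => g k.+1 - g k)) telescope_sumr//.
  rewrite /g opprK subr0 addrC; congr (_ - ramp _).
  by rewrite /grid_size -addnn -addn1 !natrD; ring.
move=> a _; rewrite /hat /g /tent opprK addrC -[a.+1%:R]natr1.
have -> : m.+1%:R * (x - grid a) = m.+1%:R * x + (m.+1 * m.+1)%:R - a%:R.
  by rewrite mulrBr /grid mulrCA divff ?mulr1 ?pnatr_eq0//; ring.
by congr (- ramp _ + ramp _); ring.
Qed.

Lemma pou01 m x : 0 <= pou m x <= 1.
Proof.
apply/andP; split; first by apply: sumr_ge0 => a _; case/andP: (hat01 a x).
rewrite pouE; have /andP[_ h1] := ramp01 (m.+1%:R * x + (m.+1 * m.+1)%:R + 1).
have /andP[h2 _] := ramp01 (m.+1%:R * x - (m.+1 * m.+1)%:R); lra.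
Qed.

Lemma pou1 m x : `|x| <= m.+1%:R -> pou m x = 1.
Proof.
rewrite ler_norml => /andP[x1 x2]; rewrite pouE natrM.
have m0 : 0 < m.+1%:R :> R by [].
rewrite ramp_ge1 ?ramp_le0 ?subr0//.
  by rewrite subr_le0 ler_pM2l.
by rewrite lerDr -mulrDr mulr_ge0// -lerBlDr sub0r.
Qed.

Lemma bm_pou (d : measure_display) (T : measurableType d) m (X : T -> R) :
  measurable_fun setT X -> bounded_measurable (fun w => pou m (X w)).
Proof.
move=> mX; apply: bm_sum => a; split.
  by apply: measurableT_comp => //; exact: hat_measurable.
by exists 1 => w; rewrite ger0_norm; case/andP: (hat01 a (X w)).
Qed.

End tents.

Section approximation.
Context (R : realType) (I : finType).

(** The weights [t] may sum to less than 1; the missing mass is charged at the bound [B] of [y]. *)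
Lemma weighted_approx (t c e : I -> R) (y B : R) : (forall a, 0 <= t a) ->
  \sum_a t a <= 1 -> `|y| <= B -> (forall a, t a != 0 -> `|y - c a| <= e a) ->
  `|y - \sum_a c a * t a| <= \sum_a e a * t a + B * (1 - \sum_a t a).
Proof.
move=> t0 t1 yB yc.
have -> : y - \sum_a c a * t a =
    \sum_a (y - c a) * t a + y * (1 - \sum_a t a).
  under [in RHS]eq_bigr do rewrite mulrBl.
  by rewrite sumrB -mulr_sumr; ring.
rewrite (le_trans (ler_normD _ _))// lerD//.
  rewrite (le_trans (ler_norm_sum _ _ _))// ler_sum// => a _.
  rewrite normrM (ger0_norm (t0 a)); have [->|ta] := eqVneq (t a) 0.
    by rewrite !mulr0.
  by rewrite ler_wpM2r// yc.
by rewrite normrM [X in _ * X]ger0_norm ?subr_ge0// ler_wpM2r// subr_ge0.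
Qed.

End approximation.

Section grid_functions.
Context (R : realType) (J : finType).
Implicit Types (m : nat) (x : J -> R).

Definition mhat m (a : {ffun J -> 'I_(grid_size m)}) x : R :=
  \prod_j hat (a j) (x j).

Lemma mhat01 m (a : {ffun J -> 'I_(grid_size m)}) x : 0 <= mhat a x <= 1.
Proof.
apply/andP; split.
  by apply: prodr_ge0 => j _; case/andP: (hat01 (a j) (x j)).
by apply: prodr_ile1 => j _; exact: hat01.
Qed.

Lemma mhat_sum m x :
  \sum_(a : {ffun J -> 'I_(grid_size m)}) mhat a x = \prod_j pou m (x j).
Proof. by rewrite /pou bigA_distr_bigA. Qed.

Lemma prod_pou01 m x : 0 <= \prod_j pou m (x j) <= 1.
Proof.
apply/andP; split.
  by apply: prodr_ge0 => j _; case/andP: (pou01 m (x j)).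
by apply: prodr_ile1 => j _; exact: pou01.
Qed.

Lemma mhat_supp m (a : {ffun J -> 'I_(grid_size m)}) x :
  mhat a x != 0 -> forall j, `|x j - grid R (a j)| <= m.+1%:R^-1.
Proof.
move=> ax j; apply: hat_supp; apply: contra ax => /eqP h.
by rewrite /mhat (bigD1 j)//= h mul0r.
Qed.

Lemma mhat_lip m (a : {ffun J -> 'I_(grid_size m)}) x y (u : R) : 0 <= u ->
  (forall j, `|x j - y j| <= u) ->
  `|mhat a x - mhat a y| <= #|J|%:R * (2 * m.+1%:R) * u.
Proof.
move=> u0 xy; rewrite (le_trans (ler_norm_prodB _ _ _))// => [j|j|].
- exact: hat01.
- exact: hat01.
rewrite [leRHS](_ : _ = \sum_(j : J) 2 * m.+1%:R * u); last first.
  by rewrite sumr_const -[RHS]mulr_natl -[LHS]mulrA.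
by rewrite ler_sum// => j _; rewrite (le_trans (hat_lip _ _ _))// ler_wpM2l.
Qed.

Context (d : measure_display) (T : measurableType d) (X : T -> J -> R).
Hypothesis mX : forall j, measurable_fun setT (X ^~ j).

Lemma bm_mhat m (a : {ffun J -> 'I_(grid_size m)}) :
  bounded_measurable (fun w => mhat a (X w)).
Proof.
apply: bm_prod => j; split; last first.
  by exists 1 => w; rewrite ger0_norm; case/andP: (hat01 (a j) (X w j)).
by apply: measurableT_comp => //; exact: hat_measurable.
Qed.

Lemma bm_prod_pou m : bounded_measurable (fun w => \prod_j pou m (X w j)).
Proof. by apply: bm_prod => j; exact: bm_pou. Qed.

(** Every point lies in the box of the grid from some [m] on, and there the hats sum to 1. *)
Lemma Ex_prod_pou_cvg (P : probability T R) :
  Ex P (fun w => 1 - \prod_j pou m (X w j)) @[m --> \oo] --> (0 : R).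
Proof.
apply: (@Ex_cvg0 _ _ _ _ _ 1) => [m|m w|].
- by apply: bmB; [exact: bm_cst|exact: bm_prod_pou].
- by have /andP[? ?] := prod_pou01 m (X w); rewrite ger0_norm; lra.
- apply: aeW => w; apply: cvg_near_cst.
  have [k hk] : exists k : nat, \sum_j `|X w j| < k.+1%:R.
    by exists (Num.truncn (\sum_j `|X w j|)); exact: truncnS_gt.
  near=> m; rewrite big1 ?subrr// => j _; apply: pou1.
  rewrite (@le_trans _ _ (\sum_j `|X w j|))//.
    by rewrite (bigD1 j)//= lerDl sumr_ge0.
  rewrite (le_trans (ltW hk))// ler_nat ltnS.
  by near: m; exact: nbhs_infty_ge.
Unshelve. all: by end_near. Qed.

End grid_functions.

(** * Joint convergence tested on products of hats *)

Section joint.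
Context (R : realType) (J : finType) (d : nat -> measure_display)
  (T : forall n, measurableType (d n)) (P : forall n, probability (T n) R)
  (X : forall n, T n -> J -> R)
  (d' : measure_display) (T' : measurableType d') (Q : probability T' R)
  (Y : T' -> J -> R).
Hypothesis mX : forall n j, measurable_fun setT (@X n ^~ j).
Hypothesis mY : forall j, measurable_fun setT (Y ^~ j).
Hypothesis XY : forall m (a : {ffun J -> 'I_(grid_size m)}),
  Ex (P n) (fun w => mhat a (@X n w)) @[n --> \oo] -->
  Ex Q (fun w => mhat a (Y w)).

Lemma mhat_sum_cvg m (c : {ffun J -> 'I_(grid_size m)} -> R) :
  Ex (P n) (fun w => \sum_a c a * mhat a (@X n w)) @[n --> \oo] -->
  Ex Q (fun w => \sum_a c a * mhat a (Y w)).
Proof.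
have bX n a : bounded_measurable (fun w => c a * mhat a (@X n w)).
  by apply: bmM; [exact: bm_cst|exact: bm_mhat].
have bY a : bounded_measurable (fun w => c a * mhat a (Y w)).
  by apply: bmM; [exact: bm_cst|exact: bm_mhat].
rewrite Ex_sum//; under eq_fun do rewrite Ex_sum//.
apply: cvg_big => [|a _]; first exact: add_continuous.
rewrite ExZ; last exact: bm_mhat.
under eq_fun do (rewrite ExZ; last exact: bm_mhat).
by apply: cvgM; [exact: cvg_cst|exact: XY].
Qed.

(** This yields the tightness of the sequence: the mass off the grid is 1 minus a finite sum of
    hats, so its expectation converges together with theirs. *)
Lemma prod_pou_cvg m :
  Ex (P n) (fun w => 1 - \prod_j pou m (@X n w j)) @[n --> \oo] -->
  Ex Q (fun w => 1 - \prod_j pou m (Y w j)).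
Proof.
rewrite ExB; [|exact: bm_cst|exact: bm_prod_pou].
under eq_fun do (rewrite ExB; [|exact: bm_cst|exact: bm_prod_pou]).
rewrite Ex_cst; apply: cvgB; first by under eq_fun do rewrite Ex_cst; exact: cvg_cst.
have := @mhat_sum_cvg m (fun=> 1).
rewrite (_ : (fun w => \sum_a 1 * mhat a (Y w)) = (fun w => \prod_j pou m (Y w j))).
  rewrite (_ : (fun n => Ex (P n) (fun w => \sum_a 1 * mhat a (@X n w))) =
    (fun n => Ex (P n) (fun w => \prod_j pou m (@X n w j))))//.
  apply/funext => n; apply: eq_Ex => w; rewrite -mhat_sum.
  by apply: eq_bigr => a _; rewrite mul1r.
by apply/funext => w; rewrite -mhat_sum; apply: eq_bigr => a _; rewrite mul1r.
Qed.

Lemma joint_cvg (Phi : (J -> R) -> R) (C : R) :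
  (forall x, 0 <= Phi x <= 1) ->
  (forall x y (u : R), 0 <= u -> (forall j, `|x j - y j| <= u) ->
     `|Phi x - Phi y| <= C * u) ->
  Ex (P n) (fun w => Phi (@X n w)) @[n --> \oo] --> Ex Q (fun w => Phi (Y w)).
Proof.
move=> Phi01 Phi_lip; apply/cvgrPdist_le => e e0.
have C1 : 0 < `|C| + 1 by rewrite ltr_wpDl.
(* Five errors: discretization and missing mass on either side, and the convergence of the finite
   sum. *)
have e50 : 0 < e / 5 by rewrite divr_gt0.
have Q0 := Ex_prod_pou_cvg mY Q.
have [m Cm hm] : exists2 m, C / m.+1%:R <= e / 5 &
    Ex Q (fun w => 1 - \prod_j pou m (Y w j)) < e / 5.
  near \oo => m; exists m; last first.
    by near: m; move: Q0 => /cvgr_lt; apply.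
  rewrite (@le_trans _ _ ((`|C| + 1) / m.+1%:R))//.
    by rewrite ler_pM2r ?invr_gt0// (le_trans (ler_norm _))// lerDl.
  rewrite mulrC -ler_pdivlMr//; apply: ltW; near: m.
  by apply: (near_infty_natSinv_lt (PosNum (divr_gt0 e50 C1))).
pose c (a : {ffun J -> 'I_(grid_size m)}) := Phi (fun j => grid R (a j)).
have c0 a : 0 <= c a by case/andP: (Phi01 (fun j => grid R (a j))).
pose Phim x := \sum_a c a * mhat a x.
have approx x : `|Phi x - Phim x| <= e / 5 + (1 - \prod_j pou m (x j)).
  have t0 (a : {ffun J -> 'I_(grid_size m)}) : 0 <= mhat a x by case/andP: (mhat01 a x).
  have t1 : \sum_(a : {ffun J -> 'I_(grid_size m)}) mhat a x <= 1.
    by rewrite mhat_sum; case/andP: (prod_pou01 m x).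
  have P1 : `|Phi x| <= 1 by rewrite ger0_norm; case/andP: (Phi01 x).
  have := @weighted_approx _ _ (fun a => mhat a x) c (fun=> e / 5) (Phi x) 1 t0 t1 P1.
  rewrite mul1r -mulr_sumr mhat_sum => /(_ _)/le_trans; apply.
    move=> a ax; rewrite (le_trans _ Cm)// Phi_lip ?invr_ge0// => j.
    exact: mhat_supp.
  rewrite lerD2r ler_piMr ?(ltW e50)//; by case/andP: (prod_pou01 m x).
have sand (d0 : measure_display) (T0 : measurableType d0) (P0 : probability T0 R)
    (Z : T0 -> J -> R) : (forall j, measurable_fun setT (Z ^~ j)) ->
    `|Ex P0 (fun w => Phi (Z w)) - Ex P0 (fun w => Phim (Z w))| <=
    e / 5 + Ex P0 (fun w => 1 - \prod_j pou m (Z w j)).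
  move=> mZ.
  have bP : bounded_measurable (fun w => 1 - \prod_j pou m (Z w j)).
    by apply: bmB; [exact: bm_cst|exact: bm_prod_pou].
  rewrite -[X in _ <= X + _](Ex_cst P0) -ExD//; last exact: bm_cst.
  apply: (@Ex_sandwich _ _ _ _ 1) => // [|||w].
  - apply: bm_sum => a; apply: bmM; [exact: bm_cst|exact: bm_mhat].
  - by apply: bmD => //; exact: bm_cst.
  - by move=> w; apply: sumr_ge0 => a _; rewrite mulr_ge0//; case/andP: (mhat01 a (Z w)).
  - by rewrite addr_ge0 ?(ltW e50)//; have /andP[] := prod_pou01 m (Z w); lra.
near=> n.
have h1 := sand _ _ Q Y mY.
have h2 := sand _ _ (P n) (@X n) (@mX n).
have h3 : `|Ex Q (fun w => Phim (Y w)) - Ex (P n) (fun w => Phim (@X n w))| <= e / 5.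
  by near: n; have := @mhat_sum_cvg m c => /cvgrPdist_le; apply.
have h4 : Ex (P n) (fun w => 1 - \prod_j pou m (@X n w j)) < e / 5.
  by near: n; have := @prod_pou_cvg m => /cvgr_lt; apply.
have := hm; move: h1 h2 h3 h4; rewrite !ler_norml.
move=> /andP[? ?] /andP[? ?] /andP[? ?] ? ?; apply/andP; split; lra.
Unshelve. all: by end_near. Qed.

End joint.

(** * Brownian motion *)

Section gaussian_affine.
Context (R : realType).
Local Notation leb := (@lebesgue_measure R).

(** Both signs of [c] occur, since the services enter the weighted noise with negative coefficients;
    for negative [c] the preimage of []x, y]] is closed on the left. *)
Lemma lebesgue_measure_affine (c b : R) (A : set R) : c != 0 -> measurable A ->
  leb A = (`|c|%:E * leb ((fun x : R => c * x + b)%R @^-1` A))%E.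
Proof.
move=> c0 mA; pose f (x : measurableTypeR R) : measurableTypeR R := c * x + b.
have mf : measurable_fun setT f.
  by apply: measurable_funD => //; exact: measurable_funM.
pose k : {nonneg R} := NngNum (normr_ge0 c).
pose nu := mscale k (pushforward leb f) : {measure set (measurableTypeR R) -> \bar R}.
apply: (@lebesgue_measure_unique R (nu mf)) => // X /ocitvP[->|[[x y] /= xy ->]].
  by rewrite !measure0.
rewrite /nu /mscale/= /pushforward.
have [c_gt0|c_lt0|/eqP] := ltgtP c 0; last by rewrite (negbTE c0).
- have -> : f @^-1` `]x, y] = `[(y - b) / c, (x - b) / c[%classic.
    apply/seteqP; split=> z; rewrite /= !in_itv/= /f ler_ndivrMr// ltr_ndivlMr// ![z * c]mulrC.
      by move=> /andP[? ?]; apply/andP; split; lra.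
    by move=> /andP[? ?]; apply/andP; split; lra.
  rewrite !lebesgue_measure_itv/= !lte_fin xy ltr_nM2r ?invr_lt0// ltrD2r xy.
  by rewrite -!EFinD -EFinM ltr0_norm//; congr EFin; field.
- have -> : f @^-1` `]x, y] = `](x - b) / c, (y - b) / c]%classic.
    apply/seteqP; split=> z; rewrite /= !in_itv/= /f ler_pdivlMr// ltr_pdivrMr// ![z * c]mulrC.
      by move=> /andP[? ?]; apply/andP; split; lra.
    by move=> /andP[? ?]; apply/andP; split; lra.
  rewrite !lebesgue_measure_itv/= !lte_fin xy ltr_pM2r ?invr_gt0// ltrD2r xy.
  by rewrite -!EFinD -EFinM gtr0_norm//; congr EFin; field.
Qed.

Lemma gaussian_affine (c b m v : R) (B : set R) : c != 0 -> 0 <= v ->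
  measurable B ->
  gaussian m v ((fun x => c * x + b) @^-1` B) = gaussian (c * m + b) (c ^+ 2 * v) B.
Proof.
move=> c0 v0 mB; rewrite /gaussian mulf_eq0 sqrf_eq0 (negbTE c0)/=.
have [_|vn0] := eqVneq v 0; first by rewrite !diracE; congr (_%:R%:E); rewrite !inE.
have v_gt0 : 0 < v by rewrite lt_def vn0.
rewrite (sqrtrM _ (sqr_ge0 c)) sqrtr_sqr; set s := Num.sqrt v.
have s_gt0 : 0 < s by rewrite sqrtr_gt0.
have sn0 : s != 0 by rewrite gt_eqF.
have cn0 : `|c| != 0 by rewrite normr_eq0.
pose f (x : measurableTypeR R) : measurableTypeR R := c * x + b.
have mf : measurable_fun setT f.
  by apply: measurable_funD => //; exact: measurable_funM.
pose k : {nonneg R} := NngNum (normr_ge0 c).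
pose nu := mscale k (pushforward leb f) : {measure set (measurableTypeR R) -> \bar R}.
rewrite /normal_prob.
set g := normal_pdf (c * m + b) (`|c| * s).
have mg : measurable_fun setT (EFin \o g).
  by apply/measurable_EFinP; exact: measurable_normal_pdf.
have g0 x : (0 <= (EFin \o g) x)%E by rewrite lee_fin normal_pdf_ge0.
have -> : (\int[leb]_(x in B) (EFin \o g) x = \int[nu mf]_(x in B) (EFin \o g) x)%E.
  by apply: eq_measure_integral => A mA _; exact: lebesgue_measure_affine.
rewrite /nu ge0_integral_mscale//.
rewrite ge0_integral_pushforward//; last by apply: measurable_funTS.
rewrite -ge0_integralZl//.
- apply: eq_integral => x _; rewrite /= -EFinM; congr EFin.
  rewrite /g !normal_pdfE ?mulf_neq0// /normal_peak /normal_fun.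
  have -> : (`|c| * s) ^+ 2 = c ^+ 2 * s ^+ 2 by rewrite exprMn real_normK ?num_real.
  have -> : (f x - (c * m + b)) ^+ 2 = c ^+ 2 * (x - m) ^+ 2 by rewrite /f; ring.
  have -> : c ^+ 2 * s ^+ 2 * pi *+ 2 = c ^+ 2 * (s ^+ 2 * pi *+ 2).
    by rewrite [RHS]mulrnAr -[in LHS]mulrA.
  rewrite (sqrtrM _ (sqr_ge0 c)) sqrtr_sqr invfM [RHS]mulrA [in RHS]mulrA.
  rewrite divff// mul1r; congr (_ * expR _).
  by rewrite -mulrnAr !mulNr -mulf_div divff ?mul1r// sqrf_eq0.
- by rewrite -[X in measurable X]setTI; exact: mf.
- by apply: measurable_funTS; exact: measurableT_comp.
- by move=> x _; exact: g0.
- exact: measurable_funTS.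
Qed.

End gaussian_affine.

Section gsigma.
Context (R : realType) (d d' : measure_display) (T : measurableType d)
  (U : measurableType d') (I : set R) (X : T -> R -> U).

Lemma generated_measurable t : I t ->
  measurable_fun [set: g_sigma_algebraType
    [set A | exists t B, [/\ I t, measurable B & A = (X ^~ t) @^-1` B]]]
    (fun w => X w t).
Proof.
move=> It _ B mB; rewrite setTI; apply: sub_sigma_algebra.
by exists t, B.
Qed.

End gsigma.

Section increments.
Context (R : realType) (d : measure_display) (T : measurableType d)
  (P : probability T R) (m A : R) (W : T -> R -> R).
Hypothesis hW : brownian_motion P m A W.

(** Induction on [K]: the event formed by the earlier increments belongs to the past of [tau K], of
    which the last increment is independent. *)
Lemma bm_increments (tau : nat -> R) (K : nat) (B : nat -> set R) :
  0 <= tau 0%N -> (forall i, tau i <= tau i.+1) -> (forall i, measurable (B i)) ->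
  fine (P (\big[setI/setT]_(i < K)
    [set w | B i (W w (tau i.+1) - W w (tau i))])) =
  \prod_(i < K) fine (P [set w | B i (W w (tau i.+1) - W w (tau i))]).
Proof.
move=> tau0 tauS mB; have [_ _ _ hind] := hW.
have tau_ge0 i : 0 <= tau i by elim: i => // i ih; exact: le_trans ih (tauS i).
have tau_le i j : (i <= j)%N -> tau i <= tau j.
  move=> /subnK <-; elim: (j - i)%N => // n ih; exact: le_trans ih (tauS _).
have mincr i : measurable [set w | B i (W w (tau i.+1) - W w (tau i))].
  have [[_ mW] _ _ _] := hW.
  have := measurable_funB (mW _ (tau_ge0 i.+1)) (mW _ (tau_ge0 i)).
  by move=> /(_ measurableT _ (mB i)); rewrite setTI.
elim: K => [|K ih]; first by rewrite !big_ord0 probability_setT.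
rewrite !big_ord_recr/= -ih -fineM; last 2 first.
- by apply: fin_num_measure; apply: bigsetI_measurable => i _; exact: mincr.
- by apply: fin_num_measure; exact: mincr.
rewrite hind//.
pose G := [set F | exists t C, [/\ `[0, tau K]%classic t, measurable C & F = (W ^~ t) @^-1` C]].
suff : (G.-sigma.-measurable) (\big[setI/setT]_(i < K)
    [set w | B i (W w (tau i.+1) - W w (tau i))]) by [].
rewrite -(bigcap_mkord K (fun i => [set w | B i (W w (tau i.+1) - W w (tau i))])).
apply: fin_bigcap_measurable => // i /= iK.
have mW t : 0 <= t -> t <= tau K ->
    measurable_fun [set: g_sigma_algebraType G] (fun w => W w t).
  by move=> t0 tK; apply: generated_measurable; rewrite /= in_itv/= t0.
have := measurable_funB (mW _ (tau_ge0 i.+1) (tau_le _ _ iK)) (mW _ (tau_ge0 i) (tau_le _ _ (ltnW iK))).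
by move=> /(_ measurableT _ (mB i)); rewrite setTI.
Qed.

End increments.

(** * Convergence of the noise on a mesh *)

Section bm_pairs.
Context (R : realType) (d : measure_display) (T : measurableType d)
  (P : probability T R) (m A : R) (W : T -> R -> R).
Hypothesis hW : brownian_motion P m A W.

Lemma bm_measurable_incr s t : 0 <= s -> 0 <= t ->
  measurable_fun setT (fun w => W w t - W w s).
Proof. by move=> s0 t0; have [[_ mW] _ _ _] := hW; apply: measurable_funB; exact: mW. Qed.

Lemma bm_increments_ord (tau : nat -> R) (K : nat) (B : 'I_K -> set R) :
  0 <= tau 0%N -> (forall i, tau i <= tau i.+1) -> (forall i, measurable (B i)) ->
  fine (P (\bigcap_(i : 'I_K) ((fun w => W w (tau i.+1) - W w (tau i)) @^-1` B i))) =
  \prod_(i < K) fine (P ((fun w => W w (tau i.+1) - W w (tau i)) @^-1` B i)).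
Proof.
case: K B => [|K] B tau0 tauS mB.
  rewrite big_ord0 (_ : \bigcap_i _ = setT) ?probability_setT//.
  by apply/seteqP; split => // w _ [].
pose B' (i : nat) := B (inord i).
have := @bm_increments _ _ _ _ _ _ _ hW tau K.+1 B' tau0 tauS (fun i => mB _).
rewrite /B'; under [in RHS]eq_bigr do rewrite inord_val.
move=> <-; congr (fine (P _)).
under eq_bigr do rewrite inord_val.
rewrite -bigcap_seq_cond/=.
by apply/seteqP; split=> w h i; [move=> _; exact: h|move=> _; apply: h; rewrite /= mem_index_enum].
Qed.

Lemma bm_increments_pair (tau : nat -> R) (k q : nat)
    (B : 'I_q * 'I_k -> set R) :
  0 <= tau 0%N -> (forall i, tau i <= tau i.+1) -> (forall i, measurable (B i)) ->
  fine (P (\bigcap_(i : 'I_q * 'I_k) ((fun w => W w (tau (i.2 * q + i.1).+1%N) -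
      W w (tau (i.2 * q + i.1)%N)) @^-1` B i))) =
  \prod_(i : 'I_q * 'I_k) fine (P ((fun w => W w (tau (i.2 * q + i.1).+1%N) -
      W w (tau (i.2 * q + i.1)%N)) @^-1` B i)).
Proof.
move=> tau0 tauS mB.
(* Pairs are numbered chronologically, [j = l * q + p]; [setT] fills the indices that do not come
   from a pair. *)
pose B' (j : nat) : set R := if insub (j %% q)%N is Some p then
  if insub (j %/ q)%N is Some l then B (p, l) else setT else setT.
have B'E (p : 'I_q) (l : 'I_k) : B' (l * q + p)%N = B (p, l).
  have q0 : (0 < q)%N by exact: leq_ltn_trans (ltn_ord p).
  rewrite /B' modnMDl modn_small// valK divnMDl// divn_small// addn0 valK//.
have mB' j : measurable (B' j).
  by rewrite /B'; case: insub => // p; case: insub.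
have := @bm_increments _ _ _ _ _ _ _ hW tau (k * q) B' tau0 tauS mB'.
rewrite -(big_mkord xpredT (fun i => fine (P [set w | B' i (W w (tau i.+1) - W w (tau i))]))).
rewrite big_nat_mul big_mkord.
rewrite [X in _ = X -> _](_ : _ = \prod_(i : 'I_q * 'I_k)
   fine (P ((fun w => W w (tau (i.2 * q + i.1).+1%N) -
      W w (tau (i.2 * q + i.1)%N)) @^-1` B i))); last first.
  pose F (p : 'I_q) (l : 'I_k) := fine (P ((fun w => W w (tau (l * q + p).+1%N) -
      W w (tau (l * q + p)%N)) @^-1` B (p, l))).
  rewrite [RHS](eq_bigr (fun i => F i.1 i.2)); last by case.
  rewrite -(pair_bigA _ F) /= exchange_big/=.
  apply: eq_bigr => l _; rewrite -{1}[(l * q)%N]add0n mulSn big_addn addnK big_mkord.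
  by apply: eq_bigr => p _; rewrite [(p + _)%N]addnC B'E.
move=> <-; congr (fine (P _)).
rewrite -(bigcap_mkord (k * q) (fun i => [set w | B' i (W w (tau i.+1) - W w (tau i))])).
apply/seteqP; split=> w h.
  move=> j /= jkq; have q0 : (0 < q)%N by case: (q) jkq; rewrite ?muln0.
  have jl : (j %/ q < k)%N by rewrite ltn_divLR.
  have jp : (j %% q < q)%N by rewrite ltn_mod.
  have := h (Ordinal jp, Ordinal jl) Logic.I; rewrite /= -B'E/=.
  by rewrite -divn_eq.
move=> [p l] _ /=; rewrite -B'E; apply: h => /=.
by rewrite -ltn_divLR ?(leq_ltn_trans _ (ltn_ord p))// divnMDl ?(leq_ltn_trans _ (ltn_ord p))// divn_small// addn0.
Qed.

End bm_pairs.

Section increments_limit.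
Context (R : realType) (q k : nat).
Context (d : nat -> measure_display) (T : forall n, measurableType (d n))
  (P : forall n, probability (T n) R) (Gen : forall n, 'I_q -> set (set (T n)))
  (xi : forall n, 'I_q -> T n -> R -> R).
Context (d0 : measure_display) (T0 : measurableType d0) (P0 : probability T0 R)
  (Wp : 'I_q -> T0 -> R -> R) (v c theta : 'I_q -> R) (Del : R).
Context (d1 : measure_display) (T1 : measurableType d1) (Q : probability T1 R)
  (W : T1 -> R -> R) (m A : R) (wt : 'I_q -> R).
Hypothesis indep : forall n (F : 'I_q -> set (T n)),
  (forall p, <<s @Gen n p >> (F p)) ->
  fine (P n (\bigcap_(p : 'I_q) F p)) = \prod_(p < q) fine (P n (F p)).
Hypothesis mGen : forall n p t, 0 <= t ->
  measurable_fun [set: g_sigma_algebraType (@Gen n p)] (fun w => @xi n p w t).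
Hypothesis mxi : forall n p t, 0 <= t -> measurable_fun setT (fun w => @xi n p w t).
Hypothesis rxi : forall n p w, right_continuous_path (@xi n p w).
Hypothesis cvgxi : forall p,
  @cvg_in_distribution R R^o d T P (fun n => @xi n p) d0 T0 P0 (Wp p).
Hypothesis hWp : forall p, brownian_motion P0 0 (v p) (Wp p).
Hypothesis hW : brownian_motion Q m A W.
Hypothesis v0 : forall p, 0 <= v p.
Hypothesis c0 : forall p, c p != 0.
Hypothesis theta0 : forall p, 0 <= theta p.
Hypothesis Del0 : 0 < Del.
Hypothesis A0 : 0 <= A.
Hypothesis wt0 : forall p, 0 <= wt p.
Hypothesis wt1 : \sum_p wt p = 1.
Hypothesis vwt : forall p, c p ^+ 2 * (v p * theta p) = A * wt p.

Definition incr_pre n (w : T n) (i : 'I_q * 'I_k) : R :=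
  c i.1 * (@xi n i.1 w (theta i.1 * (i.2.+1%:R * Del)) -
           @xi n i.1 w (theta i.1 * (i.2%:R * Del))).

(* Each mesh interval is cut into q pieces of relative lengths [wt p], so that
   the increments of [W] over the pieces play the role of the independent
   limits of the q scaled processes. *)
Definition split_time (j : nat) : R :=
  Del * ((j %/ q)%:R + \sum_(p < q | (p < j %% q)%N) wt p).

(** The drift of [W] is removed, so that each piece carries a centred normal law like the increments
    of [Wp p]; [partial_sums] puts it back. *)
Definition incr_lim (w : T1) (i : 'I_q * 'I_k) : R :=
  W w (split_time (i.2 * q + i.1).+1%N) - W w (split_time (i.2 * q + i.1)%N)
  - m * (Del * wt i.1).

Lemma split_timeE (l p : nat) : (p <= q)%N -> (0 < q)%N ->
  split_time (l * q + p) = Del * (l%:R + \sum_(p' < q | (p' < p)%N) wt p').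
Proof.
rewrite leq_eqVlt => /predU1P[->|pq] q0; rewrite /split_time; last first.
  by rewrite modnMDl modn_small// divnMDl// divn_small// addn0.
rewrite -mulSnr modnMl mulnK// big_pred0// addr0 -natr1.
congr (_ * (_ + _)); rewrite -[LHS]wt1; apply: eq_bigl => p'.
by rewrite ltn_ord.
Qed.

Lemma split_timeS (l : nat) (p : 'I_q) :
  split_time (l * q + p).+1 = split_time (l * q + p) + Del * wt p.
Proof.
have q0 : (0 < q)%N by exact: leq_ltn_trans (ltn_ord p).
rewrite -addnS !split_timeE//; last exact: ltnW.
rewrite -mulrDr -addrA; congr (_ * (_ + _)).
rewrite (bigD1 p)//= addrC; congr (_ + _); apply: eq_bigl => p'.
by rewrite ltnS ltn_neqAle andbC.
Qed.

Lemma split_time_mono (j : nat) : split_time j <= split_time j.+1.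
Proof.
have q0 : (0 < q)%N.
  rewrite lt0n; apply/eqP => q0; have := wt1.
  rewrite big1 => [/esym/eqP|p _]; first by rewrite oner_eq0.
  by have := ltn_ord p; rewrite [X in (_ < X)%N]q0.
have jq : (j %% q < q)%N by rewrite ltn_mod.
rewrite {1 2}(divn_eq j q) (split_timeS (j %/ q) (Ordinal jq)).
by rewrite lerDl mulr_ge0// ltW.
Qed.

Lemma split_time0 : split_time 0 = 0.
Proof. by rewrite /split_time div0n mod0n big_pred0// addr0 mulr0. Qed.

Lemma split_time_ge0 j : 0 <= split_time j.
Proof. by elim: j => [|j ih]; [rewrite split_time0|exact: le_trans ih (split_time_mono j)]. Qed.

Lemma incr_pre_measurable n i : measurable_fun setT (fun w => @incr_pre n w i).
Proof.
apply: measurable_funM => //; apply: measurable_funB; apply: mxi;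
  by rewrite !mulr_ge0// ltW.
Qed.

Lemma incr_lim_measurable i : measurable_fun setT (fun w => incr_lim w i).
Proof.
apply: measurable_funB => //; apply: (bm_measurable_incr hW); exact: split_time_ge0.
Qed.

Lemma incr_lim_prod mm (a : {ffun 'I_q * 'I_k -> 'I_(grid_size mm)}) :
  Ex Q (fun w => mhat a (incr_lim w)) =
  \prod_p \prod_l Ex Q (fun w => hat (a (p, l)) (incr_lim w (p, l))).
Proof.
rewrite (pair_bigA _ (fun p l => Ex Q (fun w => hat (a (p, l)) (incr_lim w (p, l))))) /=.
rewrite [RHS](eq_bigr (fun i => Ex Q (fun w => hat (a i) (incr_lim w i)))); last by case.
apply: (@Ex_prod R _ _ Q _ (fun i w => incr_lim w i) (fun i => hat (a i))) => [i|i|i x|B mB].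
- exact: incr_lim_measurable.
- exact: hat_measurable.
- exact: hat01.
- pose B' (i : 'I_q * 'I_k) := (fun x : R => x - m * (Del * wt i.1)) @^-1` B i.
  have mB' i : measurable (B' i).
    rewrite -[B' i]setTI; have : measurable_fun setT (fun x : R => x - m * (Del * wt i.1)).
      by apply: measurable_funB.
    by move=> /(_ measurableT _ (mB i)).
  by have := bm_increments_pair hW _ split_time_mono mB'; rewrite split_time0; apply.
Qed.

(** Both increments are centred and normal; their variances, [c p ^+ 2 * v p * theta p * Del] and
    [A * wt p * Del], agree by [vwt]. *)
Lemma law_match p l (h : R -> R) : measurable_fun setT h -> (forall x, 0 <= h x) ->
  Ex P0 (fun w => h (c p * (Wp p w (theta p * (l.+1%:R * Del)) -
                            Wp p w (theta p * (l%:R * Del))))) =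
  Ex Q (fun w => h (W w (split_time (l * q + p).+1%N) - W w (split_time (l * q + p)%N)
     - m * (Del * wt p))).
Proof.
move=> mh h0.
have t0 : 0 <= theta p * (l%:R * Del) by rewrite !mulr_ge0// ltW.
have t01 : theta p * (l%:R * Del) <= theta p * (l.+1%:R * Del).
  by rewrite ler_wpM2l// ler_pM2r// ler_nat.
have m1 := bm_measurable_incr (hWp p) t0 (le_trans t0 t01).
have m2 := bm_measurable_incr hW (split_time_ge0 (l * q + p)) (split_time_ge0 (l * q + p).+1).
apply: (@eq_law_Ex _ _ _ _ _ P0 Q
  (fun w => c p * (Wp p w (theta p * (l.+1%:R * Del)) - Wp p w (theta p * (l%:R * Del))))
  (fun w => W w (split_time (l * q + p).+1%N) - W w (split_time (l * q + p)%N)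
     - m * (Del * wt p)) h) => //.
- exact: measurable_funM.
- exact: measurable_funB.
move=> B mB.
pose B1 := (fun x : R => c p * x + 0) @^-1` B.
pose B2 := (fun x : R => 1 * x + - (m * (Del * wt p))) @^-1` B.
have mB1 : measurable B1.
  rewrite -[B1]setTI; have : measurable_fun setT (fun x : R => c p * x + 0).
    by apply: measurable_funD => //; exact: measurable_funM.
  by move=> /(_ measurableT _ mB).
have mB2 : measurable B2.
  rewrite -[B2]setTI; have : measurable_fun setT (fun x : R => 1 * x + - (m * (Del * wt p))).
    by apply: measurable_funD => //; exact: measurable_funM.
  by move=> /(_ measurableT _ mB).
have [_ _ /(_ _ _ B1 t0 t01 mB1) g1 _] := hWp p.
have [_ _ /(_ _ _ B2 (split_time_ge0 (l * q + p)) (split_time_mono _) mB2) g2 _] := hW.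
transitivity (P0 [set w | B1 (Wp p w (theta p * (l.+1%:R * Del)) - Wp p w (theta p * (l%:R * Del)))]).
  by congr (P0 _); apply/seteqP; split=> w; rewrite /B1/= addr0.
rewrite g1 mul0r; transitivity (Q [set w | B2 (W w (split_time (l * q + p).+1%N) - W w (split_time (l * q + p)%N))]); last first.
  by congr (Q _); apply/seteqP; split=> w; rewrite /B2/= mul1r.
rewrite g2 split_timeS addrAC subrr add0r.
have td : theta p * (l.+1%:R * Del) - theta p * (l%:R * Del) = theta p * Del.
  by rewrite -natr1; ring.
rewrite td.
have e1 : 0 <= v p * (theta p * Del) by rewrite !mulr_ge0// ltW.
have e2 : 0 <= A * (Del * wt p) by rewrite !mulr_ge0// ltW.
rewrite [LHS](@gaussian_affine R (c p) 0 0 _ B (c0 p) e1 mB).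
rewrite [RHS](@gaussian_affine R 1 _ _ _ B (oner_neq0 R) e2 mB).
congr (gaussian _ _ B); first by ring.
by rewrite expr1n mul1r [v p * _]mulrA mulrA vwt; ring.
Qed.

(** Independence has two sources. Before the limit the processes are independent of each other, so
    the expectation factors over [p], and each factor converges separately. Only in the limit, where
    increments over disjoint intervals are independent, does it factor further over [l]. *)
Lemma incr_pre_cvg mm (a : {ffun 'I_q * 'I_k -> 'I_(grid_size mm)}) :
  Ex (P n) (fun w => mhat a (@incr_pre n w)) @[n --> \oo] -->
  Ex Q (fun w => mhat a (incr_lim w)).
Proof.
rewrite incr_lim_prod.
pose t (p : 'I_q) (j : 'I_k.+1) := theta p * (j%:R * Del).
pose G p (x : 'I_k.+1 -> R) := \prod_(l < k)
  hat (a (p, l)) (c p * (x (lift ord0 l) - x (widen_ord (leqnSn k) l))).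
have G01 p x : 0 <= G p x <= 1.
  apply/andP; split; first by apply: prodr_ge0 => l _; case/andP: (hat01 (a (p, l)) (c p * (x (lift ord0 l) - x (widen_ord (leqnSn k) l)))).
  by apply: prodr_ile1 => l _; exact: hat01.
have t0 p j : 0 <= t p j by rewrite !mulr_ge0// ltW.
have preE n (w : T n) : mhat a (@incr_pre n w) = \prod_p G p (@xi n p w \o t p).
  rewrite /mhat (eq_bigr (fun i => hat (a (i.1, i.2)) (@incr_pre n w (i.1, i.2)))); last by case.
  rewrite -(pair_bigA _ (fun p l => hat (a (p, l)) (@incr_pre n w (p, l)))) /=.
  by apply: eq_bigr => p _; apply: eq_bigr => l _; rewrite /incr_pre /= /t lift0.
have mG p (d' : measure_display) (U : measurableType d') (x : U -> R -> R) :
    (forall t, 0 <= t -> measurable_fun setT (x ^~ t)) ->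
    measurable_fun setT (fun w => G p (x w \o t p)).
  move=> mx; apply: measurable_prod => l _.
  apply: measurableT_comp; first exact: hat_measurable.
  by apply: measurable_funM => //; apply: measurable_funB; apply: mx.
have bG p (d' : measure_display) (U : measurableType d') (x : U -> R -> R) :
    (forall t, 0 <= t -> measurable_fun setT (x ^~ t)) ->
    bounded_measurable (fun w => G p (x w \o t p)).
  move=> mx; split; first exact: mG.
  by exists 1 => w; rewrite ger0_norm; case/andP: (G01 p (x w \o t p)).
have -> : (fun n => Ex (P n) (fun w => mhat a (@incr_pre n w))) =
    (fun n => \prod_p Ex (P n) (fun w => G p (@xi n p w \o t p))).
  apply/funext => n; under eq_Ex do rewrite preE.
  apply: Ex_prod_unit => [p|p w|B mB].
  - by apply: mG => // u; exact: mxi.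
  - exact: G01.
  - apply: indep => p.
    have := mG p _ (g_sigma_algebraType (@Gen n p)) (@xi n p) (@mGen n p).
    by move=> /(_ measurableT _ (mB p)); rewrite setTI.
apply: cvg_big => [|p _]; first exact: mul_continuous.
have -> : \prod_(l < k) Ex Q (fun w => hat (a (p, l)) (incr_lim w (p, l))) =
    Ex P0 (fun w => G p (Wp p w \o t p)).
  transitivity (\prod_(l < k) Ex P0 (fun w => hat (a (p, l))
     (c p * (Wp p w (theta p * (l.+1%:R * Del)) - Wp p w (theta p * (l%:R * Del)))))).
    apply: eq_bigr => l _; rewrite law_match//; first exact: hat_measurable.
    by move=> x; case/andP: (hat01 (a (p, l)) x).
  symmetry; rewrite /G.
  pose h (l : 'I_k) (x : R) := hat (a (p, l)) (c p * x).
  pose tau (l : nat) := theta p * (l%:R * Del).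
  have tau0 l : 0 <= tau l by rewrite !mulr_ge0// ltW.
  transitivity (Ex P0 (fun w => \prod_(l < k) h l (Wp p w (tau l.+1) - Wp p w (tau l)))).
    by apply: eq_Ex => w; apply: eq_bigr => l _; rewrite /h /tau /= /t lift0.
  apply: (@Ex_prod R _ _ P0 _ (fun (l : 'I_k) w => Wp p w (tau l.+1) - Wp p w (tau l)) h) => [l|l|l x|B mB].
  - exact: (bm_measurable_incr (hWp p)).
  - apply: measurableT_comp; first exact: hat_measurable.
    exact: measurable_funM.
  - exact: hat01.
  - apply: (bm_increments_ord (hWp p)) => // l.
    by rewrite /tau ler_wpM2l// ler_pM2r// ler_nat.
have [[cW mW] cW' _ _] := hWp p.
have rW w : right_continuous_path (Wp p w) by have [+ _] := cW w.
have {}cW' : {ae P0, forall w, {within `[0, +oo[, continuous (Wp p w)}}.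
  by apply: filterS cW' => w [].
have G_lip x y (u : R) : 0 <= u -> (forall j, `|x j - y j| <= u) ->
    `|G p x - G p y| <= k%:R * (2 * mm.+1%:R * (`|c p| * 2)) * u.
  move=> u0 xy; rewrite (le_trans (ler_norm_prodB _ _ _))// => [l|l|].
  + exact: hat01.
  + exact: hat01.
  rewrite [leRHS](_ : _ = \sum_(l < k) 2 * mm.+1%:R * (`|c p| * 2 * u)); last first.
    by rewrite sumr_const card_ord -[RHS]mulr_natl; ring.
  apply: ler_sum => l _; rewrite (le_trans (hat_lip _ _ _))// ler_wpM2l//.
  rewrite -mulrBr normrM -mulrA ler_wpM2l//.
  rewrite (_ : _ - _ = (x (lift ord0 l) - y (lift ord0 l)) -
    (x (widen_ord (leqnSn k) l) - y (widen_ord (leqnSn k) l))); last by ring.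
  by rewrite (le_trans (ler_normB _ _))// mulr_natl mulr2n lerD.
exact: (fdd_transfer (@cvgxi p) rW mW cW' (t0 p) (G01 p) G_lip
  (bG p _ _ _ mW) (fun n => bG p _ _ _ (@mxi n p))).
Qed.

(** Recovers mesh values from increments. Being Lipschitz, it turns a hat of the mesh values into an
    admissible test function of the increments. *)
Definition partial_sums (x : 'I_q * 'I_k -> R) (l : 'I_k) : R :=
  \sum_(l' < k | (l' < l.+1)%N) \sum_(p < q) x (p, l') + m * (l.+1%:R * Del).

Lemma partial_sums_telescope (F : nat -> R) (l : 'I_k) :
  \sum_(l' < k | (l' < l.+1)%N) (F l'.+1 - F l') = F l.+1 - F 0%N.
Proof.
rewrite -(big_ord_widen k (fun i => F i.+1 - F i) (ltn_ord l)).
by rewrite -(big_mkord xpredT (fun i => F i.+1 - F i)) telescope_sumr.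
Qed.

Lemma partial_sums_pre n (w : T n) l : partial_sums (@incr_pre n w) l =
  \sum_(p < q) c p * (@xi n p w (theta p * (l.+1%:R * Del)) - @xi n p w 0)
  + m * (l.+1%:R * Del).
Proof.
congr (_ + _); rewrite exchange_big/=; apply: eq_bigr => p _.
rewrite /incr_pre/= -mulr_sumr; congr (_ * _).
rewrite (partial_sums_telescope (fun i => @xi n p w (theta p * (i%:R * Del)))).
by rewrite mul0r mulr0.
Qed.

Lemma partial_sums_lim w l :
  partial_sums (incr_lim w) l = W w (l.+1%:R * Del) - W w 0.
Proof.
have q0 : (0 < q)%N.
  rewrite lt0n; apply/eqP => q0; have := wt1.
  rewrite big1 => [/esym/eqP|p _]; first by rewrite oner_eq0.
  by have := ltn_ord p; rewrite [X in (_ < X)%N]q0.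
have st i : split_time (i * q) = i%:R * Del.
  by rewrite -[(i * q)%N]addn0 split_timeE// big_pred0 ?addr0 1?mulrC.
have sumE (l' : 'I_k) : \sum_(p < q) incr_lim w (p, l') =
    W w (l'.+1%:R * Del) - W w (l'%:R * Del) - m * Del.
  rewrite /incr_lim sumrB -mulr_sumr -mulr_sumr wt1 mulr1; congr (_ - _) => /=.
  pose F (p : nat) := W w (split_time (l' * q + p)).
  rewrite (eq_bigr (fun i : 'I_q => F i.+1 - F i)); last first.
    by move=> i _; rewrite /F addnS.
  rewrite -(big_mkord xpredT (fun p => F p.+1 - F p)) telescope_sumr//.
  by rewrite /F -mulSnr addn0 !st.
rewrite /partial_sums (eq_bigr _ (fun l' _ => sumE l')).
rewrite (eq_bigr (fun l' : 'I_k => (fun i => W w (i%:R * Del) - m * (i%:R * Del)) l'.+1 -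
   (fun i => W w (i%:R * Del) - m * (i%:R * Del)) l')); last first.
  by move=> l' _ /=; rewrite -natr1; ring.
rewrite (partial_sums_telescope (fun i => W w (i%:R * Del) - m * (i%:R * Del))).
by rewrite !mul0r; ring.
Qed.

Lemma values_cvg mm (a : {ffun 'I_k -> 'I_(grid_size mm)}) :
  Ex (P n) (fun w => mhat a (fun l =>
    \sum_(p < q) c p * (@xi n p w (theta p * (l.+1%:R * Del)) - @xi n p w 0)
    + m * (l.+1%:R * Del))) @[n --> \oo] -->
  Ex Q (fun w => mhat a (fun l => W w (l.+1%:R * Del) - W w 0)).
Proof.
pose Phi (x : 'I_q * 'I_k -> R) := mhat a (partial_sums x).
have -> : (fun n => Ex (P n) (fun w => mhat a (fun l =>
    \sum_(p < q) c p * (@xi n p w (theta p * (l.+1%:R * Del)) - @xi n p w 0)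
    + m * (l.+1%:R * Del)))) = (fun n => Ex (P n) (fun w => Phi (@incr_pre n w))).
  apply/funext => n; apply: eq_Ex => w; congr (mhat a _).
  by apply/funext => l; rewrite partial_sums_pre.
have -> : Ex Q (fun w => mhat a (fun l => W w (l.+1%:R * Del) - W w 0)) =
    Ex Q (fun w => Phi (incr_lim w)).
  apply: eq_Ex => w; congr (mhat a _).
  by apply/funext => l; rewrite partial_sums_lim.
have Phi01 x : 0 <= Phi x <= 1 by exact: mhat01.
have Phi_lip x y (u : R) : 0 <= u -> (forall j, `|x j - y j| <= u) ->
    `|Phi x - Phi y| <= #|'I_k|%:R * (2 * mm.+1%:R) * (k%:R * q%:R) * u.
  move=> u0 xy; rewrite -[_ * u]mulrA; apply: mhat_lip.
    by rewrite mulr_ge0// mulr_ge0.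
  move=> l; rewrite /partial_sums opprD addrACA subrr addr0 -sumrB.
  rewrite (le_trans (ler_norm_sum _ _ _))//.
  apply: (@le_trans _ _ (\sum_(l' < k) \sum_(p < q) u)); last first.
    by rewrite !sumr_const !card_ord -mulrnA mulnC -[leLHS]mulr_natl natrM.
  rewrite big_mkcond/=; apply: ler_sum => l' _; case: ifP => _; last first.
    by apply: sumr_ge0 => ? _.
  by rewrite -sumrB (le_trans (ler_norm_sum _ _ _))// ler_sum.
exact: (joint_cvg incr_pre_measurable incr_lim_measurable incr_pre_cvg Phi01 Phi_lip).
Qed.

End increments_limit.

(** * Discrete reflection *)

Section discrete.
Context (R : realType) (beta : R).
Hypothesis beta0 : 0 < beta.

Definition clip (u : R) : R := Num.min beta (Num.max 0 u).

Fixpoint discrete_reflection (a : nat -> R) (l : nat) : R :=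
  if l is l'.+1 then clip (discrete_reflection a l' + a l - a l') else clip (a 0%N).

Lemma clip_bound u : 0 <= clip u <= beta.
Proof. by rewrite /clip le_min (ltW beta0) le_max lexx ge_min lexx. Qed.

(** The clip lowers its argument only to put it on [beta], and (next lemma) raises it only to put it
    on 0: these are the complementarity conditions of the discrete regulators. *)
Lemma clip_ge u : clip u < beta -> u <= clip u.
Proof.
rewrite /clip gt_min ltxx/= => h; rewrite (min_idPr (ltW h)).
by rewrite le_max lexx orbT.
Qed.

Lemma clip_le u : 0 < clip u -> clip u <= u.
Proof.
rewrite /clip lt_min => /andP[_]; rewrite lt_max ltxx/= => u0.
by rewrite ge_min (max_idPr (ltW u0)) lexx orbT.
Qed.

Lemma discrete_reflection_bound a l : 0 <= discrete_reflection a l <= beta.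
Proof. by case: l => [|l]; exact: clip_bound. Qed.

End discrete.

(** * Approximate two-sided reflection *)

Section reflection.
Context (R : realType) (beta kap del h : R) (piece : R -> R -> Prop)
  (y w L U : R -> R).
Hypothesis beta0 : 0 < beta.
Hypothesis del0 : 0 < del.
Hypothesis piece_itv : forall a b, piece a b -> [/\ 0 <= a, a <= b, b <= h & b <= a + del].
Hypothesis reach : forall s t, 0 <= s -> s <= t -> t <= h ->
  clos_refl_trans _ piece s t.
Hypothesis yE : forall t, 0 <= t <= h -> y t = w t + L t - U t.
Hypothesis y_bound : forall t, 0 <= t <= h -> 0 <= y t <= beta + kap.
Hypothesis w_osc : forall s t, 0 <= s <= h -> 0 <= t <= h -> `|t - s| <= del ->
  `|w t - w s| <= kap.
Hypothesis L_mono : forall a b, piece a b -> L a <= L b.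
Hypothesis U_mono : forall a b, piece a b -> U a <= U b.
Hypothesis L_supp : forall a b, piece a b -> L b = L a \/ y b <= kap.
Hypothesis U_supp : forall a b, piece a b -> U b = U a \/ beta - kap <= y b.

(** Induction along a chain of elementary intervals replaces an induction over event times; it needs
    only local information on the path. *)
Lemma piece_induction (s : R) (Q : R -> Prop) : 0 <= s -> Q s ->
  (forall a b, s <= a -> piece a b -> Q a -> Q b) ->
  forall t, s <= t -> t <= h -> Q t.
Proof.
move=> s0 Qs QS t st th.
have [//] : Q t /\ s <= t.
elim/clos_refl_trans_ind_left: (reach s0 st th) => // a b _ [Qa sa] ab.
have [_ ab' _ _] := piece_itv ab.
by split; [exact: QS ab Qa|exact: le_trans ab'].
Qed.

(** On a short window the noise is nearly constant, and only the regulators move [m]. As [beta]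
    exceeds [4 * kap], they cannot both act: the invariant says that neither has acted, or only [L]
    and [m] is still low, or only [U] and [m] is still high. *)
Lemma L_window (s t : R) : 4 * kap < beta -> 0 <= s -> s <= t -> t <= h ->
  t <= s + del -> L t - L s <= 2 * kap.
Proof.
move=> kb s0 st th tsd.
have sh : s <= h by exact: le_trans th.
pose m t := y t - (w t - w s).
have mE t' : 0 <= t' <= h -> m t' = y s + (L t' - L s) - (U t' - U s).
  by move=> ht'; rewrite /m !yE ?s0//; ring.
suff : t <= s + del -> [\/ U t = U s /\ L t = L s, U t = U s /\ m t <= 2 * kap |
    L t = L s /\ beta - 2 * kap <= m t].
  have /andP[ys _] : 0 <= y s <= beta + kap by apply: y_bound; rewrite s0.
  have kap0 : 0 <= kap.
    have := w_osc (s := s) (t := s); rewrite s0 sh !subrr normr0 => /(_ isT isT); apply.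
    exact: ltW.
  move=> /(_ tsd)[[_ ->]|[Ut]|[-> _]]; [lra| |lra].
  by rewrite mE ?Ut ?(le_trans s0 st)//; lra.
apply: (piece_induction (s := s) (Q := fun t => t <= s + del ->
  [\/ U t = U s /\ L t = L s, U t = U s /\ m t <= 2 * kap |
    L t = L s /\ beta - 2 * kap <= m t])) => //; first by move=> _; apply: Or31.
move=> a b sa ab Qa bsd; have [a0 ab' bh _] := piece_itv ab.
have b0 : 0 <= b by exact: le_trans ab'.
have hb : 0 <= b <= h by rewrite b0.
have ha : 0 <= a <= h by rewrite a0 (le_trans ab').
have {Qa} := Qa (le_trans ab' bsd).
have := w_osc (s := s) (t := b); rewrite s0 sh b0 bh => /(_ isT isT).
have sb : s <= b := le_trans sa ab'.
rewrite ger0_norm ?subr_ge0// => /(_ _)/ler_normlP[|wb1 wb2]; first lra.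
have := mE b hb; have := mE a ha; have mb : m b = y b - (w b - w s) by [].
have := L_mono ab; have := U_mono ab.
move=> Uab Lab mEa mEb.
have [Lb|yb] := L_supp ab; have [Ub|yb'] := U_supp ab.
- rewrite Lb Ub in mEb *.
  have -> : m b = m a by rewrite mEa mEb.
  by [].
- case=> [[Ua La]|[Ua ma]|[La ma]].
  + by apply: Or33; rewrite Lb La; split => //; lra.
  + by exfalso; rewrite Lb in mEb; lra.
  + by apply: Or33; rewrite Lb La; split => //; lra.
- case=> [[Ua La]|[Ua ma]|[La ma]].
  + by apply: Or32; rewrite Ub Ua; split => //; lra.
  + by apply: Or32; rewrite Ub Ua; split => //; lra.
  + by exfalso; rewrite Ub in mEb; lra.
- by exfalso; lra.
Qed.

(** Crude, as it grows with the number [k] of windows. It keeps idleness and losses bounded in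
    [service_fluid], where the scale is large compared with [k]. *)
Lemma L_bound (k : nat) (t : R) : 4 * kap < beta -> 0 <= t -> t <= h ->
  t <= k%:R * del -> L t - L 0 <= k%:R * (2 * kap).
Proof.
move=> kb; elim: k t => [|k ih] t t0 th tk.
  have -> : t = 0 by apply/eqP; rewrite eq_le t0 andbT; move: tk; rewrite mul0r.
  by rewrite subrr mul0r.
have [tk'|tk'] := leP t (k%:R * del).
  have := ih t t0 th tk'; rewrite -natr1 mulrDl mul1r.
  have := L_window kb t0 (lexx t) th _; rewrite subrr lerDl (ltW del0) => /(_ isT).
  by lra.
have := @L_window (k%:R * del) t kb _ (ltW tk') th _.
have := ih (k%:R * del) _ _ (lexx _).
rewrite mulr_ge0 ?(ltW del0)// (le_trans (ltW tk') th).
move: tk; rewrite -natr1 !mulrDl !mul1r => tk /(_ isT isT) h1 /(_ isT tk).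
lra.
Qed.

Context (Del d1 : R) (a : nat -> R).
Hypothesis Del0 : 0 < Del.
Hypothesis delDel : del <= Del.
Hypothesis wa : forall t, 0 <= t <= h -> `|w t - a (Num.truncn (t / Del))| <= d1.
Hypothesis init : `|L 0 - U 0 - (discrete_reflection beta a 0 - a 0%N)| <= kap + (d1 + kap).

(** [u] is the difference of the net regulators. Were it below [- c], then [y] would be more than
    [kap] below the discrete reflection, hence below [beta - kap], while the latter would be
    positive: [U] does not grow and the clip does not raise, so [u] cannot have decreased. Above [c]
    the roles are exchanged. *)
Lemma reflection_compare t : 0 <= t <= h ->
  `|y t - discrete_reflection beta a (Num.truncn (t / Del))| <= kap + 2 * (d1 + kap).
Proof.
(* [d1 + kap] bounds the distance of the noise, at the end of a piece, to the mesh value at its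
   start; the other [kap] is the tolerance of the barriers. *)
pose c := kap + (d1 + kap); pose u t l := L t - U t - (discrete_reflection beta a l - a l).
have yu t' l : 0 <= t' <= h -> y t' - discrete_reflection beta a l = u t' l + (w t' - a l).
  by move=> ht'; rewrite yE// /u; ring.
suff H : forall t, 0 <= t -> t <= h -> `|u t (Num.truncn (t / Del))| <= c.
  move=> /[dup] ht /andP[t0 th]; rewrite yu// (le_trans (ler_normD _ _))//.
  have := H t t0 th; have := wa ht; rewrite /c.
  have kap0 : 0 <= kap.
    have := w_osc ht ht; rewrite !subrr normr0; apply; exact: ltW.
  by lra.
apply: (piece_induction (s := 0)) => //; first by rewrite mul0r Num.Theory.truncn0.
move=> s b _ sb us; have [s0 sb' bh bsd] := piece_itv sb.
have b0 : 0 <= b by exact: le_trans sb'.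
have hb : 0 <= b <= h by rewrite b0.
have hs : 0 <= s <= h by rewrite s0 (le_trans sb').
set l := Num.truncn (s / Del).
have wb : `|w b - a l| <= d1 + kap.
  rewrite (_ : w b - a l = (w s - a l) + (w b - w s)); last by ring.
  rewrite (le_trans (ler_normD _ _))// lerD ?wa//; apply: w_osc => //.
  by rewrite ger0_norm ?subr_ge0// lerBlDl.
have yb := y_bound hb.
have ub : `|u b l| <= c.
  have := yu b l hb; have := discrete_reflection_bound beta0 a l.
  move: us wb; rewrite -/l !ler_norml => /andP[u1 u2] /andP[w1 w2] /andP[p1 p2] yE'.
  apply/andP; split; rewrite leNgt; apply/negP => ubc.
    have [Ub|] := U_supp sb; last by rewrite /c in ubc; lra.
    by have := L_mono sb; move: ubc u1; rewrite /u Ub; lra.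
  have [Lb|] := L_supp sb; last by rewrite /c in ubc; lra.
  by have := U_mono sb; move: ubc u2; rewrite /u Lb; lra.
(* A piece is no longer than the mesh, so it passes at most one mesh point. *)
have [l0 l1] : (l <= Num.truncn (b / Del))%N /\ (Num.truncn (b / Del) <= l.+1)%N.
  have sD : 0 <= s / Del by rewrite divr_ge0// ltW.
  have bD : 0 <= b / Del by rewrite divr_ge0// ltW.
  split; first by apply: le_truncn; rewrite ler_pM2r ?invr_gt0.
  rewrite -ltnS -(ltr_nat R); have /andP[h1 _] := truncn_itv bD.
  rewrite (le_lt_trans h1)// -[l.+2%:R]natr1; have /andP[_ h2] := truncn_itv sD.
  rewrite (le_lt_trans (y := s / Del + 1))//; last by rewrite ltrD2r.
  rewrite ler_pdivrMr// mulrDl divfK ?gt_eqF// mul1r (le_trans bsd)// lerD2l//.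
have [->//|l2] : Num.truncn (b / Del) = l \/ Num.truncn (b / Del) = l.+1.
  move: l1; rewrite leq_eqVlt ltnS => /predU1P[|l1]; [by right|left].
  by apply/eqP; rewrite eqn_leq l1 l0.
have wb' := wa hb; rewrite l2 in wb' *.
have kap0 : 0 <= kap.
  have := w_osc hb hb; rewrite !subrr normr0; apply; exact: ltW.
have := yu b l.+1 hb.
have uS : u b l.+1 = u b l - (discrete_reflection beta a l.+1 - (discrete_reflection beta a l + a l.+1 - a l)).
  by rewrite /u; ring.
have hp : clip beta (discrete_reflection beta a l + a l.+1 - a l) = discrete_reflection beta a l.+1 by [].
have := @clip_le R beta (discrete_reflection beta a l + a l.+1 - a l).
have := @clip_ge R beta (discrete_reflection beta a l + a l.+1 - a l).
rewrite hp; move: ub wb'; rewrite !ler_norml.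
move: (discrete_reflection beta a l.+1) (discrete_reflection beta a l) uS => p p' uS.
move=> /andP[u1 u2] /andP[w1 w2] cg cl yE'.
apply/andP; split; rewrite leNgt; apply/negP => ubc.
  have p0 : 0 < p by rewrite /c in ubc; lra.
  by have := cl p0; lra.
have p0 : p < beta by rewrite /c in ubc; lra.
by have := cg p0; lra.
Qed.

End reflection.

(** * State space collapse *)

Section collapse.
Context (R : realType) (N : nat) (lam mu : 'I_N -> R) (beta kap del h r c k1 : R)
  (piece : R -> R -> Prop) (x nz T ell : 'I_N -> R -> R).
Hypothesis lam0 : forall i, 0 < lam i.
Hypothesis mu0 : forall i, 0 < mu i.
Hypothesis hcrit : \sum_(i < N) lam i / mu i = 1.
Hypothesis kap0 : 0 < kap.
Hypothesis del0 : 0 < del.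
Hypothesis r0 : 0 < r.
Hypothesis c0 : 0 < c.
Hypothesis c_le : forall i, c <= lam i / mu i.
Hypothesis k1_ge : forall i, 4 * kap <= k1 * (mu i)^-1.
Hypothesis piece_itv : forall a b, piece a b -> [/\ 0 <= a, a <= b, b <= h & b <= a + del].
Hypothesis reach : forall s t, 0 <= s -> s <= t -> t <= h ->
  clos_refl_trans _ piece s t.
Hypothesis xE : forall j t, 0 <= t <= h ->
  x j t = nz j t + r * (lam j * t - mu j * T j t) - ell j t.
Hypothesis x_bound : forall j t, 0 <= t <= h -> 0 <= x j t <= beta + kap.
Hypothesis x0 : forall j, x j 0 = 0.
Hypothesis nz_osc : forall j s t, 0 <= s <= h -> 0 <= t <= h -> `|t - s| <= del ->
  `|nz j t - nz j s| <= kap.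
Hypothesis x_jump : forall a b, piece a b -> forall j, `|x j b - x j a| <= kap.
Hypothesis work : forall a b, piece a b ->
  (forall j, T j b = T j a /\ x j a = 0) \/
  exists i, [/\ T i b = T i a + (b - a), forall j, j != i -> T j b = T j a &
    forall j, x j a <= x i a + kap].
Hypothesis ell_mono : forall a b, piece a b -> forall j, ell j a <= ell j b.
Hypothesis ell_supp : forall a b, piece a b -> forall j,
  ell j b = ell j a \/ beta - kap <= x j b.

Let sg i := (mu i)^-1.
Let Sg := \sum_i sg i.
Let wsum (A : {set 'I_N}) := \sum_(i in A) sg i.

Let sg0 i : 0 < sg i. Proof. by rewrite invr_gt0. Qed.

Let wsum_le A : 0 <= wsum A <= Sg.
Proof.
rewrite sumr_ge0/=; last by move=> i _; exact: ltW.
rewrite /Sg [leRHS](bigID (mem A))/= lerDl.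
by apply: sumr_ge0 => i _; exact: ltW.
Qed.

Let Sg_gt0 (i : 'I_N) : 0 < Sg.
Proof.
rewrite /Sg (bigD1 i)//= ltr_pwDl// sumr_ge0// => j _; exact: ltW.
Qed.

Definition weighted_mean (z : 'I_N -> R) := (\sum_i sg i * z i) / Sg.

(* Excess workload of the classes in [A] over their share of the total. The
   penalty is concave in the weight of [A], so that every class of a maximizing
   [A] exceeds every other class by a margin. *)
Definition excess (A : {set 'I_N}) (z : 'I_N -> R) :=
  \sum_(i in A) sg i * z i - wsum A * weighted_mean z
  - k1 * wsum A * (Sg - wsum A).

(** Neither adding [i] to [A] nor removing [j] from it increases the excess. After division by
    [sg i] and [sg j], the difference of the two inequalities leaves the second difference of the
    penalty. *)
Lemma excess_gap (A : {set 'I_N}) z i j : (forall B, excess B z <= excess A z) ->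
  j \in A -> i \notin A -> k1 * (sg i + sg j) <= z j - z i.
Proof.
move=> Amax jA iA.
have hi := Amax (i |: A); have hj := Amax (A :\ j).
have ei (F : 'I_N -> R) : \sum_(k in i |: A) F k = F i + \sum_(k in A) F k.
  by rewrite big_setU1.
have ej (F : 'I_N -> R) : \sum_(k in A) F k = F j + \sum_(k in A :\ j) F k.
  by rewrite (big_setD1 j).
have e1 : wsum (i |: A) = sg i + wsum A by exact: ei.
have e2 : wsum (A :\ j) = wsum A - sg j by rewrite /wsum [in RHS]ej; ring.
have e3 : \sum_(k in A :\ j) sg k * z k = \sum_(k in A) sg k * z k - sg j * z j.
  by rewrite [in RHS](ej (fun k => sg k * z k)); ring.
move: hi hj; rewrite /excess (ei (fun k => sg k * z k)) e3 e1 e2.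
move: (weighted_mean z) (wsum A) (\sum_(k in A) sg k * z k) => m s p hi hj.
have h1 : sg j * (m + k1 * (Sg - 2 * s + sg j)) <= sg j * z j by lra.
have h2 : sg i * z i <= sg i * (m + k1 * (Sg - 2 * s - sg i)) by lra.
rewrite ler_pM2l// in h1; rewrite ler_pM2l// in h2; lra.
Qed.

Let fluid s t (j : 'I_N) := x j t - (nz j t - nz j s).

(** For a maximizing [A] with positive excess, the gap makes every class of [A] longer than all
    others already before the piece. So the server works for [A] only, whose load is at most
    [1 - c], and nothing is lost outside [A]; losses inside [A] lower its workload by at least its
    share in the total loss. *)
Lemma excess_window (s M0 : R) : 0 <= s -> (forall A, excess A (x ^~ s) <= M0) ->
  forall t, s <= t -> t <= h -> t <= s + del ->
  forall A, excess A (fluid s t) <= Num.max 0 (M0 - r * c * (t - s)).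
Proof.
move=> s0 hM0 t st th.
apply: (@piece_induction _ del h piece piece_itv reach s
  (fun t => t <= s + del -> forall A, excess A (fluid s t) <= Num.max 0 (M0 - r * c * (t - s)))) => //.
  move=> _ A; rewrite subrr mulr0 subr0 le_max; apply/orP; right.
  rewrite (_ : fluid s s = x ^~ s)//; apply/funext => j.
  by rewrite /fluid subrr subr0.
move=> {st th t} a b sa ab Qa bsd B; have [a0 ab' bh _] := piece_itv ab.
have b0 : 0 <= b by exact: le_trans ab'.
have hb : 0 <= b <= h by rewrite b0.
have ha : 0 <= a <= h by rewrite a0 (le_trans ab').
have hs : 0 <= s <= h by rewrite s0 (le_trans sa)//; case/andP: ha.
have {}Qa := Qa (le_trans ab' bsd).
have [A Amax] : exists A, forall C, excess C (fluid s b) <= excess A (fluid s b).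
  exists [arg max_(A > (finset.set0 : {set 'I_N})) excess A (fluid s b)]%O => C.
  by case: arg_maxP => // A' _; apply.
apply: le_trans (Amax B) _; rewrite leNgt gt_max; apply/negP => /andP[Apos Abig].
have [j jA] : exists j, j \in A.
  apply/set0Pn; apply: contraTneq Apos => ->; rewrite -leNgt /excess /wsum !big_set0.
  by rewrite !(mul0r, mulr0, subr0).
have [i iA] : exists i, i \notin A.
  have [|/forallPn/=[i iA]] := boolP [forall i, i \in A]; last by exists i.
  move=> /forallP AT; have {}AT : A = [set: 'I_N]%SET by apply/setP => i; rewrite AT inE.
  have eT (F : 'I_N -> R) : \sum_(i in [set: 'I_N]%SET) F i = \sum_i F i.
    by apply: eq_bigl => i; rewrite inE.
  move: Apos; rewrite /excess AT /wsum !eT -/Sg /weighted_mean mulrC divfK ?gt_eqF ?(Sg_gt0 j)//.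
  by rewrite !subrr mulr0 subr0 ltxx.
(* Noise costs [2 * kap] and jumps another [2 * kap]: the margin falls from 8 to 6 for the queues at
   [b] and to 4 for those at [a]. *)
have gap j' i' : j' \in A -> i' \notin A -> 8 * kap <= fluid s b j' - fluid s b i'.
  move=> j'A i'A; apply: le_trans (excess_gap Amax j'A i'A).
  by have := k1_ge i'; have := k1_ge j'; rewrite -/(sg i') -/(sg j'); lra.
have nzb k : `|nz k b - nz k s| <= kap.
  by apply: nz_osc => //; rewrite ger0_norm ?subr_ge0 ?(le_trans sa)// lerBlDl.
have gapb j' i' : j' \in A -> i' \notin A -> 6 * kap <= x j' b - x i' b.
  move=> j'A i'A; have := gap _ _ j'A i'A; rewrite /fluid.
  by have := nzb j'; have := nzb i'; rewrite !ler_norml; lra.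
have gapa j' i' : j' \in A -> i' \notin A -> 4 * kap <= x j' a - x i' a.
  move=> j'A i'A; have := gapb _ _ j'A i'A.
  by have := x_jump ab j'; have := x_jump ab i'; rewrite !ler_norml; lra.
have [idle|[i0 [Ti0 Tj xi0]]] := work ab.
  by have := gapa j i jA iA; have [_ ->] := idle j; have [_ ->] := idle i; have := kap0; lra.
have i0A : i0 \in A.
  apply: contraT => i0A; have := gapa j i0 jA i0A; have := xi0 j; have := kap0; lra.
have lossA k : k \notin A -> ell k b = ell k a.
  move=> kA; have [//|] := ell_supp ab k.
  by have := gapb j k jA kA; have /andP[_] := x_bound j hb; have := kap0; lra.
pose D := b - a; have D0 : 0 <= D by rewrite subr_ge0.
pose dl k := sg k * (ell k b - ell k a).
have dl0 k : 0 <= dl k by rewrite mulr_ge0 ?(ltW (sg0 k))// subr_ge0 ell_mono.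
have step k : sg k * fluid s b k = sg k * fluid s a k +
    (r * (lam k / mu k * D - (T k b - T k a)) - dl k).
  rewrite /fluid (xE k hb) (xE k ha) /dl /D /sg; field.
  by rewrite gt_eqF.
have sumT (C : {set 'I_N}) : i0 \in C -> \sum_(k in C) (T k b - T k a) = D.
  move=> i0C; rewrite (big_setD1 i0)//= Ti0 big1 => [|k]; first by rewrite /D; ring.
  by rewrite finset.in_setD1 => /andP[ki _]; rewrite Tj// subrr.
have sumA : \sum_(k in A) sg k * fluid s b k = \sum_(k in A) sg k * fluid s a k +
    (r * ((\sum_(k in A) lam k / mu k) * D - D) - \sum_(k in A) dl k).
  rewrite (eq_bigr _ (fun k _ => step k)) big_split/= sumrB -mulr_sumr sumrB.
  by rewrite sumT// mulr_suml.
have sumall : \sum_k sg k * fluid s b k = \sum_k sg k * fluid s a k - \sum_(k in A) dl k.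
  rewrite (eq_bigr _ (fun k _ => step k)) big_split/= sumrB -mulr_sumr sumrB.
  have -> : \sum_k (T k b - T k a) = D.
    by rewrite -(sumT [set: 'I_N]%SET) ?inE//; apply: eq_bigl => k; rewrite inE.
  rewrite -mulr_suml hcrit mul1r subrr mulr0 sub0r; congr (_ - _).
  rewrite (bigID (mem A))/= [X in _ + X]big1 ?addr0//.
  by move=> k kA; rewrite /dl lossA// subrr mulr0.
have rhoA : \sum_(k in A) lam k / mu k <= 1 - c.
  have := hcrit; rewrite (bigID (mem A))/= [X in _ + X](bigD1 i)//=.
  have : 0 <= \sum_(k < N | (k \notin A) && (k != i)) lam k / mu k.
    by apply: sumr_ge0 => k _; rewrite divr_ge0// ltW.
  have := c_le i; lra.
pose l := \sum_(k in A) dl k; have l0 : 0 <= l by apply: sumr_ge0.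
have /andP[s1 s2] := wsum_le A.
have Sg0 := Sg_gt0 j.
have frac : wsum A / Sg <= 1 by rewrite ler_pdivrMr// mul1r.
have drop : excess A (fluid s b) <= excess A (fluid s a) - r * c * D.
  rewrite /excess sumA /weighted_mean sumall -/l.
  have h1 : r * ((\sum_(k in A) lam k / mu k) * D - D) <= - (r * c * D).
    rewrite -mulrA -mulrN ler_pM2l//.
    have := ler_wpM2r D0 rhoA; lra.
  have h2 : wsum A / Sg * l <= l by rewrite ler_piMl.
  move: h1 h2; rewrite [wsum A * ((_ - l) / Sg)]mulrCA ![_ / Sg]mulrC; lra.
have := Qa A; rewrite le_max => /orP[Qa'|Qa'].
  have : 0 <= r * c * D by rewrite !mulr_ge0 ?(ltW r0) ?(ltW c0).
  by lra.
move: Abig; rewrite ltNge (le_trans drop)//.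
rewrite (_ : b - s = (a - s) + D); last by rewrite /D; ring.
by apply: le_trans (lerB Qa' (lexx (r * c * D))) _; rewrite [r * c * (_ + D)]mulrDr opprD addrA.
Qed.

Hypothesis rcd : Sg * (beta + kap) <= r * c * del.

(** A window of length [del] ending at [t] dissipates any initial excess, by [rcd]; if [t] is too
    early for that, the window starts at 0, where the system is empty. *)
Lemma excess_fluid_le0 t : 0 <= t <= h ->
  exists s, [/\ 0 <= s <= h, `|t - s| <= del & forall A, excess A (fluid s t) <= 0].
Proof.
move=> /andP[t0 th].
have h0 : 0 <= h by exact: le_trans th.
have k10 (i : 'I_N) : 0 <= k1.
  have := k1_ge i; rewrite -/(sg i) => h1; have := le_trans (mulr_ge0 (ler0n R 4) (ltW kap0)) h1.
  by rewrite pmulr_lge0.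
have pen (A : {set 'I_N}) : 0 <= k1 * wsum A * (Sg - wsum A).
  have [->|[i iA]] := set_0Vmem A; first by rewrite /wsum big_set0 mulr0 mul0r.
  by have /andP[s1 s2] := wsum_le A; rewrite !mulr_ge0 ?subr_ge0 ?(k10 i).
have [td|td] := leP t del.
  exists 0; split; rewrite ?lexx ?subr0 ?ger0_norm// => A.
  apply: le_trans (@excess_window 0 0 (lexx _) _ t t0 th _ A) _.
  - move=> B; rewrite /excess /weighted_mean.
    rewrite !big1 => [|i _|i _]; rewrite ?x0 ?mulr0//.
    by rewrite mul0r mulr0 subrr sub0r oppr_le0.
  - by rewrite add0r.
  - by rewrite ge_max lexx subr0 sub0r oppr_le0 !mulr_ge0 ?(ltW r0) ?(ltW c0).
have s0 : 0 <= t - del by rewrite subr_ge0 ltW.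
have sh : t - del <= h by rewrite (le_trans _ th)// gerBl ltW.
exists (t - del); split; rewrite ?s0 ?sh//.
  by rewrite opprB addrCA subrr addr0 ger0_norm// ltW.
move=> A.
have st : t - del <= t by rewrite gerBl ltW.
apply: le_trans (@excess_window (t - del) (Sg * (beta + kap)) s0 _ t st th _ A) _.
- move=> B; rewrite /excess.
  have hx i : 0 <= x i (t - del) <= beta + kap by apply: x_bound; rewrite s0.
  have m0 : 0 <= weighted_mean (x ^~ (t - del)).
    apply: divr_ge0; last by apply: sumr_ge0 => i _; exact: ltW.
    by apply: sumr_ge0 => i _; rewrite mulr_ge0 ?(ltW (sg0 i))//; case/andP: (hx i).
  have /andP[s1 s2] := wsum_le B.
  rewrite lerBlDr (le_trans _ (lerD (lexx _) (pen B)))// addr0 lerBlDr.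
  rewrite (le_trans _ (lerD (lexx _) (mulr_ge0 s1 m0)))// addr0.
  rewrite /Sg mulr_suml [leRHS](bigID (mem B))/=.
  rewrite -[leLHS]addr0 lerD//.
    by apply: ler_sum => i _; rewrite ler_pM2l//; case/andP: (hx i).
  apply: sumr_ge0 => i _; rewrite mulr_ge0 ?(ltW (sg0 i))//.
  by case/andP: (hx i); exact: le_trans.
- by rewrite subrK.
- by rewrite ge_max lexx/= opprB addrCA subrr addr0 subr_le0.
Qed.

(** The singleton of [j] bounds its queue from above and the complement bounds it from below, with
    the same penalty. Passing from [fluid] to [x] costs [kap] for the class and [kap] for the
    mean. *)
Lemma state_space_collapse t j : 0 <= t <= h ->
  `|x j t - weighted_mean (x ^~ t)| <= k1 * Sg + 2 * kap.
Proof.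
move=> ht; have [s [hs ts Phi0]] := excess_fluid_le0 ht.
have Sg0 := Sg_gt0 j.
have nzb k : `|nz k t - nz k s| <= kap by exact: nz_osc.
have mean : `|weighted_mean (x ^~ t) - weighted_mean (fluid s t)| <= kap.
  rewrite /weighted_mean -mulrBl -sumrB normrM [X in _ * X]gtr0_norm ?invr_gt0//.
  rewrite ler_pdivrMr// (le_trans (ler_norm_sum _ _ _))// mulr_sumr ler_sum// => k _.
  rewrite -mulrBr normrM (gtr0_norm (sg0 k)) mulrC ler_pM2r//.
  by rewrite /fluid opprB addrCA subrr addr0.
have xz : `|x j t - fluid s t j| <= kap by rewrite /fluid opprB addrCA subrr addr0.
have k10 : 0 <= k1.
  have := k1_ge j; rewrite -/(sg j) => h1; have := le_trans (mulr_ge0 (ler0n R 4) (ltW kap0)) h1.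
  by rewrite pmulr_lge0.
have sgS : sg j <= Sg by have := wsum_le [set j]%SET; rewrite /wsum big_set1 => /andP[].
have zm : `|fluid s t j - weighted_mean (fluid s t)| <= k1 * Sg.
  have h1 := Phi0 [set j]%SET; have h2 := Phi0 (~: [set j])%SET.
  move: h1 h2; rewrite /excess /wsum !big_set1.
  have compl (F : 'I_N -> R) : \sum_(i in (~: [set j])%SET) F i = \sum_i F i - F j.
    rewrite [in RHS](bigD1 j)//= addrAC subrr add0r.
    by apply: eq_bigl => i; rewrite !inE.
  rewrite !compl -/Sg.
  have mS : \sum_i sg i * fluid s t i = Sg * weighted_mean (fluid s t).
    by rewrite /weighted_mean mulrC divfK// gt_eqF.
  rewrite mS; move: (fluid s t j) (weighted_mean (fluid s t)) => z m h1 h2.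
  rewrite ler_norml; apply/andP; split.
    rewrite -(ler_pM2l (sg0 j)).
    have : k1 * (sg j * (Sg - sg j)) <= k1 * (sg j * Sg).
      by rewrite ler_wpM2l// ler_pM2l// gerBl ltW.
    lra.
  rewrite -(ler_pM2l (sg0 j)).
  have : k1 * (sg j * (Sg - sg j)) <= k1 * (sg j * Sg).
    by rewrite ler_wpM2l// ler_pM2l// gerBl ltW.
  lra.
move: xz mean zm; rewrite !ler_norml => /andP[? ?] /andP[? ?] /andP[? ?].
by apply/andP; split; lra.
Qed.

End collapse.

(** * Paths of the queue *)

Section chain.
Context (R : realType) (N : nat) (b : 'I_N -> R)
  (tie : nat -> {set 'I_N} -> 'I_N).
Hypothesis tieP : forall c (M : {set 'I_N}) i, i \in M -> tie c M \in M.
Implicit Types (z : state N) (i j : 'I_N).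

(** Along a path this is the number of arrivals ([path_arrived]); expressed through the state, it
    can be followed step by step. *)
Definition arrived z j := (customers z j + completed z j + lost z j)%N.

(** The alternative for a buffer is there because its size may be negative. *)
Definition admissible z :=
  (server z = None -> forall j, queue z j = 0%N) /\
  (forall j, queue z j = 0%N \/ (queue z j)%:R <= b j).

Lemma admissible_empty : admissible (empty_state N).
Proof. by split=> [_|] j; [|left]; rewrite /= ffunE. Qed.

Variant step_spec z : state N -> Prop :=
| Step_serve i : server z = None -> (forall j, queue z j = 0%N) ->
    step_spec z (State (queue z) (Some i) (lost z) (completed z))
| Step_join i k : server z = Some k -> (queue z i).+1%:R <= b i ->
    step_spec z (State (incr (queue z) i) (Some k) (lost z) (completed z))
| Step_lose i k : server z = Some k -> b i < (queue z i).+1%:R ->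
    step_spec z (State (queue z) (Some k) (incr (lost z) i) (completed z))
| Step_empty i : server z = Some i -> (forall j, queue z j = 0%N) ->
    step_spec z (State (queue z) None (lost z) (incr (completed z) i))
| Step_next i j : server z = Some i -> (forall k, (queue z k <= queue z j)%N) ->
    (0 < queue z j)%N ->
    step_spec z (State (decr (queue z) j) (Some j) (lost z) (incr (completed z) i)).

Lemma stepP z z' : admissible z -> step b tie z z' -> step_spec z z'.
Proof.
move=> + h; case: h => {}z i => [[z0 zb]|zi [z0 zb]].
  rewrite /arrive; case zi: (server z) => [k|].
    by case: leP => h; [exact: Step_join|exact: Step_lose].
  by apply: Step_serve => //; exact: z0.
rewrite /complete; case: ifPn => [/forallP q0|/forallPn/=[k qk]].
  by apply: Step_empty => // j; exact/eqP.
have [k0 k0M] : exists k, k \in longest z.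
  exists [arg max_(l > k) queue z l]%N; rewrite inE; apply/forallP => l.
  by case: arg_maxnP => // l' _; apply.
have := tieP (\sum_k completed z k)%N k0M.
set j := tie _ _; rewrite inE => /forallP jM.
apply: Step_next => //.
by apply: leq_trans (jM k); rewrite lt0n.
Qed.

Lemma step_admissible z z' : admissible z -> step b tie z z' -> admissible z'.
Proof.
move=> az /(stepP az); case: (az) => z0 zb; case=> [i|i l|i l|i|i j] => //.
- move=> zl h; split=> //= k; rewrite ffunE.
  by have [->|ki] := eqVneq k i; [right; rewrite addn1|rewrite addn0].
- move=> si _ q0; split => //= k; rewrite ffunE; case: (zb k) => [->|qk].
    by left; rewrite sub0n.
  by right; rewrite (le_trans _ qk)// ler_nat leq_subr.
Qed.

Lemma step_arrived z z' j : admissible z -> step b tie z z' ->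
  [/\ (completed z j <= completed z' j)%N, (lost z j <= lost z' j)%N,
   (customers z j + completed z j <= customers z' j + completed z' j)%N &
   (queue z' j + arrived z j <= queue z j + arrived z' j)%N].
Proof.
move=> az /(stepP az); rewrite /arrived /customers.
case=> [i|i l|i l|i|i k] /= => [-> q0|->|->|-> q0|-> kM k0] //=; rewrite ?ffunE ?q0/=.
- by split; lia.
- by move=> _; split; lia.
- by move=> _; split; lia.
- rewrite (_ : (Some i == Some j) = (j == i)); last by rewrite eq_sym.
  by move: (j == i) => c; split; lia.
- rewrite (_ : (Some i == Some j) = (j == i)); last by rewrite eq_sym.
  rewrite (_ : (Some k == Some j) = (j == k)); last by rewrite eq_sym.
  have : (j == k <= queue z j)%N by case: eqP => // ->.
  by move: (j == k) (j == i) => c c'; split; lia.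
Qed.

(** A new service goes to a longest buffer; the customer who leaves it still counts among the
    customers of the class, which keeps the comparison valid afterwards. *)
Lemma step_server z z' i : admissible z -> step b tie z z' -> server z' = Some i ->
  (server z = Some i /\ completed z' = completed z) \/
  forall j, (queue z' j <= customers z' i)%N.
Proof.
move=> az /(stepP az); rewrite /customers.
case=> [k|k l|k l|k|k l] /= => [zk q0|zk|zk|zk q0|zk kM k0] //=; rewrite ?ffunE.
- by right => j; rewrite q0.
- by move=> _ [<-]; left.
- by move=> _ [<-]; left.
- move=> [<-]; right => j; rewrite !ffunE !eqxx subnK//.
  by rewrite (leq_trans (leq_subr _ _)).
Qed.

(** A buffer shrinks only at the completion of a service, and then by at most one. *)
Lemma step_completed z z' j : admissible z -> step b tie z z' ->
  (queue z j + \sum_i completed z i <= queue z' j + \sum_i completed z' i)%N.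
Proof.
have incrE i : (\sum_k incr (completed z) i k = \sum_k completed z k + 1)%N.
  under eq_bigr do rewrite ffunE.
  by rewrite big_split/= -big_mkcond/= big_pred1_eq.
move=> az /(stepP az).
by case=> [i|i l|i l|i|i k] /=; rewrite ?ffunE ?incrE;
  try move: (j == _) => c; move: (queue z j) (\sum_i _)%N => p q; lia.
Qed.

Lemma step_lost z z' j : admissible z -> step b tie z z' ->
  lost z' j = lost z j \/ b j < (queue z' j).+1%:R.
Proof.
move=> az /(stepP az).
case=> [i|i l|i l|i|i k] /=; do ?by left.
move=> _ h; rewrite ffunE; have [->|_] := eqVneq j i; first by right.
by left; rewrite addn0.
Qed.

Lemma chain_admissible z z' : clos_refl_trans _ (step b tie) z z' ->
  admissible z -> admissible z'.
Proof.
move=> zz' az; elim/clos_refl_trans_ind_left: zz' => // y y' _.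
exact: step_admissible.
Qed.

Lemma chain_arrived z z' j : clos_refl_trans _ (step b tie) z z' -> admissible z ->
  [/\ (completed z j <= completed z' j)%N, (lost z j <= lost z' j)%N,
   (customers z j + completed z j <= customers z' j + completed z' j)%N &
   (queue z' j + arrived z j <= queue z j + arrived z' j)%N].
Proof.
move=> zz' az; elim/clos_refl_trans_ind_left: zz' => // y y' zy [h1 h2 h3 h4] yy'.
have [e1 e2 e3 e4] := step_arrived j (chain_admissible zy az) yy'.
by split; [exact: leq_trans e1|exact: leq_trans e2|exact: leq_trans e3|lia].
Qed.

Lemma chain_server z z' i : clos_refl_trans _ (step b tie) z z' -> admissible z ->
  server z' = Some i -> (server z = Some i /\ completed z' = completed z) \/
  forall j, (queue z' j + arrived z j <= customers z' i + arrived z' j)%N.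
Proof.
move=> zz' az; elim/clos_refl_trans_ind_left: zz' => [zi|y y' zy ih yy' y'i].
  by left.
have ay := chain_admissible zy az.
have [[yi yc]|h] := step_server ay yy' y'i.
  have [[zi zc]|h] := ih yi; first by left; rewrite yc.
  right => j; have := h j; have [_ _ _] := step_arrived j ay yy'.
  have [_ _ + _] := step_arrived i ay yy'; rewrite yc; lia.
right => j; have := h j; have [] := chain_arrived j zy az.
by have [] := step_arrived j ay yy'; rewrite /arrived; lia.
Qed.

Lemma chain_customers z z' j : clos_refl_trans _ (step b tie) z z' -> admissible z ->
  (customers z' j + arrived z j <= customers z j + arrived z' j)%N.
Proof.
by move=> zz' az; have [] := chain_arrived j zz' az; rewrite /arrived; lia.
Qed.

(** Buffer [j] was full when the customer was lost, but completions at the same instant may have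
    reduced it since; they are counted on the right. *)
Lemma chain_lost z z' j : clos_refl_trans _ (step b tie) z z' -> admissible z ->
  lost z' j = lost z j \/
  b j + (\sum_i completed z i)%:R < (queue z' j + (\sum_i completed z' i)).+1%:R.
Proof.
move=> zz' az; elim/clos_refl_trans_ind_left: zz' => [|y y' zy ih yy']; first by left.
have ay := chain_admissible zy az.
have [e|h] := step_lost j ay yy'.
  have [e'|h] := ih; first by left; rewrite e e'.
  right; apply: lt_le_trans h _; rewrite ler_nat ltnS.
  exact: (step_completed j ay yy').
right; rewrite -addSn natrD ltr_leD// ler_nat leq_sum// => i _.
by have [] := chain_arrived i (rt_trans _ _ _ _ _ zy (rt_step _ _ _ _ yy')) az.
Qed.

End chain.

(** Least upper bound argument: the supremum of the reachable times is reached by a piece from the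
    left, and a piece to the right would pass it if it were below [t]. *)
Lemma reach_pieces (R : realType) (h : R) (piece : R -> R -> Prop) :
  (forall t, 0 < t -> t <= h -> exists2 e, 0 < e &
    forall u, 0 <= u -> t - e < u < t -> piece u t) ->
  (forall t, 0 <= t -> exists2 e, 0 < e &
    forall u, t < u < t + e -> u <= h -> piece t u) ->
  forall s t, 0 <= s -> s <= t -> t <= h -> clos_refl_trans _ piece s t.
Proof.
move=> left right s t s0 st th.
pose A : set R := [set u | s <= u <= t /\ clos_refl_trans _ piece s u].
have As : A s by split; [rewrite lexx|exact: rt_refl].
have supA : has_sup A.
  by split; [exists s|exists t => u [/andP[]]].
have ubA u : A u -> u <= sup A by exact: sup_upper_bound.
have sm : s <= sup A by exact: ubA.
have mt : sup A <= t by apply: ge_sup; [exists s|move=> u [/andP[]]].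
have Am : A (sup A).
  move: sm; rewrite le_eqVlt => /predU1P[<-//|sm].
  have [||e e0 he] := left (sup A); first exact: le_lt_trans sm.
    exact: le_trans th.
  have [u Au um] := sup_adherent e0 supA.
  have := ubA _ Au; rewrite le_eqVlt => /predU1P[<-//|um'].
  have [/andP[su ut] cu] := Au.
  split; first by rewrite (ltW sm).
  apply: rt_trans cu _; apply: rt_step; apply: he; first exact: le_trans su.
  by rewrite um.
move: mt; rewrite le_eqVlt => /predU1P[<-|mt]; first by case: Am.
have [e e0 he] := right (sup A) (le_trans s0 sm).
pose u := Num.min t (sup A + e / 2).
have mu : sup A < u by rewrite /u lt_min mt ltrDl divr_gt0.
have : A u.
  split; first by rewrite (le_trans sm (ltW mu)) ge_min lexx.
  case: Am => _ cm; apply: rt_trans cm _; apply: rt_step; apply: he.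
    by rewrite mu gt_min ltrD2l gtr_pMr ?invf_lt1 ?ltr1n// orbT.
  by rewrite (le_trans _ th)// ge_min lexx.
by move/ubA; rewrite leNgt mu.
Qed.

Section path.
Context (R : realType) (N : nat) (b : 'I_N -> R)
  (tie : nat -> {set 'I_N} -> 'I_N) (E S : 'I_N -> R -> nat) (Z : R -> state N).
Hypothesis tieP : forall c (M : {set 'I_N}) i, i \in M -> tie c M \in M.
Hypothesis Zpath : slq_path b tie E S Z.
Lemma path_arrived t i : 0 <= t -> arrived (Z t) i = E i t.
Proof.
have [_ _ _ cS cE] := Zpath => t0.
by have := cS t i t0; have := cE t i t0; rewrite /arrived => + ->; lia.
Qed.

Context (del h : R).
Hypothesis del0 : 0 < del.

(** All events of a piece sit at its right end: the state is frozen before, and the chain of steps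
    describes the instant [t]. *)
Definition path_piece (s t : R) :=
  [/\ [/\ 0 <= s, s <= t, t <= h & t <= s + del],
   forall u, s <= u < t -> Z u = Z s & clos_refl_trans _ (step b tie) (Z s) (Z t)].

Lemma path_reach s t : 0 <= s -> s <= t -> t <= h ->
  clos_refl_trans _ path_piece s t.
Proof.
have [Z0 Zr Zl _ _] := Zpath.
apply: reach_pieces => {s t} [t t0 th|t t0].
  have [z /at_left_ball[e e0 he] zt] := Zl t t0.
  exists (Num.min e del) => [|u u0 /andP[tu ut]]; first by rewrite lt_min e0.
  have teu : t - e < u by rewrite (le_lt_trans _ tu)// lerD2l lerN2 ge_min lexx.
  have tdu : t - del < u by rewrite (le_lt_trans _ tu)// lerD2l lerN2 ge_min lexx orbT.
  have uz : Z u = z by apply: he; rewrite teu.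
  split; rewrite ?uz//.
    by split => //; [exact: ltW|rewrite -lerBlDr ltW].
  by move=> v /andP[uv vt]; rewrite (he v) ?vt ?andbT//; exact: lt_le_trans uv.
have /at_right_ball[e e0 he] := Zr t t0.
exists (Num.min e del) => [|u /andP[tu ut] uh]; first by rewrite lt_min e0.
move: ut; rewrite -ltrBlDl lt_min !ltrBlDl => /andP[ut1 ut2].
split.
- by split; rewrite // ltW.
- move=> v /andP[]; rewrite le_eqVlt => /predU1P[->//|tv vu].
  by apply: he; rewrite tv (lt_trans vu).
- by rewrite (he u) ?tu//; exact: rt_refl.
Qed.

Lemma path_induction (Q : R -> Prop) : Q 0 ->
  (forall s t, path_piece s t -> Q s -> Q t) ->
  forall t, 0 <= t -> t <= h -> Q t.
Proof.
move=> Q0 QS; have itv s t : path_piece s t -> [/\ 0 <= s, s <= t, t <= h & t <= s + del].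
  by case.
exact: (piece_induction itv path_reach (lexx 0) Q0 (fun a b _ => QS a b)).
Qed.

Lemma path_admissible t : 0 <= t -> t <= h -> admissible b (Z t).
Proof.
move: t; apply: path_induction => [|s t [_ _ st] as_]; last exact: chain_admissible st as_.
by have [-> _ _ _ _] := Zpath; exact: admissible_empty.
Qed.

Let busy i (t : R) := [set s : R | 0 <= s <= t /\ server (Z s) = Some i].
Let busy_between i (s t : R) := [set u : R | s < u <= t /\ server (Z u) = Some i].

Let busyU i s t : 0 <= s -> s <= t -> busy i t = busy i s `|` busy_between i s t.
Proof.
move=> s0 st; apply/seteqP; split => [u [/andP[u0 ut] iu]|u [[/andP[u0 us] iu]|[/andP[su ut] iu]]].
- have [us|su] := leP u s; [left|right]; split=> //; last by rewrite su.
  by rewrite u0.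
- by split=> //; rewrite u0 (le_trans us).
- by split=> //; rewrite ut andbT (le_trans s0)// ltW.
Qed.

(** The set is an interval or empty, up to the point [t], where the state may differ from that on
    the rest of the piece. *)
Let busy_betweenE i s t : path_piece s t ->
  [/\ measurable (busy_between i s t) &
   lebesgue_measure (busy_between i s t) =
     (if server (Z s) == Some i then t - s else 0)%:E].
Proof.
move=> [[s0 st _ _] cst _].
have [<-|nst] := eqVneq s t.
  have -> : busy_between i s s = set0.
    by rewrite -subset0 => u [/andP[su us]]; move: (lt_le_trans su us); rewrite ltxx.
  by rewrite measure0 subrr if_same; split.
have {}st : s < t by rewrite lt_neqAle nst.
have cst' u : s < u -> u < t -> Z u = Z s by move=> su ut; apply: cst; rewrite (ltW su).
case: eqP => si; case: (eqVneq (server (Z t)) (Some i)) => ti.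
- have -> : busy_between i s t = `]s, t]%classic.
    apply/seteqP; split => u; rewrite /= in_itv/=; first by case.
    move=> /[dup] sut /andP[su]; rewrite le_eqVlt => /predU1P[->|ut].
      by split => //; rewrite st lexx.
    by split => //; rewrite cst'.
  by split; [exact: measurable_itv|rewrite lebesgue_measure_itv/= lte_fin st EFinB].
- have -> : busy_between i s t = `]s, t[%classic.
    apply/seteqP; split => u; rewrite /= in_itv/=.
      move=> [/andP[->]]; rewrite le_eqVlt => /predU1P[->|//].
      by move/eqP: ti.
    by move=> /[dup] sut /andP[su ut]; split => //; [rewrite su ltW|rewrite cst'].
  by split; [exact: measurable_itv|rewrite lebesgue_measure_itv/= lte_fin st EFinB].
- have -> : busy_between i s t = [set t].
    apply/seteqP; split => u /=; last by move=> ->; rewrite /busy_between/= st lexx.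
    move=> [/andP[su]]; rewrite le_eqVlt => /predU1P[->//|ut].
    by rewrite cst'.
  by split; [exact: measurable_set1|rewrite lebesgue_measure_set1].
- have -> : busy_between i s t = set0.
    rewrite -subset0 => u [/andP[su]]; rewrite le_eqVlt => /predU1P[->|ut].
      by move/eqP: ti.
    by rewrite cst'.
  by rewrite measure0; split.
Qed.

Let busy0 i : busy i 0 `<=` [set 0].
Proof. by move=> u [/andP[u0 u0'] _] /=; apply/eqP; rewrite eq_le u0'. Qed.

Let busy_measurable i t : 0 <= t -> t <= h -> measurable (busy i t).
Proof.
move: t; apply: path_induction => [|s t st ms].
  by have /subset_set1[->|->] := @busy0 i; [exact: measurable0|exact: measurable_set1].
have [[s0 st' _ _] _ _] := st; have [m _] := busy_betweenE i st.
by rewrite (busyU i s0 st'); exact: measurableU.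
Qed.

Lemma service_time0 i : service_time Z i 0 = 0.
Proof.
rewrite /service_time -/(busy i 0).
have /subset_set1[->|->] := @busy0 i; first by rewrite measure0.
by rewrite lebesgue_measure_set1.
Qed.

Lemma service_time_piece i s t : path_piece s t ->
  service_time Z i t = service_time Z i s + (if server (Z s) == Some i then t - s else 0).
Proof.
move=> st; have [[s0 st' th _] _ _] := st; have [m me] := busy_betweenE i st.
have sh := le_trans st' th.
have fin : lebesgue_measure (busy i s) \is a fin_num.
  rewrite ge0_fin_numE// (@le_lt_trans _ _ (lebesgue_measure `[0, s]%classic))//.
    apply: le_measure; rewrite ?inE.
    - exact: busy_measurable.
    - exact: measurable_itv.
    - by move=> u [us _]; rewrite /= in_itv.
  by rewrite lebesgue_measure_itv; case: ifP => _; rewrite ltry.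
rewrite /service_time -/(busy i t) -/(busy i s) (busyU i s0 st') measureU//.
- by rewrite [X in fine (_ + X)]me fineD.
- exact: busy_measurable.
- rewrite -subset0 => u [[/andP[_ us] _] [/andP[su _] _]].
  by move: (le_lt_trans us su); rewrite ltxx.
Qed.

Context (J : nat).
Hypothesis E_jump : forall s t, path_piece s t -> forall j, (E j t <= E j s + J)%N.

(** The witness is the start of the service in progress, when its class was the longest up to the
    arrivals of the same instant, counted by [J]. The age of the service is bounded only later,
    through the service noise. *)
Lemma service_start i t : 0 <= t -> t <= h -> server (Z t) = Some i ->
  exists s, [/\ 0 <= s <= t, completed (Z t) i = completed (Z s) i,
   service_time Z i t = service_time Z i s + (t - s) &
   forall j, (queue (Z t) j + E j s <= customers (Z t) i + E j t + J)%N].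
Proof.
move: t; apply: path_induction => [|s t st ih ti].
  by have [-> _ _ _ _] := Zpath.
have [[s0 st' th _] _ rst] := st.
have t0 := le_trans s0 st'; have sh := le_trans st' th.
have as_ := path_admissible s0 sh.
have [[si e]|new] := chain_server tieP rst as_ ti.
  have [a [/andP[a0 sa] ca Ta ja]] := ih si; exists a; split.
  - by rewrite a0 (le_trans sa).
  - by rewrite e.
  - by rewrite (service_time_piece i st) si eqxx Ta; lra.
  - move=> j; have := ja j; have [_ _ _] := chain_arrived tieP j rst as_.
    have [_ _ + _] := chain_arrived tieP i rst as_.
    by rewrite e !path_arrived//; lia.
exists t; split; rewrite ?t0 ?lexx ?subrr ?addr0//.
by move=> j; have := new j; have := E_jump st j; rewrite !path_arrived//; lia.
Qed.

End path.

(** * The scaled queue *)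

Lemma modulus_bound (R : realType) (g : R -> R) (del h kap : R) (k : nat) (t : R) :
  0 < del ->
  (forall s t, 0 <= s <= h -> 0 <= t <= h -> `|t - s| <= del -> `|g t - g s| <= kap) ->
  0 <= t <= h -> t <= k%:R * del -> `|g t - g 0| <= k%:R * kap.
Proof.
move=> del0 osc; elim: k t => [|k ih] t /andP[t0 th] tk.
  have -> : t = 0 by apply/eqP; rewrite eq_le t0 andbT; move: tk; rewrite mul0r.
  by rewrite subrr normr0 mul0r.
have h0 : 0 <= h by exact: le_trans th.
pose s := Num.max 0 (t - del).
have s0 : 0 <= s by rewrite le_max lexx.
have st : s <= t by rewrite ge_max t0 gerBl ltW.
have ts : t - del <= s by rewrite le_max lexx orbT.
have sk : s <= k%:R * del.
  rewrite ge_max mulr_ge0 ?(ltW del0)//= lerBlDr.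
  by rewrite -[X in _ + X]mul1r -mulrDl natr1.
have := ih s; rewrite s0 (le_trans st th) => /(_ isT sk) h1.
have := osc s t; rewrite s0 (le_trans st th) t0 th => /(_ isT isT).
rewrite ger0_norm ?subr_ge0// => /(_ _) h2.
rewrite -natr1 mulrDl mul1r (_ : g t - g 0 = (g s - g 0) + (g t - g s)); last by ring.
by rewrite (le_trans (ler_normD _ _))// lerD// h2//; lra.
Qed.

Lemma ler_norm_convex (R : realDomainType) (N : nat) (p g : 'I_N -> R) (e : R) :
  (forall i, 0 <= p i) -> \sum_i p i = 1 -> (forall i, `|g i| <= e) ->
  `|\sum_i p i * g i| <= e.
Proof.
move=> p0 p1 ge; rewrite -[leRHS]mul1r -p1 mulr_suml.
rewrite (le_trans (ler_norm_sum _ _ _))// ler_sum// => i _.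
by rewrite normrM (ger0_norm (p0 i)) ler_wpM2l.
Qed.

Section scaled.
Context (R : realType) (N : nat) (lam mu lamhat lamn ep : 'I_N -> R)
  (beta r rr C nu del h H epsg : R) (k : nat)
  (tie : nat -> {set 'I_N} -> 'I_N) (E S : 'I_N -> R -> nat) (Z : R -> state N).
Hypothesis tieP : forall c (M : {set 'I_N}) i, i \in M -> tie c M \in M.
Hypothesis Zpath : slq_path (fun i => beta * r + ep i * r) tie E S Z.
Hypothesis E_mono : forall i s t, 0 <= s -> s <= t -> (E i s <= E i t)%N.
Hypothesis S_mono : forall i s t, 0 <= s -> s <= t -> (S i s <= S i t)%N.
Hypothesis E0 : forall i, E i 0 = 0%N.
Hypothesis S0 : forall i, S i 0 = 0%N.
Hypothesis rrE : rr = r ^+ 2.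
Hypothesis N0 : (0 < N)%N.
Hypothesis lam0 : forall i, 0 < lam i.
Hypothesis mu0 : forall i, 0 < mu i.
Hypothesis hcrit : \sum_(i < N) lam i / mu i = 1.
Hypothesis C1 : 1 <= C.
Hypothesis lamC : forall i, lam i <= C /\ (lam i)^-1 <= C.
Hypothesis muC : forall i, mu i <= C /\ (mu i)^-1 <= C.
Hypothesis lamhatC : forall i, `|lamhat i| <= C.
Hypothesis nu0 : 0 < nu.
Hypothesis nu1 : nu <= 1.
Hypothesis del0 : 0 < del.
Hypothesis delC : del * C <= nu.
Hypothesis h0 : 0 <= h.
Hypothesis hH : h + 1 < H.
Hypothesis hk : h <= k%:R * del.
Hypothesis beta0 : 0 < beta.

Let e j t := r^-1 * ((E j t)%:R - lamn j * t).
Let s j t := r^-1 * ((S j t)%:R - rr * mu j * t).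
Let q j := r^-1 * lamn j.

Hypothesis e_osc : forall j u t, 0 <= u < H -> 0 <= t < H -> `|t - u| <= del ->
  `|e j t - e j u| <= nu.
Hypothesis s_osc : forall j u t, 0 <= u < H -> 0 <= t < H -> `|t - u| <= del ->
  `|s j t - s j u| <= nu.
Hypothesis r_inv : r^-1 <= nu.
Hypothesis ep_le : forall j, `|ep j| <= nu.
Hypothesis lamn_le : forall j, `|q j - r * lam j - lamhat j| * (h + 1) <= nu.
Hypothesis r_ge : 2 * C * (C + 1) <= r.
Hypothesis r_large : 2 * N%:R * C ^+ 3 * k.+1%:R * beta <= r * del.
Hypothesis r_large' : nu * C < r * del.

(** One tolerance for all errors over a piece or a window. The 6 comes from [work]: 3 for arrivals
    during the service in progress, 2 for those at its start, 1 for the customer in service. The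
    factor [N%:R] comes from [ell_supp], where completions of all classes may follow a loss. *)
Let kap := 6 * N%:R * C ^+ 2 * nu.
Let Sg := \sum_(i < N) (mu i)^-1.
Let col := 4 * kap * C * Sg + 2 * kap.

Hypothesis kap_beta : 4 * (kap + col) < beta.

Let C0 : 0 < C. Proof. exact: lt_le_trans C1. Qed.
Let NR1 : 1 <= N%:R :> R. Proof. by rewrite ler1n. Qed.
Let r0 : 0 < r.
Proof. by apply: lt_le_trans r_ge; rewrite !mulr_gt0 ?addr_gt0. Qed.

Let D := C ^+ 2 * nu.
Let nuD : nu <= D.
Proof. by rewrite /D ler_peMl ?(ltW nu0)// exprn_ege1. Qed.
Let D0 : 0 < D. Proof. exact: lt_le_trans nuD. Qed.
Let kapE : kap = 6 * (N%:R * D). Proof. by rewrite /kap /D; ring. Qed.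
Let ND : D <= N%:R * D.
Proof. by rewrite ler_peMl// ltW. Qed.

Let q_diff j : `|q j - r * lam j - lamhat j| <= nu.
Proof. by apply: le_trans (lamn_le j); rewrite ler_peMr// lerDr. Qed.

Let lam_r j : 2 * (C + 1) <= r * lam j.
Proof.
have [_] := lamC j; rewrite -[_^-1]div1r ler_pdivrMr// => lC.
apply: le_trans (ler_wpM2r (ltW (lam0 j)) r_ge).
rewrite (_ : 2 * C * (C + 1) * lam j = 2 * (C + 1) * (C * lam j)); last by ring.
by rewrite ler_peMr// mulr_ge0// addr_ge0// ltW.
Qed.

Let q_ge j : r * lam j / 2 <= q j.
Proof.
have := q_diff j; have := lamhatC j; have := lam_r j; rewrite !ler_norml => ? /andP[? ?] /andP[? ?].
have := nu1; lra.
Qed.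

Let q_le j : q j <= 2 * C * r.
Proof.
have := q_diff j; have := lamhatC j; have := lam_r j; rewrite !ler_norml => ? /andP[? ?] /andP[? ?].
have [lC _] := lamC j; have : r * lam j <= C * r by rewrite mulrC ler_pM2r.
have := nu1; lra.
Qed.

Let rq j x : 0 <= x -> r * x <= 2 * C * (q j * x).
Proof.
move=> x0; suff qq : r <= 2 * C * q j by rewrite (le_trans (ler_wpM2r x0 qq))// -(mulrA (2 * C)).
have [_] := lamC j; rewrite -[_^-1]div1r ler_pdivrMr// => lC.
have qq : 2 * C * (r * lam j / 2) <= 2 * C * q j by rewrite ler_pM2l ?mulr_gt0.
apply: le_trans qq.
rewrite (_ : _ * (r * lam j / 2) = r * (C * lam j)); last by field.
by rewrite ler_peMr// ltW.
Qed.

Let piece := path_piece (fun i => beta * r + ep i * r) tie Z del h.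
Let T j := service_time Z j.
Let x j t := r^-1 * (customers (Z t) j)%:R.
Let ell j t := r^-1 * (lost (Z t) j)%:R.
Let nz j t := e j t + (q j - r * lam j) * t - s j (T j t).

Let piece_itv a b : piece a b -> [/\ 0 <= a, a <= b, b <= h & b <= a + del].
Proof. by case. Qed.

Let reach : forall a b, 0 <= a -> a <= b -> b <= h -> clos_refl_trans _ piece a b.
Proof. by move=> a b; exact: (path_reach Zpath). Qed.

Let in_H t : 0 <= t -> t <= h -> 0 <= t < H.
Proof. by move=> -> th /=; apply: le_lt_trans th _; apply: lt_trans hH; rewrite ltrDl. Qed.

(** No arrival occurs strictly inside a piece, where [e j] therefore decreases at rate [q j]; the
    modulus [nu] of [e j] bounds the length. *)
Let piece_short a b j : piece a b -> q j * (b - a) <= nu.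
Proof.
move=> ab; have [a0 ab' bh bd] := piece_itv ab; have [_ cst _] := ab.
have q0 : 0 < q j by apply: lt_le_trans (q_ge j); rewrite !mulr_gt0.
rewrite leNgt; apply/negP; rewrite mulrC -ltr_pdivrMr// ltrBrDl => ub.
(* Strictly before [b], where arrivals may already be counted. *)
pose u := (a + nu / q j + b) / 2.
have nq : 0 < nu / q j by rewrite divr_gt0.
have au : a <= u by rewrite /u; lra.
have ub' : u < b by rewrite /u; lra.
have u0 : 0 <= u by exact: le_trans au.
have := e_osc j (in_H a0 (le_trans ab' bh)) (in_H u0 (le_trans (ltW ub') bh)).
rewrite ger0_norm ?subr_ge0// => /(_ _) eu.
have {}eu := eu ltac:(lra).
have Eu : E j u = E j a.
  by rewrite -!(path_arrived Zpath)// cst// au.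
move: eu; rewrite /e Eu -mulrBr (_ : _ * (_ - _) = - (q j * (u - a))); last by rewrite /q; ring.
rewrite normrN ger0_norm; last by apply: mulr_ge0; [exact: ltW|rewrite subr_ge0].
rewrite mulrC -ler_pdivlMr//; rewrite /u in ub *; lra.
Qed.

Let r_piece a b : piece a b -> r * (b - a) <= 2 * (C * nu).
Proof.
move=> ab; have [a0 ab' bh bd] := piece_itv ab.
have j : 'I_N := Ordinal N0.
have := @rq j (b - a); rewrite subr_ge0 => /(_ ab')/le_trans; apply.
by rewrite -mulrA !ler_pM2l//; exact: piece_short.
Qed.

Let scaled_count a b j : r^-1 * ((E j b)%:R - (E j a)%:R) = (e j b - e j a) + q j * (b - a).
Proof. by rewrite /e /q; ring. Qed.

Let scaled_service a b j :
  r^-1 * ((S j b)%:R - (S j a)%:R) = (s j b - s j a) + r * mu j * (b - a).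
Proof. by rewrite /s rrE; field; rewrite gt_eqF. Qed.

Let E_piece a b j : piece a b -> r^-1 * ((E j b)%:R - (E j a)%:R) <= 2 * nu.
Proof.
move=> ab; have [a0 ab' bh bd] := piece_itv ab.
rewrite scaled_count.
have := e_osc j (in_H a0 (le_trans ab' bh)) (in_H (le_trans a0 ab') bh).
rewrite ger0_norm ?subr_ge0// => /(_ ltac:(lra))/ler_normlP[_].
have := piece_short j ab; lra.
Qed.

Let T_piece a b j : piece a b -> T j a <= T j b <= T j a + (b - a).
Proof.
move=> ab; have [a0 ab' bh bd] := piece_itv ab.
rewrite /T (service_time_piece Zpath del0 j ab).
by case: ifP => _; apply/andP; split; lra.
Qed.

Let T_lip a b j : 0 <= a -> a <= b -> b <= h -> T j a <= T j b <= T j a + (b - a).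
Proof.
move=> a0; apply: (piece_induction piece_itv reach
   (Q := fun b => T j a <= T j b <= T j a + (b - a)) a0).
  by rewrite subrr addr0 lexx.
move=> c d ac cd /andP[h1 h2]; have /andP[h3 h4] := T_piece j cd.
by apply/andP; split; lra.
Qed.

Let T0 j : T j 0 = 0. Proof. exact: service_time0. Qed.

Let T_bound j t : 0 <= t -> t <= h -> 0 <= T j t <= t.
Proof. by move=> t0 th; have := T_lip j (lexx 0) t0 th; rewrite T0 add0r subr0. Qed.

Let T_in_H j t : 0 <= t -> t <= h -> 0 <= T j t < H.
Proof.
by move=> t0 th; have /andP[h1 h2] := T_bound j t0 th; apply: in_H => //; exact: le_trans th.
Qed.

Let completedE t j : 0 <= t -> completed (Z t) j = S j (T j t).
Proof. by have [_ _ _ + _] := Zpath; exact. Qed.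

Let completed_piece a b j : piece a b ->
  r^-1 * ((completed (Z b) j)%:R - (completed (Z a) j)%:R) <= 3 * D.
Proof.
move=> ab; have [a0 ab' bh bd] := piece_itv ab.
have ah := le_trans ab' bh; have b0 := le_trans a0 ab'.
rewrite !completedE// scaled_service; have /andP[t1 t2] := T_piece j ab.
have := s_osc j (T_in_H j a0 ah) (T_in_H j b0 bh).
rewrite ger0_norm ?subr_ge0// => /(_ ltac:(lra))/ler_normlP[_].
suff : r * mu j * (T j b - T j a) <= 2 * D by have := nuD; lra.
apply: (@le_trans _ _ (r * (b - a) * C)); last first.
  have := r_piece ab; rewrite -(ler_pM2r C0).
  by rewrite (_ : 2 * (C * nu) * C = 2 * D)//; rewrite /D; ring.
have [mC _] := muC j.
rewrite (_ : r * mu j * _ = r * (T j b - T j a) * mu j); last by ring.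
apply: ler_pM => //; rewrite ?mulr_ge0 ?(ltW r0) ?subr_ge0 ?(ltW (mu0 j))//.
by rewrite ler_pM2l//; lra.
Qed.

Let xE j t : 0 <= t <= h -> x j t = nz j t + r * (lam j * t - mu j * T j t) - ell j t.
Proof.
move=> /andP[t0 th]; have := path_arrived Zpath j t0; rewrite /arrived => /(congr1 (fun n => n%:R : R)).
rewrite !natrD completedE// /x /nz /ell /e /s /q rrE => h1.
have -> : (customers (Z t) j)%:R = (E j t)%:R - (S j (T j t))%:R - (lost (Z t) j)%:R :> R.
  by rewrite /customers natrD -h1; ring.
by field; rewrite gt_eqF.
Qed.

Let admis t : 0 <= t -> t <= h -> admissible (fun i => beta * r + ep i * r) (Z t).
Proof. exact: (path_admissible tieP Zpath del0). Qed.

Let queue_x t j : r^-1 * (queue (Z t) j)%:R <= x j t.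
Proof. by rewrite ler_pM2l ?invr_gt0// ler_nat leq_addr. Qed.

Let x_queue t j : x j t <= r^-1 * (queue (Z t) j)%:R + nu.
Proof.
rewrite /x /customers natrD mulrDr lerD2l (le_trans _ r_inv)// -[leRHS]mulr1.
by rewrite ler_pM2l ?invr_gt0// lern1 leq_b1.
Qed.

Let x_bound j t : 0 <= t <= h -> 0 <= x j t <= beta + kap.
Proof.
move=> /andP[t0 th]; rewrite mulr_ge0 ?invr_ge0 ?(ltW r0)//=.
have := x_queue t j; have [_ /(_ j)[->|qb]] := admis t0 th.
  by rewrite mulr0; have := beta0; have := nu0; have := D0; have := nuD; have := ND; rewrite kapE; lra.
have : r^-1 * (queue (Z t) j)%:R <= beta + ep j.
  by rewrite mulrC ler_pdivrMr// mulrDl.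
have := ep_le j; rewrite ler_norml => /andP[_].
by have := beta0; have := nu0; have := D0; have := nuD; have := ND; rewrite kapE; lra.
Qed.

Let x0 j : x j 0 = 0.
Proof. by have [Z0 _ _ _ _] := Zpath; rewrite /x Z0 /customers ffunE mulr0. Qed.

Let nz_osc j u t : 0 <= u <= h -> 0 <= t <= h -> `|t - u| <= del -> `|nz j t - nz j u| <= kap.
Proof.
wlog ut : u t / u <= t.
  move=> W hu ht tu; have [|/ltW] := leP u t; first by move=> ?; exact: W.
  by move=> ?; rewrite distrC W// distrC.
move=> /andP[u0 uh] /andP[t0 th]; rewrite ger0_norm ?subr_ge0// => tu.
have := e_osc j (in_H u0 uh) (in_H t0 th); rewrite ger0_norm ?subr_ge0// => /(_ tu) h1.
have /andP[T1 T2] := T_lip j u0 ut th.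
have := s_osc j (T_in_H j u0 uh) (T_in_H j t0 th); rewrite ger0_norm ?subr_ge0//.
move=> /(_ ltac:(lra)) h2.
have h3 : `|(q j - r * lam j) * (t - u)| <= 2 * nu.
  rewrite normrM (ger0_norm (_ : 0 <= t - u)) ?subr_ge0//.
  have : `|q j - r * lam j| <= C + nu.
    rewrite (_ : q j - _ = (q j - r * lam j - lamhat j) + lamhat j); last by ring.
    by rewrite (le_trans (ler_normD _ _))// addrC lerD.
  have tu0 : 0 <= t - u by rewrite subr_ge0.
  move=> /(ler_wpM2r tu0)/le_trans; apply.
  apply: (@le_trans _ _ ((C + nu) * del)); first by rewrite ler_wpM2l// addr_ge0 ?ltW.
  rewrite mulrDl mulrC; have : nu * del <= C * del by rewrite ler_pM2r// (le_trans nu1).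
  by have := delC; rewrite mulrC; lra.
rewrite /nz (_ : _ - _ = (e j t - e j u) + (q j - r * lam j) * (t - u) - (s j (T j t) - s j (T j u))); last by ring.
rewrite (le_trans (ler_normB _ _))// (le_trans (lerD (ler_normD _ _) (lexx _)))//.
by have := beta0; have := nu0; have := D0; have := nuD; have := ND; rewrite kapE; lra.
Qed.

Let arr_nat a b j : piece a b -> (E j a <= E j b)%N.
Proof. by move=> /piece_itv[a0 ab _ _]; exact: E_mono. Qed.

Let x_jump_le a b j : piece a b -> `|x j b - x j a| <= 5 * D.
Proof.
move=> ab; have [a0 ab' bh bd] := piece_itv ab; have [_ _ ch] := ab.
have b0 := le_trans a0 ab'.
have [_ _ c3 _] := chain_arrived tieP j ch (admis a0 (le_trans ab' bh)).
have cu : (customers (Z b) j + E j a <= customers (Z a) j + E j b)%N.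
  have := chain_customers tieP j ch (admis a0 (le_trans ab' bh)).
  by rewrite !(path_arrived Zpath).
have h1 := E_piece j ab; have h2 := completed_piece j ab.
have {}cu : r^-1 * ((customers (Z b) j)%:R - (customers (Z a) j)%:R) <=
    r^-1 * ((E j b)%:R - (E j a)%:R).
  by rewrite ler_pM2l ?invr_gt0//; move: cu; rewrite -(ler_nat R) !natrD; lra.
have {}c3 : - (r^-1 * ((customers (Z b) j)%:R - (customers (Z a) j)%:R)) <=
    r^-1 * ((completed (Z b) j)%:R - (completed (Z a) j)%:R).
  by rewrite -mulrN ler_pM2l ?invr_gt0//; move: c3; rewrite -(ler_nat R) !natrD; lra.
rewrite /x -mulrBr ler_norml; apply/andP; split; have := beta0; have := nu0; have := D0; have := nuD; lra.
Qed.

Let x_jump a b : piece a b -> forall j, `|x j b - x j a| <= kap.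
Proof.
move=> ab j; apply: le_trans (x_jump_le j ab) _.
by have := D0; have := ND; rewrite kapE; lra.
Qed.

Let ell_mono a b : piece a b -> forall j, ell j a <= ell j b.
Proof.
move=> ab j; have [a0 ab' bh bd] := piece_itv ab; have [_ _ ch] := ab.
have [_ c _ _] := chain_arrived tieP j ch (admis a0 (le_trans ab' bh)).
by rewrite /ell ler_pM2l ?invr_gt0// ler_nat.
Qed.

Let ell_supp a b : piece a b -> forall j, ell j b = ell j a \/ beta - kap <= x j b.
Proof.
move=> ab j; have [a0 ab' bh bd] := piece_itv ab; have [_ _ ch] := ab.
have b0 := le_trans a0 ab'.
have [e'|] := chain_lost tieP j ch (admis a0 (le_trans ab' bh)).
  by left; rewrite /ell e'.
rewrite -addn1 !natrD => hl; right.
have Sc : r^-1 * ((\sum_i completed (Z b) i)%:R - (\sum_i completed (Z a) i)%:R) <= 3 * (N%:R * D).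
  rewrite !natr_sum -sumrB mulr_sumr.
  rewrite (_ : 3 * (N%:R * D) = \sum_(i < N) (3 * D)); last first.
    by rewrite sumr_const card_ord -[RHS]mulr_natl; ring.
  by apply: ler_sum => i _; exact: completed_piece.
have := queue_x b j; have := ep_le j; rewrite ler_norml => /andP[ep1 _].
have : r^-1 * ((beta + ep j) * r) <= r^-1 * ((queue (Z b) j)%:R +
    ((\sum_i completed (Z b) i)%:R - (\sum_i completed (Z a) i)%:R) + 1).
  by rewrite ler_pM2l ?invr_gt0//; lra.
rewrite [X in X <= _]mulrC mulfK ?gt_eqF// mulrDr mulr1 mulrDr.
by have := beta0; have := nu0; have := D0; have := nuD; have := ND; have := r_inv; rewrite kapE; lra.
Qed.

(** The class served at [a] was the longest when this service began, at [u]. Since then [S i] has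
    stood still while the service clock was running, so the modulus of [s i] makes [r * (a - u)] of
    order [nu], and few arrivals can have changed the comparison. *)
Let work a b : piece a b ->
  (forall j, T j b = T j a /\ x j a = 0) \/
  exists i, [/\ T i b = T i a + (b - a), forall j, j != i -> T j b = T j a &
    forall j, x j a <= x i a + kap].
Proof.
move=> ab; have [a0 ab' bh bd] := piece_itv ab; have ah := le_trans ab' bh.
have TE j := service_time_piece Zpath del0 j ab.
case si: (server (Z a)) => [i|]; last first.
  left => j; rewrite /T TE si addr0; split=> //.
  by have [/(_ si)q0 _] := admis a0 ah; rewrite /x /customers q0 si mulr0.
right; exists i; split.
- by rewrite /T TE si eqxx.
- move=> j ji; rewrite /T TE si (_ : (Some i == Some j) = false) ?addr0//.
  by apply/negbTE; apply: contraNneq ji => -[->].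
(* The most arrivals that a piece can bring, unscaled. *)
pose J := Num.truncn (2 * nu * r).
have nur : 0 <= 2 * nu * r by rewrite !mulr_ge0 ?ltW.
have EJ u t : piece u t -> forall j, (E j t <= E j u + J)%N.
  move=> ut j; rewrite -leq_subLR /J truncn_ge_nat//.
  by rewrite natrB ?arr_nat// -ler_pdivrMr// mulrC; exact: E_piece.
have [u [/andP[u0 ua] cu Tu Qu]] := service_start tieP Zpath del0 EJ a0 ah si.
rewrite -!/(T i _) in Tu.
have uh := le_trans ua ah.
have Su : S i (T i a) = S i (T i u) by rewrite -!completedE.
have ua0 : 0 <= a - u by rewrite subr_ge0.
have [m1 m2] := muC i.
have Cm : 1 <= C * mu i by rewrite -ler_pdivrMr// div1r.
have short y : 0 <= y -> y <= a - u -> y <= del -> r * y <= C * nu.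
  move=> y0 yau yd.
  have Tu0 := T_in_H i u0 uh.
  have Sy : S i (T i u + y) = S i (T i u).
    have Tu1 : 0 <= T i u by case/andP: Tu0.
    have l1 : (S i (T i u) <= S i (T i u + y))%N by rewrite S_mono// lerDl.
    have l2 : (S i (T i u + y) <= S i (T i a))%N.
      by rewrite S_mono ?addr_ge0// Tu lerD2l.
    by rewrite Su in l2; apply/eqP; rewrite eqn_leq l1 l2.
  have := s_osc i Tu0 (t := T i u + y); have /andP[Ta0 TaH] := T_in_H i a0 ah.
  have -> : 0 <= T i u + y < H by case/andP: Tu0 => ? ?; apply/andP; split; lra.
  rewrite (addrC (T i u)) addrK ger0_norm// addrC => /(_ isT yd)/ler_normlP[+ _].
  rewrite (_ : - _ = r * mu i * y); last by rewrite /s Sy rrE; field; rewrite gt_eqF.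
  move=> h1; apply: (@le_trans _ _ (C * (r * mu i * y))); last by rewrite ler_pM2l.
  rewrite (_ : C * _ = r * y * (C * mu i)); last by ring.
  by rewrite ler_peMr// mulr_ge0 ?(ltW r0).
(* A service older than [del] would contradict [r_large']; hence the modulus applies to its whole
   age. *)
have ud : a - u <= del.
  rewrite leNgt; apply/negP => dau; have := short del (ltW del0) (ltW dau) (lexx _).
  by have := r_large'; lra.
have rau := short _ ua0 (lexx _) ud.
move=> j; have Ej : r^-1 * ((E j a)%:R - (E j u)%:R) <= 3 * D.
  rewrite scaled_count.
  have := e_osc j (in_H u0 uh) (in_H a0 ah); rewrite ger0_norm// => /(_ ud)/ler_normlP[_].
  have : q j * (a - u) <= 2 * C * (r * (a - u)) by rewrite mulrA ler_wpM2r.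
  have : 2 * C * (r * (a - u)) <= 2 * D.
    rewrite (_ : 2 * D = 2 * C * (C * nu)); last by rewrite /D; ring.
    by rewrite ler_pM2l// mulr_gt0.
  have := beta0; have := nu0; have := D0; have := nuD; lra.
have JE : r^-1 * J%:R <= 2 * nu.
  by rewrite mulrC ler_pdivrMr// /J truncn_le.
have := x_queue a j; have : r^-1 * (queue (Z a) j)%:R <= x i a + r^-1 * ((E j a)%:R - (E j u)%:R) + r^-1 * J%:R.
  rewrite /x -!mulrDr ler_pM2l ?invr_gt0//.
  by have := Qu j; rewrite -(ler_nat R) !natrD; lra.
by have := beta0; have := nu0; have := D0; have := nuD; have := ND; rewrite kapE; lra.
Qed.

Let alpha := Sg^-1.
Let y t := weighted_mean mu (x ^~ t).
Let w t := weighted_mean mu (nz ^~ t).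
Let L t := alpha * r * (t - \sum_i T i t).
Let U t := weighted_mean mu (ell ^~ t).
Let K1 := kap + col.

Let Sg0 : 0 < Sg.
Proof.
rewrite /Sg (bigD1 (Ordinal N0))//= ltr_pwDl ?invr_gt0// sumr_ge0// => i _.
by rewrite invr_ge0 ltW.
Qed.

Let alpha0 : 0 < alpha. Proof. by rewrite invr_gt0. Qed.

Let mean_norm (g : 'I_N -> R) (c : R) : (forall i, `|g i| <= c) -> `|weighted_mean mu g| <= c.
Proof.
move=> gc; rewrite /weighted_mean mulr_suml.
under eq_bigr => i _ do rewrite mulrAC.
apply: ler_norm_convex => // [i|]; last by rewrite -mulr_suml divff ?gt_eqF.
by rewrite mulr_ge0 ?invr_ge0 ?(ltW Sg0) ?(ltW (mu0 i)).
Qed.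

Let meanB (f g : 'I_N -> R) :
  weighted_mean mu f - weighted_mean mu g = weighted_mean mu (fun i => f i - g i).
Proof.
rewrite /weighted_mean -mulrBl -sumrB; congr (_ / _).
by apply: eq_bigr => i _; rewrite mulrBr.
Qed.

Let Sg_le : Sg <= N%:R * C.
Proof.
rewrite /Sg (le_trans (ler_sum (G := fun=> C) _ _)) => [//|i _|]; first by case: (muC i).
by rewrite sumr_const card_ord mulr_natl.
Qed.

Let kap0 : 0 < kap. Proof. by rewrite kapE; have := ND; have := D0; lra. Qed.

Let col0 : 0 < col.
Proof.
have k4 : 0 < 4 * kap by apply: mulr_gt0 kap0.
have k2 : 0 < 2 * kap by apply: mulr_gt0 kap0.
exact: addr_gt0 (mulr_gt0 (mulr_gt0 k4 C0) Sg0) k2.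
Qed.

Let rdel_ge a : a <= 2 * N%:R * C ^+ 3 * k.+1%:R -> a * beta <= r * del.
Proof. by move=> h1; apply: le_trans r_large; rewrite ler_pM2r. Qed.

Let NC0 : 0 <= 2 * N%:R * C ^+ 3.
Proof. by rewrite -mulrA; apply: mulr_ge0 => //; apply: mulr_ge0 => //; rewrite exprn_ge0// ltW. Qed.

Let collapse j t : 0 <= t <= h -> `|x j t - y t| <= col.
Proof.
(* [C ^- 2] bounds every load from below, and [4 * kap * C] gives each class its margin of
   [4 * kap], as [mu i <= C]. *)
apply: (@state_space_collapse R N lam mu beta kap del h r (C ^- 2) (4 * kap * C)
  piece x nz T ell) => //.
- by rewrite invr_gt0 exprn_gt0.
- move=> i; have [_ l] := lamC i; have [_ m] := muC i; have [m' _] := muC i.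
  rewrite expr2 invfM ler_pM ?invr_ge0 ?(ltW C0)//.
    by rewrite -[leRHS]invrK lef_pV2 ?posrE ?invr_gt0.
  by rewrite lef_pV2 ?posrE.
- move=> i; have [m _] := muC i.
  have k4 : 0 <= 4 * kap by apply: mulr_ge0 (ltW kap0).
  rewrite -mulrA ler_peMr//.
  by rewrite ler_pdivlMr// mul1r.
- rewrite -/Sg (_ : r / C ^+ 2 * del = r * del / C ^+ 2); last by rewrite mulrAC.
  rewrite ler_pdivlMr ?exprn_gt0// mulrAC.
  have h1 : Sg * C ^+ 2 * (beta + kap) <= N%:R * C ^+ 3 * (2 * beta).
    apply: ler_pM; rewrite ?mulr_ge0 ?exprn_ge0 ?(ltW C0) ?(ltW Sg0) ?addr_ge0 ?(ltW beta0) ?(ltW kap0)//.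
      by rewrite [C ^+ 3]exprS mulrA ler_pM2r ?exprn_gt0.
    by have := kap_beta; have := col0; have := kap0; lra.
  apply: le_trans h1 _.
  rewrite (_ : _ * (2 * beta) = 2 * N%:R * C ^+ 3 * beta); last by ring.
  by apply: rdel_ge; rewrite ler_peMr ?ler1n// NC0.
Qed.

(** At critical load the drifts [r * (lam j * t - mu j * T j t)] average to a multiple of the idle
    time, which is [L]. *)
Let yE t : 0 <= t <= h -> y t = w t + L t - U t.
Proof.
move=> ht; rewrite /y /w /U /L /alpha /weighted_mean -/Sg.
rewrite (eq_bigr (fun i => (mu i)^-1 * nz i t + (r * (lam i / mu i * t - T i t)) - (mu i)^-1 * ell i t)).
  by rewrite sumrB big_split/= -mulr_sumr sumrB -mulr_suml hcrit; field; rewrite gt_eqF.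
by move=> i _; rewrite xE//; field; rewrite gt_eqF.
Qed.

Let y_bound t : 0 <= t <= h -> 0 <= y t <= beta + K1.
Proof.
move=> ht; have j : 'I_N := Ordinal N0.
apply/andP; split.
  rewrite /y /weighted_mean divr_ge0 ?(ltW Sg0)// sumr_ge0// => i _.
  by rewrite mulr_ge0 ?invr_ge0 ?(ltW (mu0 i))//; case/andP: (x_bound i ht).
have := collapse j ht; have /andP[_] := x_bound j ht; rewrite ler_norml /K1.
by move=> ? /andP[? ?]; lra.
Qed.

Let w_osc u t : 0 <= u <= h -> 0 <= t <= h -> `|t - u| <= del -> `|w t - w u| <= kap.
Proof. by move=> hu ht tu; rewrite /w meanB; apply: mean_norm => i; exact: nz_osc. Qed.

Let sumT_piece a b : piece a b ->
  ((forall j, x j a = 0) \/ L b = L a) /\ L a <= L b.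
Proof.
move=> ab; have [a0 ab' bh bd] := piece_itv ab.
rewrite /L ler_pM2l ?mulr_gt0//.
have [idle|[i [Ti Tj _]]] := work ab.
  split; first by left => j; case: (idle j).
  suff -> : \sum_i T i b = \sum_i T i a by rewrite lerD2r.
  by apply: eq_bigr => j _; case: (idle j).
suff -> : \sum_i T i b = \sum_i T i a + (b - a) by split; [right; congr (_ * _)|]; lra.
rewrite (bigD1 i)//= Ti [in RHS](bigD1 i)//= (eq_bigr (T ^~ a)); last by move=> j ji; exact: Tj.
by lra.
Qed.

Let U_piece a b : piece a b -> U a <= U b.
Proof.
move=> ab; rewrite /U /weighted_mean ler_pM2r ?invr_gt0// ler_sum// => i _.
by rewrite ler_pM2l ?invr_gt0//; exact: ell_mono.
Qed.

Let L_supp a b : piece a b -> L b = L a \/ y b <= K1.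
Proof.
move=> ab; have [a0 ab' bh bd] := piece_itv ab.
have [[x00|->] _] := sumT_piece ab; [right|by left].
rewrite (le_trans (ler_norm _))//; apply: mean_norm => i.
have := x_jump ab i; rewrite x00 subr0 /K1; have := col0; lra.
Qed.

Let U_supp a b : piece a b -> U b = U a \/ beta - K1 <= y b.
Proof.
move=> ab; have [a0 ab' bh bd] := piece_itv ab.
have [/forallP e'|/forallPn[j /eqP nj]] := boolP [forall j, ell j b == ell j a].
  left; rewrite /U; congr weighted_mean; apply/funext => j; exact/eqP.
right; have [//|] := ell_supp ab j.
have hb : 0 <= b <= h by rewrite (le_trans a0).
have := collapse j hb; rewrite ler_norml /K1 => /andP[? ?] ?; lra.
Qed.

Let L0 : L 0 = 0.
Proof. by rewrite /L big1 ?subrr ?mulr0// => i _; exact: T0. Qed.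

Let ell0 j : ell j 0 = 0.
Proof. by have [Z0 _ _ _ _] := Zpath; rewrite /ell Z0 ffunE mulr0. Qed.

Let U0 : U 0 = 0.
Proof. by rewrite /U /weighted_mean big1 ?mul0r// => i _; rewrite ell0 mulr0. Qed.

Let nz0 j : nz j 0 = 0.
Proof. by rewrite /nz T0 /e /s E0 S0 !mulr0 subrr !mulr0 addr0 subr0. Qed.

Let K1_osc u t : 0 <= u <= h -> 0 <= t <= h -> `|t - u| <= del -> `|w t - w u| <= K1.
Proof. by move=> hu ht tu; rewrite (le_trans (w_osc hu ht tu))// /K1 lerDl ltW. Qed.

(** Allows the random clock [T j] in the service noise to be replaced by a deterministic one.
    Idleness, noise and hence losses are bounded by multiples of [k], so the balance of class [j]
    bounds [r] times the difference of the clocks, and [r * del] is large compared with [k]. *)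
Let service_fluid j t : 0 <= t <= h -> `|T j t - lam j / mu j * t| <= del.
Proof.
move=> /[dup] ht /andP[t0 th].
have L1 : L t <= k%:R * (2 * K1).
  have := L_bound del0 piece_itv reach yE y_bound K1_osc (fun a b ab => (sumT_piece ab).2)
    U_piece L_supp U_supp kap_beta t0 th (le_trans th hk).
  by rewrite L0 subr0.
have wk : `|w t| <= k%:R * kap.
  have := modulus_bound (k := k) del0 w_osc ht (le_trans th hk).
  by rewrite /w meanB (_ : (fun i => _) = nz ^~ t)//; apply/funext => i; rewrite nz0 subr0.
have nzk : `|nz j t| <= k%:R * kap.
  have := modulus_bound (k := k) del0 (@nz_osc j) ht (le_trans th hk).
  by rewrite nz0 subr0.
have k0 : 0 <= k%:R :> R by [].
have kK : k%:R * kap <= k%:R * K1 by rewrite ler_wpM2l// /K1 lerDl ltW.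
have /andP[y0 _] := y_bound ht.
have U1 : U t <= 3 * (k%:R * K1).
  by move: wk; rewrite ler_norml => /andP[_]; have := yE ht; lra.
have ellge i : 0 <= ell i t by rewrite mulr_ge0 ?invr_ge0 ?(ltW r0).
have ellU : ell j t <= N%:R * C ^+ 2 * U t.
  have : (mu j)^-1 * ell j t <= Sg * U t.
    have -> : Sg * U t = \sum_i (mu i)^-1 * ell i t.
      by rewrite /U /weighted_mean -/Sg [LHS]mulrC divfK ?gt_eqF.
    rewrite (bigD1 j)//= lerDl.
    by rewrite sumr_ge0// => i _; rewrite mulr_ge0// invr_ge0 ltW.
  rewrite mulrC ler_pdivrMr// => /le_trans; apply.
  have U0' : 0 <= U t.
    by rewrite /U /weighted_mean divr_ge0 ?(ltW Sg0)// sumr_ge0// => i _; rewrite mulr_ge0// invr_ge0 ltW.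
  rewrite [X in X <= _]mulrAC ler_wpM2r//.
  rewrite expr2 mulrA ler_pM ?(ltW Sg0) ?(ltW (mu0 j))//.
  by case: (muC j).
have NC2 : 1 <= N%:R * C ^+ 2 by rewrite mulr_ege1// exprn_ege1.
pose B := k%:R * beta.
have B1 : k%:R * K1 <= B / 4.
  rewrite /B mulrAC -mulrA ler_wpM2l//; have := kap_beta; rewrite /K1 => ?; lra.
have B0 : 0 <= B by rewrite mulr_ge0// ltW.
have lB : ell j t <= N%:R * C ^+ 2 * (3 / 4 * B).
  by rewrite (le_trans ellU)// ler_pM2l ?(lt_le_trans _ NC2)//; lra.
have nB : `|nz j t| <= N%:R * C ^+ 2 * (B / 4).
  apply: (@le_trans _ _ (B / 4)); first lra.
  by rewrite ler_peMl// divr_ge0.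
have xb := x_bound j ht.
have key : r * (mu j * `|T j t - lam j / mu j * t|) <= 2 * beta + N%:R * C ^+ 2 * B.
  rewrite -{1}(gtr0_norm (mu0 j)) -normrM -{1}(gtr0_norm r0) -normrM.
  rewrite (_ : r * _ = (nz j t - ell j t) - x j t); last first.
    by rewrite xE//; field; rewrite gt_eqF.
  move: xb nB (ellge j) => /andP[x1 x2]; rewrite !ler_norml => /andP[n1 n2] l1.
  have kb : kap <= beta by have := kap_beta; have := col0; have := kap0; lra.
  by apply/andP; split; have := beta0; lra.
rewrite -(ler_pM2l r0); apply: (@le_trans _ _ (C * (2 * beta + N%:R * C ^+ 2 * B))).
  apply: le_trans (ler_wpM2l (ltW C0) key).
  rewrite mulrCA ler_pM2l// mulrA ler_peMl//.
  by have [_ m] := muC j; rewrite -ler_pdivrMr// div1r.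
rewrite /B (_ : C * _ = (2 * C + N%:R * C ^+ 3 * k%:R) * beta); last by ring.
apply: rdel_ge.
have C3 : C <= N%:R * C ^+ 3.
  by rewrite [C ^+ 3]exprS mulrCA ler_peMr// ltW.
rewrite -[k.+1%:R]natr1 mulrDr mulr1 -!(mulrA 2).
have : 0 <= N%:R * C ^+ 3 * k%:R by apply: mulr_ge0 => //; have := NC0; lra.
by move: C3; move: (N%:R * C ^+ 3) => c C3; lra.
Qed.

(** The noise with the random clocks replaced by their fluid limits and the rate mismatch
    [q j - r * lam j] by its limit [lamhat j]; its mesh values are those compared with [W]. *)
Definition limit_noise (t : R) :=
  weighted_mean mu (fun j => e j t - s j (lam j / mu j * t) + lamhat j * t).

Let rho_le j : lam j / mu j <= 1.
Proof.
rewrite -hcrit (bigD1 j)//= lerDl sumr_ge0// => i _.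
by rewrite divr_ge0// ltW.
Qed.

Let rho_ge j : 0 <= lam j / mu j. Proof. by rewrite divr_ge0 ?ltW. Qed.

Let rho_in_H j t : 0 <= t -> t <= h -> 0 <= lam j / mu j * t < H.
Proof.
move=> t0 th; apply: in_H; first by rewrite mulr_ge0.
by apply: le_trans th; rewrite ler_piMl.
Qed.

Context (a : nat -> R).
Hypothesis a0 : a 0%N = 0.
Hypothesis a_grid : forall l, l%:R * del <= h -> `|limit_noise (l%:R * del) - a l| <= epsg.

(** Five contributions of [nu]: the moduli of arrivals and of services, the change of clock, the
    error in the rates, and the drift over one mesh interval. *)
Let w_grid t : 0 <= t <= h -> `|w t - a (Num.truncn (t / del))| <= 5 * nu + epsg.
Proof.
move=> /[dup] ht /andP[t0 th]; set l := Num.truncn _; pose u := l%:R * del.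
have td : 0 <= t / del by rewrite divr_ge0// ltW.
have u0 : 0 <= u by rewrite mulr_ge0// ltW.
have ut : u <= t by rewrite /u -ler_pdivlMr// truncn_le.
have tu : t - u <= del.
  have /andP[_] := truncn_itv td; rewrite -/l -natr1 ltr_pdivrMr// mulrDl mul1r => ?.
  by rewrite /u; lra.
have uh := le_trans ut th.
rewrite (_ : w t - _ = (w t - limit_noise u) + (limit_noise u - a l)); last by ring.
rewrite (le_trans (ler_normD _ _))// lerD//; last exact: a_grid.
rewrite /w /limit_noise meanB; apply: mean_norm => j.
have tu0 : `|t - u| <= del by rewrite ger0_norm ?subr_ge0.
have e1 := e_osc j (in_H u0 uh) (in_H t0 th) tu0.
have s1 := s_osc j (rho_in_H j t0 th) (T_in_H j t0 th) (service_fluid j ht).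
have s2 : `|s j (lam j / mu j * t) - s j (lam j / mu j * u)| <= nu.
  apply: s_osc; [exact: rho_in_H|exact: rho_in_H|].
  by rewrite -mulrBr normrM (ger0_norm (rho_ge j)) (le_trans _ tu0)// ler_piMl.
have d1 : `|(q j - r * lam j - lamhat j) * t| <= nu.
  rewrite normrM (ger0_norm t0); apply: le_trans (lamn_le j).
  by rewrite ler_wpM2l//; lra.
have d2 : `|lamhat j * (t - u)| <= nu.
  by rewrite normrM; apply: le_trans delC; rewrite mulrC ler_pM.
rewrite /nz (_ : _ - _ = (e j t - e j u) - (s j (T j t) - s j (lam j / mu j * t))
  - (s j (lam j / mu j * t) - s j (lam j / mu j * u)) + (q j - r * lam j - lamhat j) * t
  + lamhat j * (t - u)); last by ring.
move: e1 s1 s2 d1 d2; rewrite !ler_norml.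
move=> /andP[? ?] /andP[? ?] /andP[? ?] /andP[? ?] /andP[? ?]; apply/andP; split; lra.
Qed.

(** Of the four terms [kap + col], three come from [reflection_compare] with tolerance [K1] and the
    last covers the collapse. *)
Lemma scaled_queue_discrete j t : 0 <= t <= h ->
  `|r^-1 * (customers (Z t) j)%:R - discrete_reflection beta a (Num.truncn (t / del))|
    <= 4 * (kap + col) + 2 * (5 * nu + epsg).
Proof.
move=> ht; have xy := collapse j ht.
have epsg0 : 0 <= epsg.
  by have := @a_grid 0%N; rewrite mul0r => /(_ h0); apply: le_trans.
have init : `|L 0 - U 0 - (discrete_reflection beta a 0 - a 0%N)| <= K1 + ((5 * nu + epsg) + K1).
  rewrite L0 U0 /= a0 /clip maxxx (min_idPr (ltW beta0)) !subr0 normr0.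
  by rewrite /K1; have := kap0; have := col0; have := nu0; lra.
have := reflection_compare beta0 del0 piece_itv reach yE y_bound K1_osc
  (fun a b ab => (sumT_piece ab).2) U_piece L_supp U_supp del0 (lexx del) w_grid init ht.
rewrite -/(x j t) => h1.
rewrite (_ : _ - _ = (x j t - y t) + (y t - discrete_reflection beta a (Num.truncn (t / del)))); last by ring.
rewrite (le_trans (ler_normD _ _))//; move: xy h1; rewrite /K1; have := kap0; lra.
Qed.

End scaled.

(** * The Skorohod map *)

Section stieltjes.
Context (R : realType).
Implicit Types (eta : cumulative R R) (g : R -> R).

Lemma lebesgue_stieltjes_measure_itvoc eta (u t : R) : u <= t ->
  lebesgue_stieltjes_measure eta `]u, t]%classic = (eta t - eta u)%:E.
Proof.
move=> ut; rewrite /lebesgue_stieltjes_measure /measure_extension/=.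
by rewrite measurable_mu_extE; [exact: wlength_itv_bnd|exact: is_ocitv].
Qed.

Lemma lebesgue_stieltjes_null eta (C : set R) g (B : set R) :
  (\int[lebesgue_stieltjes_measure eta]_(t in `[0%R, +oo[) (\1_C (g t))%:E = 0)%E ->
  measurable B -> (forall t, B t -> 0 <= t /\ C (g t)) ->
  lebesgue_stieltjes_measure eta B = 0%E.
Proof.
move=> h mB BC; apply/eqP; rewrite eq_le measure_ge0 andbT -h.
rewrite -[X in lebesgue_stieltjes_measure eta X]setIT -integral_indic//.
rewrite [leRHS]integral_mkcond.
apply: ge0_le_integral_nonmeasurable => t; first by rewrite lee_fin.
rewrite /patch; case: ifPn => tD; rewrite lee_fin !indicE.
  have [/set_mem/BC[_ Ct]|//] := boolP (t \in B).
  by rewrite mem_set.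
have [/set_mem/BC[t0 _]|//] := boolP (t \in B).
by move: tD; rewrite notin_setE => /(_ _); case; rewrite /= in_itv/= t0.
Qed.

(** Without an atom at [t] the function [eta] does not jump there: the intervals []t - 1 / n.+1, t]]
    decrease to the point. *)
Lemma lebesgue_stieltjes_atom eta (t e : R) :
  lebesgue_stieltjes_measure eta [set t] = 0%E -> 0 < e ->
  exists2 u, u < t & eta t - eta u < e.
Proof.
move=> h e0; pose F n := `]t - n.+1%:R^-1, t]%classic : set R.
have Fcap : \bigcap_n F n = [set t].
  apply/seteqP; split => [s sF|_ -> n _] /=; last first.
    by rewrite /F/= in_itv/= lexx andbT ltrBlDr ltrDl invr_gt0.
  have st : s <= t by have := sF 0%N I; rewrite /F/= in_itv/= => /andP[].
  apply/eqP; rewrite eq_le st leNgt; apply/negP => {}st.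
  have [n _ hn] : \forall n \near \oo, n.+1%:R^-1 < t - s.
    by apply: (near_infty_natSinv_lt (PosNum (_ : 0 < t - s))); rewrite subr_gt0.
  have := sF n I; rewrite /F/= in_itv/= => /andP[+ _].
  by have := hn n (leqnn n); rewrite /=; move: (n.+1%:R^-1) => q; lra.
have tn n : t - n.+1%:R^-1 <= t by rewrite gerBl invr_ge0.
have FE n : lebesgue_stieltjes_measure eta (F n) = (eta t - eta (t - n.+1%:R^-1))%:E.
  exact: lebesgue_stieltjes_measure_itvoc.
have : (lebesgue_stieltjes_measure eta \o F) n @[n --> \oo] --> (0%:E : \bar R).
  rewrite -[0%:E]h -Fcap; apply: nonincreasing_cvg_mu.
  - by rewrite [X in (X < _)%E](FE 0%N) ltry.
  - by move=> n; exact: measurable_itv.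
  - by rewrite Fcap; exact: measurable_set1.
  - move=> m n mn; apply/subsetPset => s; rewrite /F/= !in_itv/= => /andP[ns ->].
    rewrite andbT (le_lt_trans _ ns)// lerD2l lerN2 lef_pV2 ?posrE//.
    by rewrite ler_nat ltnS.
move=> /fine_cvgP[_ /cvgrPdist_lt /(_ _ e0)[n _ /(_ n (leqnn n))/=]].
rewrite FE/= sub0r normrN => /(le_lt_trans (ler_norm _)) hn.
by exists (t - n.+1%:R^-1) => //; rewrite ltrBlDr ltrDl invr_gt0.
Qed.

End stieltjes.

Section target.
Context (R : realType) (beta kap del h : R) (psi phi : R -> R).
Hypothesis beta0 : 0 < beta.
Hypothesis kap0 : 0 < kap.
Hypothesis del0 : 0 < del.
Hypothesis psi0 : psi 0 = 0.
Hypothesis psi_osc : forall s t, 0 <= s <= h -> 0 <= t <= h -> `|t - s| <= del ->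
  `|psi t - psi s| <= kap.

(* [g] stands for the distance of [phi] to one of the barriers; [eta] grows
   only when it vanishes. *)
Lemma regulator_support (eta : cumulative R R) (g : R -> R) :
  cadlag (g : skorohod R^o) ->
  (forall t, 0 <= t -> 0 <= g t) ->
  (forall B : set R, measurable B -> (forall t, B t -> 0 <= t /\ 0 < g t) ->
     lebesgue_stieltjes_measure eta B = 0%E) ->
  (forall u t, 0 <= u -> u <= t -> t <= h -> t <= u + del ->
     g t <= g u + kap + (eta t - eta u)) ->
  (forall t, 0 < t -> t <= h -> exists2 e, 0 < e & forall u, 0 <= u ->
     t - e < u < t -> eta t = eta u \/ g t <= 3 * kap) /\
  (forall t, 0 <= t -> exists2 e, 0 < e & forall u,
     t < u < t + e -> eta u = eta t \/ g u <= 3 * kap).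
Proof.
move=> [gr gl] g0 null incr.
have const u t : 0 <= u -> u <= t -> (forall s, u < s -> s <= t -> 0 < g s) ->
    eta t = eta u.
  move=> u0 ut gs; have := lebesgue_stieltjes_measure_itvoc eta ut.
  rewrite null; last first.
  - move=> s; rewrite /= in_itv/= => /andP[us st]; split; last exact: gs.
    by rewrite (le_trans u0)// ltW.
  - exact: measurable_itv.
  by move=> [/esym/eqP]; rewrite subr_eq0 => /eqP.
split=> [t t0 th|t t0]; last first.
  (* Just after [t], either [g] is below [2 * kap] by right continuity, or it is positive and the
     regulator rests. *)
  have [gt|gt] := leP (g t) kap.
    have [e e0 he] := cvg_at_right_dist (gr t t0) kap0.
    exists e => // u ut; right; have := he u ut.
    by rewrite ltr_norml => /andP[? ?]; lra.
  have [e e0 he] := cvg_at_right_dist (gr t t0) (lt_trans kap0 gt).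
  exists e => // u /andP[tu ue]; left; apply: const => // [|s ts su]; first exact: ltW.
  have := he s; rewrite ts (le_lt_trans su ue) => /(_ isT).
  by rewrite ltr_norml => /andP[_]; lra.
have [gt0|] := boolP (g t <= 3 * kap); first by exists 1 => // u _ _; right.
rewrite -ltNge => gt.
have [l gtl] := gl t t0.
have gtl' e : 0 < e -> exists2 r, 0 < r & forall s, t - r < s < t -> `|l - g s| < e.
  move=> e0; apply: at_left_ball.
  by move: gtl => /cvgrPdist_lt; exact.
(* A low left limit with [g t] above [3 * kap] is impossible: [eta] has no atom at [t] as [g t] is
   positive, so [incr] leaves less than [3 * kap], one [kap] each for the level before, the noise
   and the regulator. Otherwise [g] is positive just before [t]. *)
have [l0|l0] := leP l (kap / 2); last first.
  have [e e0 he] := gtl' _ (lt_trans (divr_gt0 kap0 (ltr0n R 2)) l0).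
  exists e => // u u0 /andP[eu ut]; left; apply: const => // [|s us]; first exact: ltW.
  rewrite le_eqVlt => /predU1P[->|st]; first by have := kap0; lra.
  have := he s; rewrite st (lt_trans eu us) => /(_ isT).
  by rewrite ltr_norml => /andP[_]; lra.
have [e e0 he] := gtl' (kap / 2) (divr_gt0 kap0 (ltr0n R 2)).
have atom : lebesgue_stieltjes_measure eta [set t] = 0%E.
  apply: null; first exact: measurable_set1.
  by move=> _ ->; rewrite ltW//; split => //; have := kap0; lra.
have [v vt ev] := lebesgue_stieltjes_atom atom kap0.
exfalso.
pose u := (t + Num.max (Num.max v (t - del)) (Num.max (t - e) 0)) / 2.
pose m := Num.max (Num.max v (t - del)) (Num.max (t - e) 0).
have mt : m < t by rewrite /m !gt_max vt t0 !gtrBl del0 e0.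
have um : m < u < t by rewrite /u -/m; apply/andP; split; lra.
move: um; rewrite /m !gt_max -!andbA => /and5P[vu du eu u0 ut].
have := he u; rewrite eu ut => /(_ isT); rewrite ltr_norml => /andP[gu _].
have := incr u t (ltW u0) (ltW ut) th; rewrite -lerBlDr (ltW du) => /(_ isT).
have := @cumulative_is_nondecreasing _ _ _ eta _ _ (ltW vu).
by move: gu ev gt l0; lra.
Qed.

Lemma skorohod_map_discrete (Del d1 : R) (a : nat -> R) : skorohod_map beta psi phi ->
  0 < Del -> del <= Del -> a 0%N = 0 ->
  (forall t, 0 <= t <= h -> `|psi t - a (Num.truncn (t / Del))| <= d1) ->
  forall t, 0 <= t <= h ->
    `|phi t - discrete_reflection beta a (Num.truncn (t / Del))| <= 3 * kap + 2 * (d1 + 3 * kap).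
Proof.
move=> [[phir phil] [eta1 [eta2 [etaN phiE phib I1 I2]]]] Del0 delDel a0 wa t ht.
have h0 : 0 <= h by case/andP: ht; exact: le_trans.
have m1 := @cumulative_is_nondecreasing _ _ _ eta1.
have m2 := @cumulative_is_nondecreasing _ _ _ eta2.
have null1 (B : set R) : measurable B -> (forall t, B t -> 0 <= t /\ 0 < phi t) ->
    lebesgue_stieltjes_measure eta1 B = 0%E.
  move=> mB hB; apply: lebesgue_stieltjes_null I1 mB _ => s /hB[s0 ps]; split=> //=.
  by rewrite in_itv/= ps; case/andP: (phib s s0).
have null2 (B : set R) : measurable B -> (forall t, B t -> 0 <= t /\ 0 < beta - phi t) ->
    lebesgue_stieltjes_measure eta2 B = 0%E.
  move=> mB hB; apply: lebesgue_stieltjes_null I2 mB _ => s /hB[s0]; rewrite subr_gt0 => ps.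
  by split=> //=; rewrite in_itv/= ps andbT; case/andP: (phib s s0).
have at0 (eta : cumulative R R) : (forall t, t < 0 -> eta t = 0) ->
    lebesgue_stieltjes_measure eta [set 0] = 0%E -> eta 0 = 0.
  move=> en atom; apply/eqP; rewrite eq_le; apply/andP; split; last first.
    by have := @cumulative_is_nondecreasing _ _ _ eta _ _ (lerN10 R); rewrite en// ltrN10.
  rewrite leNgt; apply/negP => e0.
  by have [u u0] := lebesgue_stieltjes_atom atom e0; rewrite (en u)// subr0 ltxx.
have eta20 : 0 <= eta2 0.
  by have [_ e] := etaN (-1) (ltrN10 R); have := m2 _ _ (lerN10 R); rewrite e.
have eta10 : 0 <= eta1 0.
  by have [e _] := etaN (-1) (ltrN10 R); have := m1 _ _ (lerN10 R); rewrite e.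
(* A positive start would require mass of [eta1] at 0, which complementarity forbids. *)
have phi0 : phi 0 = 0.
  have := phiE 0 (lexx _); rewrite psi0 add0r => p0.
  have /andP[p1 _] := phib 0 (lexx _); move: p1; rewrite le_eqVlt => /predU1P[//|p1].
  have e10 : eta1 0 = 0.
    apply: at0 => [s s0|]; first by case: (etaN s s0).
    by apply: null1 => [|_ ->]; [exact: measurable_set1|rewrite lexx].
  by move: p1; rewrite p0 e10; lra.
have e20 : eta2 0 = 0.
  apply: at0 => [s s0|]; first by case: (etaN s s0).
  by apply: null2 => [|_ ->]; [exact: measurable_set1|rewrite lexx phi0 subr0].
have e10 : eta1 0 = 0 by have := phiE 0 (lexx _); rewrite psi0 phi0 e20; lra.
have in_h u s : 0 <= u -> u <= s -> s <= h -> 0 <= u <= h /\ 0 <= s <= h.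
  by move=> u0 us sh; rewrite u0 (le_trans us sh) (le_trans u0 us) sh.
have [l1 r1] : (forall t, 0 < t -> t <= h -> exists2 e, 0 < e & forall u, 0 <= u ->
     t - e < u < t -> eta1 t = eta1 u \/ phi t <= 3 * kap) /\
  (forall t, 0 <= t -> exists2 e, 0 < e & forall u,
     t < u < t + e -> eta1 u = eta1 t \/ phi u <= 3 * kap).
  apply: regulator_support => //; first by move=> s /phib/andP[].
  move=> u s u0 us sh sd; have [hu hs] := in_h _ _ u0 us sh.
  have := psi_osc hu hs; rewrite ger0_norm ?subr_ge0// lerBlDl => /(_ sd).
  rewrite ler_norml => /andP[_ w2]; rewrite !phiE ?(le_trans u0 us)//.
  by have := m2 _ _ us; lra.
have [l2 r2] : (forall t, 0 < t -> t <= h -> exists2 e, 0 < e & forall u, 0 <= u ->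
     t - e < u < t -> eta2 t = eta2 u \/ beta - phi t <= 3 * kap) /\
  (forall t, 0 <= t -> exists2 e, 0 < e & forall u,
     t < u < t + e -> eta2 u = eta2 t \/ beta - phi u <= 3 * kap).
  apply: regulator_support => //.
  - split=> [s s0|s s0]; first by apply: cvgB; [exact: cvg_cst|exact: phir].
    have [l hl] := phil s s0; exists (beta - l).
    by apply: cvgB; [exact: cvg_cst|exact: hl].
  - by move=> s /phib/andP[]; rewrite subr_ge0.
  move=> u s u0 us sh sd; have [hu hs] := in_h _ _ u0 us sh.
  have := psi_osc hu hs; rewrite ger0_norm ?subr_ge0// lerBlDl => /(_ sd).
  rewrite ler_norml => /andP[w1 _]; rewrite !phiE ?(le_trans u0 us)//.
  by have := m1 _ _ us; lra.
(* The regulators may act at a continuum of times, but around every time short intervals on both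
   sides satisfy the alternatives of [reflection_compare], with tolerance [3 * kap]. *)
pose piece u s := [/\ [/\ 0 <= u, u <= s, s <= h & s <= u + del],
  eta1 s = eta1 u \/ phi s <= 3 * kap & eta2 s = eta2 u \/ beta - 3 * kap <= phi s].
have piece_itv u s : piece u s -> [/\ 0 <= u, u <= s, s <= h & s <= u + del] by case.
have reach u s : 0 <= u -> u <= s -> s <= h -> clos_refl_trans _ piece u s.
  apply: reach_pieces => {u s} [s s0 sh|s s0].
    have [e e0 he] := l1 s s0 sh; have [e' e'0 he'] := l2 s s0 sh.
    exists (Num.min del (Num.min e e')) => [|u u0 /andP[]]; first by rewrite !lt_min del0 e0.
    rewrite ltrBlDl -ltrBlDr !lt_min !ltrBlDr -!ltrBlDl => /and3P[c1 c2 c3] us.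
    split; first by split => //; [exact: ltW|rewrite -lerBlDr ltW].
      by apply: he; rewrite // c2.
    have [||] := he' u u0; [by rewrite c3|by left|].
    by rewrite lerBlDr addrC -lerBlDr; right.
  have [e e0 he] := r1 s s0; have [e' e'0 he'] := r2 s s0.
  exists (Num.min del (Num.min e e')) => [|u /andP[su]]; first by rewrite !lt_min del0 e0.
  rewrite -ltrBlDl !lt_min !ltrBlDl => /and3P[c1 c2 c3] uh.
  split; first by split => //; exact: ltW.
    by apply: he; rewrite su.
  have [||] := he' u; [by rewrite su|by left|].
  by rewrite lerBlDr addrC -lerBlDr; right.
apply: (@reflection_compare _ beta (3 * kap) del h piece phi psi eta1 eta2) => //.
- by move=> s /andP[s0 _]; exact: phiE.
- by move=> s /andP[s0 _]; have /andP[-> p] := phib s s0; have := kap0; lra.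
- by move=> u s hu hs us; have := psi_osc hu hs us; have := kap0; lra.
- by move=> u s /piece_itv[_ us _ _]; exact: m1.
- by move=> u s /piece_itv[_ us _ _]; exact: m2.
- by move=> u s [].
- by move=> u s [].
- rewrite e10 e20 /= a0 /clip maxxx (min_idPr (ltW beta0)) !subr0 normr0.
  have : `|psi 0 - a (Num.truncn (0 / Del))| <= d1 by apply: wa; rewrite lexx.
  by move=> /(le_trans (normr_ge0 _)); have := kap0; lra.
Qed.

End target.

(** * Continuous functionals *)

Section row_paths.
Context (R : realType) (N : nat).

Lemma row_norm_le (v : 'rV[R]_N) (e : R) : 0 <= e ->
  (forall j, `|v ord0 j| <= e) -> `|v| <= e.
Proof.
move=> e0 ve; rewrite [`|v|]mx_normrE; apply: bigmax_le => // -[i j] _ /=.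
by rewrite (ord1 i).
Qed.

Definition diagonal_path (x : R -> R) (t : R) : 'rV[R]_N := \row_i x t.

Lemma diagonal_dist x y s t : `|diagonal_path x s - diagonal_path y t| <= `|x s - y t|.
Proof. by apply: row_norm_le => // j; rewrite !mxE. Qed.

Lemma cadlag_diagonal (x : R -> R) : cadlag (x : skorohod R^o) ->
  cadlag (diagonal_path x : skorohod 'rV[R]_N).
Proof.
move=> [xr xl]; split=> t t0.
  apply/cvgrPdist_lt => e e0; have /cvgrPdist_lt/(_ e e0) := xr t t0.
  by apply: filterS => s; exact/le_lt_trans/diagonal_dist.
have [l /cvgrPdist_lt xtl] := xl t t0; exists (\row_i l).
apply/cvgrPdist_lt => e /xtl; apply: filterS => s.
by apply: le_lt_trans; apply: row_norm_le => // j; rewrite !mxE.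
Qed.

End row_paths.

Lemma cadlag_piecewise_constant (R : realType) (V : normedModType R) (x : R -> V) :
  (forall t, 0 <= t -> \forall s \near t^'+, x s = x t) ->
  (forall t, 0 < t -> exists l, \forall s \near t^'-, x s = l) ->
  cadlag (x : skorohod V).
Proof.
move=> xr xl; split=> t t0; first by apply: cvg_near_cst; exact: xr.
by have [l xtl] := xl t t0; exists l; exact: cvg_near_cst.
Qed.

Lemma cadlag_truncn (R : realType) (u : nat -> R) (Del : R) : 0 < Del ->
  cadlag ((fun t => u (Num.truncn (t / Del))) : skorohod R^o).
Proof.
move=> Del0.
have tr (l : nat) s : l%:R * Del <= s < l.+1%:R * Del -> Num.truncn (s / Del) = l.
  move=> /andP[ls sl]; apply/eqP; rewrite truncn_eq.
    by rewrite ler_pdivlMr// ls ltr_pdivrMr.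
  by rewrite divr_ge0 ?(ltW Del0)// (le_trans _ ls)// mulr_ge0// ltW.
apply: cadlag_piecewise_constant => t t0.
  have td : 0 <= t / Del by rewrite divr_ge0// ltW.
  have /andP[h1 h2] := truncn_itv td; move: h1 h2.
  rewrite ler_pdivlMr// ltr_pdivrMr//; set l := Num.truncn _ => h1 h2.
  apply: (@ball_at_right _ _ (l.+1%:R * Del - t)); first by rewrite subr_gt0.
  move=> s /andP[ts]; rewrite addrC subrK => sl.
  by rewrite (tr l)// sl (le_trans h1)// ltW.
pose l := (Num.truncn (t / Del)).
have td : 0 <= t / Del by rewrite divr_ge0// ltW.
have /andP[h1 h2] := truncn_itv td; move: h1 h2.
rewrite ler_pdivlMr// ltr_pdivrMr// -/l => h1 h2.
move: h1; rewrite le_eqVlt => /predU1P[lt|h1]; last first.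
  exists (u l); apply: (@ball_at_left _ _ (t - l%:R * Del)); first by rewrite subr_gt0.
  move=> s /andP[]; rewrite opprB addrC subrK => ls st.
  by rewrite (tr l)// ltW//= (lt_trans st).
case: l lt {h2} => [|l] lt; first by move: t0; rewrite -lt mul0r ltxx.
exists (u l); apply: (@ball_at_left _ _ Del) => // s /andP[].
rewrite -lt -natr1 mulrDl mul1r addrK => ls st.
by rewrite (tr l)// (ltW ls) -natr1 mulrDl mul1r.
Qed.

Section oscillation.
Context (R : realType) (V : normedModType R) (f : skorohod V -> R) (M : R).
Hypothesis fM : forall x, cadlag x -> 0 <= f x <= M.
Implicit Types (x y : skorohod V) (h e : R).

(** Uniform neighbourhoods on [[0, h]], without time change, are what the comparison with step paths
    produces. *)
Definition osc x h e : R := sup [set u | exists y, [/\ cadlag y,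
  forall t, 0 <= t <= h -> `|(y : R -> V) t - (x : R -> V) t| <= e & u = `|f y - f x|]].

Lemma f_dist x y : cadlag x -> cadlag y -> `|f y - f x| <= M.
Proof.
move=> /fM/andP[? ?] /fM/andP[? ?]; rewrite ler_norml.
by apply/andP; split; lra.
Qed.

Lemma osc_ge x y h e : cadlag x -> cadlag y ->
  (forall t, 0 <= t <= h -> `|(y : R -> V) t - (x : R -> V) t| <= e) ->
  `|f y - f x| <= osc x h e.
Proof.
move=> cx cy yx; apply: sup_upper_bound; last by exists y.
split; first by exists `|f y - f x|, y.
by exists M => _ [z [cz _ ->]]; exact: f_dist.
Qed.

Lemma osc_le x h e (u : R) : cadlag x -> 0 <= e ->
  (forall y, cadlag y ->
     (forall t, 0 <= t <= h -> `|(y : R -> V) t - (x : R -> V) t| <= e) ->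
     `|f y - f x| <= u) -> osc x h e <= u.
Proof.
move=> cx e0 hu; apply: ge_sup; last by move=> _ [y [cy yx ->]]; exact: hu.
by exists 0, x; split => // [t _|]; rewrite subrr normr0.
Qed.

Lemma osc_bound x h e : cadlag x -> 0 <= e -> 0 <= osc x h e <= M.
Proof.
move=> cx e0; apply/andP; split; last by apply: osc_le => // y cy _; exact: f_dist.
rewrite -(normr0 R) -(subrr (f x)); apply: osc_ge => // t _.
by rewrite subrr normr0.
Qed.

(** The centre [x] varies around the point of continuity [y]: later [y] is the limit path and [x] a
    step path that changes with the mesh. *)
Lemma osc_small y (eta : R) : {within @cadlag R V, continuous f} -> cadlag y ->
  0 < eta -> exists h e, 0 < e /\ forall x h' e', cadlag x -> h <= h' -> 0 <= e' <= e ->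
    (forall t, 0 <= t <= h' -> `|(y : R -> V) t - (x : R -> V) t| <= e') ->
    osc x h' e' <= eta.
Proof.
move=> cf cy eta0.
have /subspace_continuousP/(_ y cy)/cvgrPdist_lt/(_ (eta / 2)) := cf.
rewrite divr_gt0// => /(_ isT).
rewrite near_withinE => -[[h e] /= e0 sub].
(* [z] is within [2 * e'] of [y], and this must stay below [e]. *)
exists h, (e / 3); split; first by rewrite divr_gt0.
have close z e' h' : h <= h' -> e' < e -> cadlag z ->
    (forall t, 0 <= t <= h' -> `|(z : R -> V) t - (y : R -> V) t| <= e') ->
    `|f y - f z| < eta / 2.
  move=> hh ee cz zy; apply: sub => //; exists id; split => [|t _|t /andP[t0 th]].
  - exact: time_change_id.
  - by rewrite subrr normr0.
  - by rewrite (le_lt_trans (zy t _))// t0 (le_trans th).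
move=> x h' e' cx hh /andP[e'0 e'e] yx; apply: osc_le => // z cz zx.
have fx : `|f y - f x| < eta / 2.
  apply: (close x e' h') => // [|t ht]; first lra.
  by rewrite distrC; exact: yx.
have fz : `|f y - f z| < eta / 2.
  apply: (close z (e' + e') h') => // [|t ht]; first lra.
  by rewrite -(subrKA (x t)) (le_trans (ler_normD _ _))// lerD ?zx// distrC yx.
move: fx fz; rewrite !ltr_norml ler_norml => /andP[? ?] /andP[? ?].
by apply/andP; split; lra.
Qed.

End oscillation.

Section approximation_in_distribution.
Context (R : realType) (d : nat -> measure_display)
  (T : forall n, measurableType (d n)) (P : forall n, probability (T n) R)
  (d' : measure_display) (T' : measurableType d') (Q : probability T' R)
  (f : forall n, T n -> R) (g : T' -> R) (M : R).
Hypothesis fM : forall n w, 0 <= @f n w <= M.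
Hypothesis gM : forall w, 0 <= g w <= M.

Lemma Ex_cvg_approx : (forall eta : R, 0 < eta ->
  exists (u e : forall n, T n -> R) (v e' : T' -> R),
   [/\ (forall n, bounded_measurable (@u n) /\ (forall w, 0 <= @u n w)),
     (forall n, bounded_measurable (@e n) /\ (forall w, 0 <= @e n w)),
     [/\ bounded_measurable v, forall w, 0 <= v w, bounded_measurable e' &
        forall w, 0 <= e' w],
     (\forall n \near \oo, (forall w, `|@f n w - @u n w| <= @e n w) /\ Ex (P n) (@e n) <= eta) &
     [/\ Ex (P n) (@u n) @[n --> \oo] --> Ex Q v,
       forall w, `|g w - v w| <= e' w & Ex Q e' <= eta]]) ->
  Ex (P n) (@f n) @[n --> \oo] --> Ex Q g.
Proof.
move=> H; apply/cvgrPdist_le => eta eta0.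
have eta3 : 0 < eta / 3 by rewrite divr_gt0.
have [u [e [v [e' [hu he [bv v0 be' e'0] near [uv gv ee']]]]]] := H _ eta3.
move: uv => /cvgrPdist_le/(_ _ eta3) uv; near=> n.
have [fu en] : (forall w, `|@f n w - @u n w| <= @e n w) /\ Ex (P n) (@e n) <= eta / 3.
  by near: n.
have [[bu u0] [be e0]] := (hu n, he n).
have h1 := Ex_sandwich (P n) bu be (@fM n) u0 e0 fu.
have h2 := Ex_sandwich Q bv be' gM v0 e'0 gv.
have h3 : `|Ex Q v - Ex (P n) (@u n)| <= eta / 3 by near: n.
rewrite (_ : _ - _ = (Ex Q g - Ex Q v) + (Ex Q v - Ex (P n) (@u n))
  + (Ex (P n) (@u n) - Ex (P n) (@f n))); last by ring.
rewrite (le_trans (ler_normD _ _))// (le_trans (lerD (ler_normD _ _) (lexx _)))//.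
by rewrite [X in _ + X]distrC; lra.
Unshelve. all: by end_near. Qed.

End approximation_in_distribution.

(** * Convergence *)

Lemma common_scale (R : realType) (q : nat) (d : 'I_q -> R) (d0 : R) :
  0 < d0 -> (forall p, 0 < d p) -> exists2 del, 0 < del & del <= d0 /\ forall p, del <= d p.
Proof.
move=> d00 hd; exists (\big[Num.min/d0]_p d p); first exact: lt_bigmin.
by split=> [|p]; [exact: bigmin_le_id|exact: bigmin_le_cond].
Qed.

Lemma exists_weights (R : realType) (q : nat) (u : 'I_q -> R) : (0 < q)%N ->
  (forall p, 0 <= u p) -> exists wt : 'I_q -> R,
  [/\ forall p, 0 <= wt p, \sum_p wt p = 1 & forall p, u p = (\sum_p' u p') * wt p].
Proof.
move=> q0 u0; have S0 : 0 <= \sum_p u p by exact: sumr_ge0.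
(* If all contributions vanish, any weights satisfy the last clause; uniform ones sum to 1. *)
have [S1|S1] := eqVneq (\sum_p u p) 0.
  exists (fun=> q%:R^-1); split => [p||p]; first by rewrite invr_ge0.
    by rewrite sumr_const card_ord -[LHS]mulr_natl divff// pnatr_eq0 -lt0n.
  by rewrite S1 mul0r; move: S1 => /eqP; rewrite psumr_eq0// => /allP/(_ p); rewrite mem_index_enum => /(_ isT)/eqP.
exists (fun p => u p / \sum_p u p); split => [p||p].
- by rewrite divr_ge0.
- by rewrite -mulr_suml divff.
- by rewrite mulrC divfK.
Qed.

Lemma near_le_sqrt (R : realType) (K : R) :
  \forall n \near \oo, K <= Num.sqrt (n%:R : R).
Proof.
near=> n; rewrite (le_trans (ler_norm K))// -sqrtr_sqr ler_wsqrtr//.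
by near: n; exact: nbhs_infty_ger.
Unshelve. all: by end_near. Qed.

Section brownian_facts.
Context (R : realType) (d : measure_display) (T : measurableType d)
  (P : probability T R) (m A : R) (W : T -> R -> R).
Hypothesis hW : brownian_motion P m A W.

Lemma bm_right_continuous w : right_continuous_path (W w).
Proof. by have [[cW _] _ _ _] := hW; case: (cW w). Qed.

Lemma bm_measurable t : 0 <= t -> measurable_fun setT (W ^~ t).
Proof. by have [[_ mW] _ _ _] := hW; exact: mW. Qed.

Lemma bm_continuous : {ae P, forall w, {within `[0, +oo[, continuous (W w)}}.
Proof. by have [_ + _ _] := hW; apply: filterS => w []. Qed.

End brownian_facts.

Lemma counting_right_continuous (R : realType) (d : measure_display)
    (T : measurableType d) (X : T -> R -> nat) (c l : R) w : counting_process X ->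
  right_continuous_path (fun t => c * ((X w t)%:R - l * t)).
Proof.
move=> [/(_ w)[_ _ Xr] _] t t0; apply: cvgM; first exact: cvg_cst.
apply: cvgB; last first.
  apply: cvgM; first exact: cvg_cst.
  by apply: cvg_at_right_filter; exact: cvg_id.
by apply: cvg_near_cst; move: (Xr t t0); apply: filterS => s ->.
Qed.

Lemma natr_comp_measurable (R : realType) (d : measure_display)
    (T : measurableType d) (X : T -> nat) (c l : R) :
  measurable_fun setT X -> measurable_fun setT (fun w => c * ((X w)%:R - l)).
Proof.
move=> mX; apply: measurable_funM; first exact: measurable_cst.
apply: measurable_funB; last exact: measurable_cst.
have mN : measurable_fun setT (fun k : nat => k%:R : R) by [].
exact: (measurableT_comp mN mX).
Qed.

(** [b] counts bad events: if there is none the errors [e a] apply, otherwise the trivial bound [M]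
    does. *)
Lemma mhat_approx (R : realType) (J : finType) mm (c e : {ffun J -> 'I_(grid_size mm)} -> R)
    (x : J -> R) (y b M : R) :
  0 <= y <= M -> (forall a, 0 <= c a <= M) -> (forall a, 0 <= e a) -> b = 0 \/ 1 <= b ->
  (b = 0 -> forall a, mhat a x != 0 -> `|y - c a| <= e a) ->
  `|y - \sum_a c a * mhat a x| <=
    \sum_a e a * mhat a x + M * b + M * (1 - \prod_j pou mm (x j)).
Proof.
move=> /andP[y0 yM] c0 e0 hb hy; have M0 : 0 <= M by exact: le_trans yM.
have t0 (a : {ffun J -> 'I_(grid_size mm)}) : 0 <= mhat a x by case/andP: (mhat01 a x).
have /andP[p0 p1] := prod_pou01 mm x.
have ts : \sum_(a : {ffun J -> 'I_(grid_size mm)}) mhat a x <= 1 by rewrite mhat_sum.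
have es : 0 <= \sum_a e a * mhat a x by rewrite sumr_ge0// => a _; rewrite mulr_ge0.
have Mp : 0 <= M * (1 - \prod_j pou mm (x j)) by rewrite mulr_ge0// subr_ge0.
case: hb => [b0|b1].
  rewrite b0 mulr0 addr0 -mhat_sum; apply: weighted_approx => //; last exact: hy.
  by rewrite ger0_norm.
have cs : 0 <= \sum_a c a * mhat a x <= M.
  rewrite sumr_ge0/= => [|a _]; last by rewrite mulr_ge0//; case/andP: (c0 a).
  apply: (@le_trans _ _ (\sum_(a : {ffun J -> 'I_(grid_size mm)}) M * mhat a x)); last by rewrite -mulr_sumr ler_piMr.
  by apply: ler_sum => a _; rewrite ler_wpM2r//; case/andP: (c0 a).
have Mb : M <= M * b by rewrite ler_peMr.
by case/andP: cs => c1 c2; rewrite ler_norml; apply/andP; split; lra.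
Qed.

Section heavy_traffic.
Context (R : realType) (N : nat) (lam mu lamhat sigma gamma : 'I_N -> R)
  (lamn : nat -> 'I_N -> R) (beta : R) (eps : nat -> 'I_N -> R).
Hypothesis N0 : (0 < N)%N.
Hypothesis lam_gt0 : forall i, 0 < lam i.
Hypothesis mu_gt0 : forall i, 0 < mu i.
Hypothesis hlamn : forall i,
  (fun n : nat => (lamn n i - (lam i * n%:R + Num.sqrt n%:R * lamhat i) : R^o)) =o_\oo
  (fun n : nat => (Num.sqrt n%:R : R^o)).
Hypothesis hcrit : \sum_(i < N) lam i / mu i = 1.
Hypothesis hbeta : 0 < beta.
Hypothesis heps : forall i, eps n i @[n --> \oo] --> (0 : R).
Context (d : nat -> measure_display) (T : forall n, measurableType (d n))
  (P : forall n, probability (T n) R)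
  (E S : forall n, 'I_N -> T n -> R -> nat)
  (tie : forall n, T n -> nat -> {set 'I_N} -> 'I_N)
  (Z : forall n, T n -> R -> state N).
Hypothesis hsys : forall n, slq_system (P n)
  (fun i => beta * Num.sqrt n%:R + eps n i * Num.sqrt n%:R)
  (@E n) (@S n) (@tie n) (@Z n).
Context (d0 : measure_display) (T0 : measurableType d0) (P0 : probability T0 R)
  (Warr Wser : 'I_N -> T0 -> R -> R).
Hypothesis hWarr : forall i, brownian_motion P0 0 (lam i * sigma i ^+ 2) (Warr i).
Hypothesis hWser : forall i, brownian_motion P0 0 (mu i * gamma i ^+ 2) (Wser i).
Hypothesis hE2 : forall i, @cvg_in_distribution R R^o d T P
  (fun n w t => (Num.sqrt n%:R)^-1 * ((@E n i w t)%:R - lamn n i * t))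
  d0 T0 P0 (Warr i).
Hypothesis hS2 : forall i, @cvg_in_distribution R R^o d T P
  (fun n w t => (Num.sqrt n%:R)^-1 * ((@S n i w t)%:R - n%:R * mu i * t))
  d0 T0 P0 (Wser i).
Context (d1 : measure_display) (T1 : measurableType d1) (P1 : probability T1 R)
  (W X : T1 -> R -> R) (m A : R).
Let alpha := (\sum_(i < N) (mu i)^-1)^-1.
Hypothesis mE : m = alpha * \sum_(i < N) lamhat i / mu i.
Hypothesis AE : A = alpha ^+ 2 *
    \sum_(i < N) lam i / mu i ^+ 2 * (sigma i ^+ 2 + gamma i ^+ 2).
Hypothesis hW : brownian_motion P1 m A W.
Hypothesis hX : forall w, skorohod_map beta (W w) (X w).

Let counting n i : counting_process (@E n i) /\ counting_process (@S n i).
Proof. by have [] := hsys n. Qed.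

(* The indices below N stand for the arrival processes, the others for the
   service processes. *)
Definition primitive n (p : 'I_(N + N)) : T n -> R -> nat :=
  match fintype.split p with inl i => @E n i | inr i => @S n i end.
Definition noise n (p : 'I_(N + N)) (w : T n) (t : R) : R :=
  match fintype.split p with
  | inl i => (Num.sqrt n%:R)^-1 * ((@E n i w t)%:R - lamn n i * t)
  | inr i => (Num.sqrt n%:R)^-1 * ((@S n i w t)%:R - n%:R * mu i * t)
  end.
Let noise_lim (p : 'I_(N + N)) : T0 -> R -> R :=
  match fintype.split p with inl i => Warr i | inr i => Wser i end.
Let var (p : 'I_(N + N)) : R :=
  match fintype.split p with inl i => lam i * sigma i ^+ 2 | inr i => mu i * gamma i ^+ 2 end.
Let coef (p : 'I_(N + N)) : R :=
  match fintype.split p with inl i => alpha / mu i | inr i => - (alpha / mu i) end.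
Let theta (p : 'I_(N + N)) : R :=
  match fintype.split p with inl i => 1 | inr i => lam i / mu i end.
Let gen n (p : 'I_(N + N)) : set (set (T n)) := [set F | exists (t : R) (B : set nat),
  [/\ `[0, +oo[%classic t, measurable B & F = (primitive p ^~ t) @^-1` B]].

Let split_l i : fintype.split (lshift N i : 'I_(N + N)) = inl i.
Proof. exact: (unsplitK (inl i)). Qed.
Let split_r i : fintype.split (rshift N i : 'I_(N + N)) = inr i.
Proof. exact: (unsplitK (inr i)). Qed.

Let Sg0 : 0 < \sum_(i < N) (mu i)^-1.
Proof.
rewrite (bigD1 (Ordinal N0))//= ltr_pwDl ?invr_gt0// sumr_ge0// => i _.
by rewrite invr_ge0 ltW.
Qed.

Let alpha0 : 0 < alpha. Proof. by rewrite invr_gt0. Qed.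

Let indep n (F : 'I_(N + N) -> set (T n)) : (forall p, <<s @gen n p >> (F p)) ->
  fine (P n (\bigcap_(p : 'I_(N + N)) F p)) = \prod_(p < N + N) fine (P n (F p)).
Proof.
move=> hF; have [_ _ ind _ _] := hsys n.
pose s : seq ('I_N + 'I_N + nat) := [seq inl (fintype.split p) | p <- enum 'I_(N + N)].
pose Ak (k : 'I_N + 'I_N + nat) : set (T n) := if k is inl q then F (unsplit q) else setT.
have := ind s Ak; rewrite map_inj_uniq ?enum_uniq; last first.
  by move=> p p' [/(can_inj splitK)].
move=> /(_ isT) h; have {h} : P n (\bigcap_(i in [set` s]) Ak i) = (\prod_(i <- s) P n (Ak i))%E.
  apply: h => _ /mapP[p _ ->]; rewrite /Ak splitK; have := hF p.
  by rewrite /gen /primitive /generated_sigma_algebra /primitive_sigma_algebra; case: (fintype.split p).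
rewrite (_ : \bigcap_(i in [set` s]) Ak i = \bigcap_(p : 'I_(N + N)) F p); last first.
  apply/seteqP; split => w hw.
    move=> p _; have := hw (inl (fintype.split p)); rewrite /Ak splitK; apply.
    by apply/mapP; exists p; rewrite // mem_enum.
  by move=> _ /mapP[p _ ->]; rewrite /Ak splitK; exact: hw.
rewrite big_map big_enum/= => ->.
under eq_bigr => p _.
  rewrite /Ak splitK -[P n (F p)]fineK; last first.
    rewrite fin_num_measure//.
    have : <<s @gen n p >> (F p) by [].
    apply: (@smallest_sub _ (@sigma_algebra _ setT)); first exact: sigma_algebra_measurable.
    move=> _ [t [B [t0 mB ->]]]; move: t0; rewrite /= in_itv/= andbT => t0.
    rewrite -[X in measurable X]setTI /primitive.
    by case: (fintype.split p) => i; have [[_ m1] [_ m2]] := counting n i; [exact: m1|exact: m2].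
  over.
by rewrite prodEFin.
Qed.

Let mgen n p t : 0 <= t ->
  measurable_fun [set: g_sigma_algebraType (@gen n p)] (fun w => noise p w t).
Proof.
move=> t0; have : measurable_fun [set: g_sigma_algebraType (@gen n p)] (@primitive n p ^~ t).
  by apply: generated_measurable; rewrite /= in_itv/= t0.
by rewrite /primitive /noise; case: (fintype.split p) => i; exact: natr_comp_measurable.
Qed.

Let mnoise n p t : 0 <= t -> measurable_fun setT (fun w => @noise n p w t).
Proof.
rewrite /noise => t0; case: (fintype.split p) => i; apply: natr_comp_measurable.
  by have [[_ m1] _] := counting n i; exact: m1.
by have [_ [_ m2]] := counting n i; exact: m2.
Qed.

Let rnoise n p w : right_continuous_path (@noise n p w).
Proof.
rewrite /noise; case: (fintype.split p) => i; have [c1 c2] := counting n i.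
  exact: counting_right_continuous.
exact: counting_right_continuous.
Qed.

Let cvg_noise p :
  @cvg_in_distribution R R^o d T P (fun n => @noise n p) d0 T0 P0 (noise_lim p).
Proof. by rewrite /noise /noise_lim; case: (fintype.split p) => i; [exact: hE2|exact: hS2]. Qed.

Let bm_noise p : brownian_motion P0 0 (var p) (noise_lim p).
Proof. by rewrite /var /noise_lim; case: (fintype.split p) => i. Qed.

Let var0 p : 0 <= var p.
Proof. by rewrite /var; case: (fintype.split p) => i; rewrite mulr_ge0 ?sqr_ge0// ltW. Qed.

Let coef0 p : coef p != 0.
Proof.
have h i : alpha / mu i != 0 by rewrite gt_eqF// divr_gt0.
by rewrite /coef; case: (fintype.split p) => i; rewrite ?oppr_eq0.
Qed.

Let theta0 p : 0 <= theta p.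
Proof. by rewrite /theta; case: (fintype.split p) => i //; rewrite divr_ge0// ltW. Qed.

(** The service clock of class [i] runs at speed [lam i / mu i], which turns the variance
    [mu i * gamma i ^+ 2] into [lam i * gamma i ^+ 2]. *)
Let variance_sum : \sum_p coef p ^+ 2 * (var p * theta p) = A.
Proof.
rewrite AE big_split_ord/= /coef /var /theta -big_split/= mulr_sumr.
apply: eq_bigr => i _; rewrite split_l split_r.
by field; rewrite gt_eqF.
Qed.

Let A0 : 0 <= A.
Proof.
rewrite -variance_sum sumr_ge0// => p _.
by apply: mulr_ge0; [exact: sqr_ge0|exact: mulr_ge0].
Qed.

Definition mesh_values n k Del (w : T n) (l : 'I_k) : R :=
  \sum_(p < N + N) coef p * (noise p w (theta p * (l.+1%:R * Del)) - noise p w 0)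
  + m * (l.+1%:R * Del).

Definition target_values k Del (w : T1) (l : 'I_k) : R := W w (l.+1%:R * Del) - W w 0.

Lemma mesh_values_cvg k mm Del (a : {ffun 'I_k -> 'I_(grid_size mm)}) : 0 < Del ->
  Ex (P n) (fun w => mhat a (mesh_values Del w)) @[n --> \oo] -->
  Ex P1 (fun w => mhat a (target_values Del w)).
Proof.
move=> Del0.
have [wt [wt0 wt1 wtE]] : exists wt : 'I_(N + N) -> R,
  [/\ forall p, 0 <= wt p, \sum_p wt p = 1 &
    forall p, coef p ^+ 2 * (var p * theta p) = A * wt p].
  rewrite -variance_sum; apply: exists_weights; first by rewrite addn_gt0 N0.
  by move=> p; apply: mulr_ge0; [exact: sqr_ge0|exact: mulr_ge0].
exact: (values_cvg indep mgen mnoise cvg_noise bm_noise hW var0 coef0 theta0 Del0 A0 wt0 wt1 wtE).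
Qed.

Lemma mesh_values_measurable n k Del (l : 'I_k) : 0 < Del ->
  measurable_fun setT (@mesh_values n k Del ^~ l).
Proof.
move=> Del0; apply: measurable_funD; last exact: measurable_cst.
apply: measurable_sum => p; apply: measurable_funM; first exact: measurable_cst.
by apply: measurable_funB; apply: mnoise; rewrite // !mulr_ge0// ltW.
Qed.

Lemma target_values_measurable k Del (l : 'I_k) : 0 < Del ->
  measurable_fun setT (@target_values k Del ^~ l).
Proof.
move=> Del0; apply: measurable_funB; apply: (bm_measurable hW) => //.
by rewrite mulr_ge0// ltW.
Qed.

Lemma mesh_valuesE n k Del (w : T n) (l : 'I_k) :
  mesh_values Del w l = limit_noise lam mu lamhat (lamn n) (Num.sqrt n%:R) n%:R
    (fun i => @E n i w) (fun i => @S n i w) (l.+1%:R * Del).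
Proof.
have E0 i : @E n i w 0 = 0%N by have [[/(_ w)[]]] := counting n i.
have S0 i : @S n i w 0 = 0%N by have [_ [/(_ w)[]]] := counting n i.
rewrite /mesh_values /limit_noise /weighted_mean -/alpha mE big_split_ord/=.
rewrite -big_split/= mulr_sumr mulr_suml -big_split/= mulr_suml.
apply: eq_bigr => i _; rewrite /coef /noise /theta split_l split_r E0 S0 !mulr0 !subrr !mulr0 !subr0.
by rewrite mul1r /alpha; ring.
Qed.

(** Index 0 carries the initial value 0, so [a] describes the mesh times from the first on; the
    default past [k] is never read on [[0, h]] when [h <= k%:R * Del]. *)
Definition grid_path k mm (a : {ffun 'I_k -> 'I_(grid_size mm)}) (l : nat) : R :=
  if l is l'.+1 then oapp (fun i : 'I_k => grid R (a i)) 0 (insub l') else 0.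

Definition step_path k mm Del (a : {ffun 'I_k -> 'I_(grid_size mm)}) (t : R) : R :=
  discrete_reflection beta (grid_path a) (Num.truncn (t / Del)).

Lemma grid_path_close k mm (a : {ffun 'I_k -> 'I_(grid_size mm)}) (x : R -> R) Del h e l :
  0 < Del -> 0 <= e -> x 0 = 0 ->
  (forall i : 'I_k, `|x (i.+1%:R * Del) - grid R (a i)| <= e) ->
  h <= k%:R * Del -> l%:R * Del <= h -> `|x (l%:R * Del) - grid_path a l| <= e.
Proof.
move=> Del0 e0 x0 xa hk; case: l => [|l] lh; first by rewrite mul0r x0 subrr normr0.
have lk : (l < k)%N by have := le_trans lh hk; rewrite ler_pM2r// ler_nat.
by rewrite /grid_path (insubT (fun i => (i < k)%N) lk)/=; exact: (xa (Ordinal lk)).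
Qed.

Lemma smooth_osc (x : R -> R) (del nu H s t : R) : right_continuous_path x ->
  0 < del -> ~ rough del nu H x -> 0 <= s < H -> 0 <= t < H -> `|t - s| <= del / 2 ->
  `|x t - x s| <= nu.
Proof.
move=> rx del0 nx hs ht ts; apply: smooth_modulus rx nx ht hs _.
by rewrite (le_lt_trans ts)// gtr_pMr// invf_lt1// ltr1n.
Qed.

(** 11 is [3 + 2 * (1 + 3)]: the tolerance [3 * nu] of the regulators, and [nu] for the distance to
    the last mesh point. The mesh is [del / 2] because [rough] asks for distances strictly below
    [del]. *)
Lemma target_close k mm (a : {ffun 'I_k -> 'I_(grid_size mm)}) nu del h w t :
  0 < nu -> 0 < del -> h <= k%:R * (del / 2) -> W w 0 = 0 ->
  ~ rough del nu (h + 2) (W w) -> mhat a (target_values (del / 2) w) != 0 ->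
  0 <= t <= h ->
  `|X w t - step_path (del / 2) a t| <= 11 * nu + 2 * mm.+1%:R^-1.
Proof.
move=> nu0 del0 hk W0 nr /mhat_supp av ht.
have del20 : 0 < del / 2 by rewrite divr_gt0.
have in_H u : 0 <= u <= h -> 0 <= u < h + 2.
  by move=> /andP[-> uh]; rewrite (le_lt_trans uh)// ltrDl.
have osc s u : 0 <= s <= h -> 0 <= u <= h -> `|u - s| <= del / 2 -> `|W w u - W w s| <= nu.
  move=> hs hu; apply: smooth_osc (in_H _ hs) (in_H _ hu) => //.
  exact: (bm_right_continuous hW).
have := skorohod_map_discrete hbeta nu0 del20 W0 osc (hX w) del20 (lexx _) (a := grid_path a)
  (erefl _) (d1 := nu + mm.+1%:R^-1) _ ht.
move=> /(_ _)/le_trans; apply; last by move: (mm.+1%:R^-1) => e; lra.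
move=> u /andP[u0 uh]; set l := Num.truncn _.
have ud : 0 <= u / (del / 2) by rewrite divr_ge0// ltW.
have lu : l%:R * (del / 2) <= u by rewrite -ler_pdivlMr// truncn_le.
have /andP[_] := truncn_itv ud; rewrite -/l -[l.+1%:R]natr1 ltr_pdivrMr// mulrDl mul1r => ul.
rewrite (_ : W w u - _ = (W w u - W w (l%:R * (del / 2))) + (W w (l%:R * (del / 2)) - grid_path a l)); last by ring.
have l0 : 0 <= l%:R * (del / 2) by rewrite mulr_ge0// ltW.
rewrite (le_trans (ler_normD _ _))// lerD//.
  by apply: osc; rewrite ?l0 ?u0 ?uh ?(le_trans lu)// ger0_norm ?subr_ge0// lerBlDl ltW.
apply: (grid_path_close (h := h)) => //; last exact: le_trans lu uh.
by move=> i; have := av i; rewrite /target_values W0 subr0.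
Qed.

Let C := 1 + \sum_i (lam i + (lam i)^-1 + mu i + (mu i)^-1 + `|lamhat i|).

Let C_ge i : lam i + (lam i)^-1 + mu i + (mu i)^-1 + `|lamhat i| <= C - 1.
Proof.
rewrite /C [1 + _]addrC addrK (bigD1 i)//= lerDl sumr_ge0// => j _.
by rewrite !addr_ge0// ?invr_ge0 ltW.
Qed.

Let C1 : 1 <= C.
Proof.
rewrite /C lerDl sumr_ge0// => j _.
by rewrite !addr_ge0// ?invr_ge0 ltW.
Qed.

Let C_bounds i : [/\ lam i <= C, (lam i)^-1 <= C, mu i <= C, (mu i)^-1 <= C & `|lamhat i| <= C].
Proof.
have := C_ge i; have := lam_gt0 i; have := mu_gt0 i.
have : 0 < (lam i)^-1 by rewrite invr_gt0.
have : 0 < (mu i)^-1 by rewrite invr_gt0.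
have := normr_ge0 (lamhat i).
move: (lam i) (mu i) (_^-1) (_^-1) `|_| C => *; split; lra.
Qed.

(** Obtained by writing the bound [4 * (kap + col) + 10 * nu] of [scaled_queue_discrete] as a
    multiple of [nu]. *)
Definition noise_gain : R :=
  4 * (6 * N%:R * C ^+ 2) * (3 + 4 * C * \sum_(i < N) (mu i)^-1) + 10.

Let gain_ge : 11 <= noise_gain.
Proof.
have h1 : 1 <= N%:R * C ^+ 2.
  by rewrite mulr_ege1 ?exprn_ege1// ler1n.
have h2 : 0 <= C * \sum_(i < N) (mu i)^-1 by rewrite mulr_ge0 ?(ltW Sg0)// (le_trans _ C1).
have h3 : 3 <= 3 + 4 * C * \sum_(i < N) (mu i)^-1.
  by rewrite lerDl -mulrA mulr_ge0.
have : 24 * 3 <= 4 * (6 * N%:R * C ^+ 2) * (3 + 4 * C * \sum_(i < N) (mu i)^-1).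
  by apply: ler_pM => //; rewrite -(mulrA 6); lra.
by rewrite /noise_gain; lra.
Qed.

(** The conditions on the size of [n] involve the parameters, [nu], [del], [h] and [k] alone, so one
    rank serves all outcomes [w] and all grid points [a]. *)
Lemma prelimit_close (nu del h : R) (k mm : nat) : 0 < nu -> nu <= 1 -> 0 < del ->
  del / 2 * C <= nu -> 0 <= h -> h <= k%:R * (del / 2) -> nu * noise_gain < beta ->
  \forall n \near \oo, forall w, (forall p, ~ rough del nu (h + 2) (@noise n p w)) ->
  forall a : {ffun 'I_k -> 'I_(grid_size mm)},
  mhat a (mesh_values (del / 2) w) != 0 -> forall t j, 0 <= t <= h ->
  `|(Num.sqrt n%:R)^-1 * (customers (@Z n w t) j)%:R - step_path (del / 2) a t|
    <= nu * noise_gain + 2 * mm.+1%:R^-1.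
Proof.
move=> nu0 nu1 del0 delC h0 hk nub.
have del20 : 0 < del / 2 by rewrite divr_gt0.
have h10 : 0 < h + 1 by rewrite ltr_wpDl.
have near_eps : \forall n \near \oo, forall i, `|eps n i| <= nu.
  apply: filter_forall => i; have := heps i; move=> /cvgrPdist_le/(_ _ nu0).
  by apply: filterS => n; rewrite sub0r normrN.
have near_lamn : \forall n \near \oo, forall i,
    `|lamn n i - (lam i * n%:R + Num.sqrt n%:R * lamhat i)| <= nu / (h + 1) * Num.sqrt n%:R.
  apply: filter_forall => i; have /eqoP/(_ (nu / (h + 1))) := hlamn i.
  rewrite divr_gt0// => /(_ isT); apply: filterS => n.
  by rewrite [X in _ <= _ * X]ger0_norm// sqrtr_ge0.
near=> n => w nr a av t j ht.
have r_ge : 2 * C * (C + 1) <= Num.sqrt n%:R by near: n; exact: near_le_sqrt.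
have r_inv : nu^-1 <= Num.sqrt n%:R by near: n; exact: near_le_sqrt.
have r_large : 2 * N%:R * C ^+ 3 * k.+1%:R * beta / (del / 2) <= Num.sqrt n%:R.
  by near: n; exact: near_le_sqrt.
have r_large' : (nu * C + 1) / (del / 2) <= Num.sqrt n%:R by near: n; exact: near_le_sqrt.
have epsn : forall i, `|eps n i| <= nu by near: n.
have lamnn : forall i, `|lamn n i - (lam i * n%:R + Num.sqrt n%:R * lamhat i)|
    <= nu / (h + 1) * Num.sqrt n%:R by near: n.
have r0 : 0 < Num.sqrt (n%:R : R) by apply: lt_le_trans r_inv; rewrite invr_gt0.
have rr : n%:R = Num.sqrt (n%:R : R) ^+ 2 by rewrite sqr_sqrtr.
have [_ tb _ /(_ w) path _] := hsys n.
have tieP c (M : {set 'I_N}) i : i \in M -> @tie n w c M \in M.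
  by move=> iM; have [/(_ w)] := tb c M i iM.
have Kw : 4 * (6 * N%:R * C ^+ 2 * nu + (4 * (6 * N%:R * C ^+ 2 * nu) * C * \sum_(i < N) (mu i)^-1
    + 2 * (6 * N%:R * C ^+ 2 * nu))) + 10 * nu = nu * noise_gain.
  by rewrite /noise_gain; ring.
have E0 i : @E n i w 0 = 0%N by have [[/(_ w)[]]] := counting n i.
have S0 i : @S n i w 0 = 0%N by have [_ [/(_ w)[]]] := counting n i.
have E_mono i s u : 0 <= s -> s <= u -> (@E n i w s <= @E n i w u)%N.
  by have [[/(_ w)[_ + _] _] _] := counting n i; exact.
have S_mono i s u : 0 <= s -> s <= u -> (@S n i w s <= @S n i w u)%N.
  by have [_ [/(_ w)[_ + _] _]] := counting n i; exact.
have lamC i : lam i <= C /\ (lam i)^-1 <= C by case: (C_bounds i).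
have muC i : mu i <= C /\ (mu i)^-1 <= C by case: (C_bounds i).
have lamhatC i : `|lamhat i| <= C by case: (C_bounds i).
have hH : h + 1 < h + 2 by rewrite ltrD2l ltr1n.
have osc p u s : 0 <= u < h + 2 -> 0 <= s < h + 2 -> `|s - u| <= del / 2 ->
    `|noise p w s - noise p w u| <= nu.
  by move=> hu hs; apply: smooth_osc hu hs => //; exact: rnoise.
have e_osc i u s : 0 <= u < h + 2 -> 0 <= s < h + 2 -> `|s - u| <= del / 2 ->
    `|(Num.sqrt n%:R)^-1 * ((@E n i w s)%:R - lamn n i * s) -
     (Num.sqrt n%:R)^-1 * ((@E n i w u)%:R - lamn n i * u)| <= nu.
  by move=> hu hs us; have := osc (lshift N i) u s hu hs us; rewrite /noise split_l.
have s_osc i u s : 0 <= u < h + 2 -> 0 <= s < h + 2 -> `|s - u| <= del / 2 ->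
    `|(Num.sqrt n%:R)^-1 * ((@S n i w s)%:R - n%:R * mu i * s) -
     (Num.sqrt n%:R)^-1 * ((@S n i w u)%:R - n%:R * mu i * u)| <= nu.
  by move=> hu hs us; have := osc (rshift N i) u s hu hs us; rewrite /noise split_r.
have r_inv' : (Num.sqrt (n%:R : R))^-1 <= nu by rewrite -[nu]invrK lef_pV2 ?posrE ?invr_gt0.
have lamnE i : `|(Num.sqrt n%:R)^-1 * lamn n i - Num.sqrt n%:R * lam i - lamhat i| * (h + 1) <= nu.
  rewrite -ler_pdivlMr//.
  rewrite (_ : _ - lamhat i = (Num.sqrt n%:R)^-1 *
    (lamn n i - (lam i * n%:R + Num.sqrt n%:R * lamhat i))); last first.
    by rewrite [X in lam i * X]rr; move: r0; move: (Num.sqrt _) => r r0; field; rewrite gt_eqF.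
  rewrite normrM ger0_norm ?invr_ge0 ?(ltW r0)// mulrC ler_pdivrMr//; exact: lamnn.
rewrite ler_pdivrMr// in r_large.
have r_large2 : nu * C < Num.sqrt n%:R * (del / 2).
  rewrite (@lt_le_trans _ _ (nu * C + 1)) ?ltrDl//.
  by move: r_large'; rewrite ler_pdivrMr.
have kapb : 4 * (6 * N%:R * C ^+ 2 * nu + (4 * (6 * N%:R * C ^+ 2 * nu) * C * \sum_(i < N) (mu i)^-1
    + 2 * (6 * N%:R * C ^+ 2 * nu))) < beta.
  by apply: le_lt_trans nub; rewrite -Kw lerDl mulr_ge0// ltW.
have a_grid l : l%:R * (del / 2) <= h ->
    `|limit_noise lam mu lamhat (lamn n) (Num.sqrt n%:R) n%:R
      (fun i => @E n i w) (fun i => @S n i w) (l%:R * (del / 2)) - grid_path a l| <= mm.+1%:R^-1.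
  apply: grid_path_close => //.
    rewrite /limit_noise /weighted_mean big1 ?mul0r// => i _.
    by rewrite !(mulr0, E0, S0, subr0, addr0).
  by move=> i; have := mhat_supp av i; rewrite mesh_valuesE.
have := scaled_queue_discrete tieP path E_mono S_mono E0 S0 rr N0 lam_gt0 mu_gt0 hcrit C1
  lamC muC lamhatC nu0 nu1 del20 delC h0 hH hk hbeta e_osc s_osc r_inv' epsn lamnE
  r_ge r_large r_large2 kapb (erefl _) a_grid j ht.
move=> /le_trans; apply; rewrite -Kw; move: (mm.+1%:R^-1) => e; lra.
Unshelve. all: by end_near. Qed.

Definition queue_path n (w : T n) (t : R) : 'rV[R]_N :=
  \row_i ((Num.sqrt n%:R)^-1 * (customers (@Z n w t) i)%:R).

Lemma queue_path_cadlag n w : cadlag (@queue_path n w : skorohod 'rV[R]_N).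
Proof.
have [_ _ _ /(_ w)[_ Zr Zl _ _] _] := hsys n.
apply: cadlag_piecewise_constant => t t0.
  by have := Zr t t0; apply: filterS => s; rewrite /queue_path => ->.
have [z zt _] := Zl t t0.
by eexists; move: zt; apply: filterS => s; rewrite /queue_path => ->; reflexivity.
Qed.

Lemma target_cadlag w : cadlag (diagonal_path N (X w) : skorohod 'rV[R]_N).
Proof. by apply: cadlag_diagonal; case: (hX w). Qed.

Lemma step_path_cadlag k mm Del (a : {ffun 'I_k -> 'I_(grid_size mm)}) : 0 < Del ->
  cadlag (diagonal_path N (step_path Del a) : skorohod 'rV[R]_N).
Proof. by move=> Del0; apply: cadlag_diagonal; exact: cadlag_truncn. Qed.

Section functional.
Context (f : skorohod 'rV[R]_N -> R) (M : R).
Hypothesis M0 : 0 < M.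
Hypothesis fM : forall x, cadlag x -> 0 <= f x <= M.

(** [5 * (M * e)] pays for bad events, mass off the grid and convergence errors; [G] averages the
    oscillations of [f] around step paths. The third clause tells how to bound [G]: it charges only
    step paths uniformly close to [X w]. *)
Lemma mesh_approx (i : nat) : let e := i.+1%:R^-1 in let h := i%:R in
  exists G : T1 -> R, [/\ bounded_measurable G, forall w, 0 <= G w <= M,
    (forall w c, 0 <= c -> (forall x, cadlag x ->
       (forall t, 0 <= t <= h -> `|diagonal_path N (X w) t - (x : R -> 'rV[R]_N) t| <= e) ->
       osc f x h e <= c) -> G w <= c) &
    exists (u err : forall n, T n -> R) (v err' : T1 -> R),
   [/\ (forall n, bounded_measurable (@u n) /\ (forall w, 0 <= @u n w)),
     (forall n, bounded_measurable (@err n) /\ (forall w, 0 <= @err n w)),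
     [/\ bounded_measurable v, forall w, 0 <= v w, bounded_measurable err' &
        forall w, 0 <= err' w],
     (\forall n \near \oo, (forall w, `|f (@queue_path n w) - @u n w| <= @err n w) /\
        Ex (P n) (@err n) <= Ex P1 G + 5 * (M * e)) &
     [/\ Ex (P n) (@u n) @[n --> \oo] --> Ex P1 v,
       forall w, `|f (diagonal_path N (X w)) - v w| <= err' w &
       Ex P1 err' <= Ex P1 G + 5 * (M * e)]]].
Proof.
move=> e h.
have e0 : 0 < e by rewrite /e invr_gt0.
have h0 : 0 <= h by rewrite /h.
have M0' : 0 <= M by exact: ltW.
have gain0 : 0 < noise_gain by apply: lt_le_trans gain_ge.
have Cgt : 0 < C by apply: lt_le_trans C1.
(* The noise then adds at most [e / 4] to the distance of the paths, and the tolerances stay below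
   [beta]. *)
pose nu := Num.min 1 (Num.min (e / (4 * noise_gain)) (beta / (2 * noise_gain))).
have nu0 : 0 < nu by rewrite /nu !lt_min ltr01 !divr_gt0 ?mulr_gt0.
have nu1 : nu <= 1 by rewrite /nu ge_min lexx.
have nue : nu * noise_gain <= e / 4.
  have : nu <= e / (4 * noise_gain) by rewrite /nu !ge_min lexx orbT.
  by rewrite invfM mulrA ler_pdivlMr.
have nub : nu * noise_gain < beta.
  have : nu <= beta / (2 * noise_gain) by rewrite /nu !ge_min lexx !orbT.
  rewrite invfM mulrA ler_pdivlMr// => /le_lt_trans; apply.
  by rewrite ltr_pdivrMr// ltr_pMr// ltr1n.
have h20 : 0 < h + 2 by rewrite ltr_wpDl.
have q0 : 0 < (N + N)%:R :> R by rewrite ltr0n addn_gt0 N0.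
have eq0 : 0 < e / (N + N)%:R by rewrite divr_gt0.
have [delW delW0 hdelW] := rough_prob_small (bm_measurable hW) (bm_continuous hW) (h + 2) nu0 e0.
have /choice[deln hdeln] p : exists del, 0 < del /\
    \forall n \near \oo, fine (P n [set w | rough del nu (h + 2) (@noise n p w)]) < e / (N + N)%:R.
  have [del del0 hdel] := rough_transfer (@cvg_noise p)
    (fun n t => @mnoise n p t) (bm_right_continuous (@bm_noise p)) (bm_measurable (@bm_noise p))
    (bm_continuous (@bm_noise p)) nu0 h20 eq0.
  by exists del.
have nC : 0 < Num.min delW (nu / C) by rewrite lt_min delW0 divr_gt0.
have [del del0 [delm delp]] := common_scale nC (fun p => (hdeln p).1).
have [delW' delC] : del <= delW /\ del <= nu / C by move: delm; rewrite le_min => /andP[].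
have del20 : 0 < del / 2 by rewrite divr_gt0.
have del2C : del / 2 * C <= nu.
  by rewrite -ler_pdivlMr// (le_trans _ delC)// ler_piMr ?(ltW del0)// invf_le1// ler1n.
pose k := (Num.truncn (h / (del / 2))).+1.
have hk : h <= k%:R * (del / 2).
  rewrite -ler_pdivrMr// ltW//; have hd : 0 <= h / (del / 2) by rewrite divr_ge0// ltW.
  by have /andP[] := truncn_itv hd.
(* The grid adds at most another [e / 4], and the mass off it is below [e]. *)
have [mm [mme mmp]] : exists mm : nat, 8 * mm.+1%:R^-1 <= e /\
    Ex P1 (fun w => 1 - \prod_j pou mm (target_values (k := k) (del / 2) w j)) < e.
  have pc := Ex_prod_pou_cvg (X := fun w => target_values (k := k) (del / 2) w)
    (fun j => target_values_measurable j del20) P1.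
  have pc' : \forall mm \near \oo,
    Ex P1 (fun w => 1 - \prod_j pou mm (target_values (k := k) (del / 2) w j)) < e.
    move: pc => /cvgrPdist_lt/(_ _ e0); apply: filterS => mm.
    by rewrite sub0r normrN; exact/le_lt_trans/ler_norm.
  near \oo => mm; exists mm; split; last by near: mm.
  rewrite -ler_pdivlMl// -[leRHS]invrK lef_pV2 ?posrE ?invr_gt0 ?mulr_gt0 ?invr_gt0//.
  rewrite (le_trans (y := mm%:R))//; last by rewrite ler_nat.
  by near: mm; exact: nbhs_infty_ger.
have [Nul [mNul Nul0 hNul]] : {ae P1, forall w, W w 0 = 0}.
  by have [_ + _ _] := hW; apply: filterS => w [].
have mroughW := rough_measurable del nu (h + 2) (bm_measurable hW).
(* Off [B], [W] starts at 0 and is smooth at scale [del], as [target_close] requires. *)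
pose B := [set w | rough del nu (h + 2) (W w)] `|` Nul.
have mB : measurable B by exact: measurableU.
have PB : fine (P1 B) <= e.
  have : (P1 B <= P1 [set w | rough del nu (h + 2) (W w)])%E.
    rewrite (le_trans (measureU2 _ _ _))//.
    by rewrite [X in (_ + X)%E](_ : _ = 0%E) ?adde0.
  move=> PB; apply: le_trans (fine_le _ _ PB) _; rewrite ?fin_num_measure//.
  rewrite ltW// (le_lt_trans _ hdelW)//; apply: probability_fine_le => //.
    exact: rough_measurable (bm_measurable hW).
  by move=> w; exact: rough_le.
have notB w : ~ B w -> W w 0 = 0 /\ ~ rough del nu (h + 2) (W w).
  move=> nB; split; last by move=> r; apply: nB; left.
  by apply: contrapT => n0; apply: nB; right; exact: hNul.
pose phi (a : {ffun 'I_k -> 'I_(grid_size mm)}) : skorohod 'rV[R]_N :=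
  diagonal_path N (step_path (del / 2) a).
have cphi a : cadlag (phi a) by exact: step_path_cadlag.
pose os a := osc f (phi a) h e.
have os0 a : 0 <= os a <= M by apply: osc_bound => //; exact: ltW.
have os_ge0 a : 0 <= os a by case/andP: (os0 a).
pose mv n (w : T n) : 'I_k -> R := mesh_values (del / 2) w.
pose tv (w : T1) : 'I_k -> R := target_values (del / 2) w.
have mmv n j : measurable_fun setT (@mv n ^~ j) by exact: mesh_values_measurable.
have mtv j : measurable_fun setT (tv ^~ j) by exact: target_values_measurable.
have mt0 (x : 'I_k -> R) (a : {ffun 'I_k -> 'I_(grid_size mm)}) : 0 <= mhat a x.
  by case/andP: (mhat01 a x).
have sum1 (x : 'I_k -> R) : \sum_(a : {ffun 'I_k -> 'I_(grid_size mm)}) mhat a x <= 1.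
  by rewrite mhat_sum; case/andP: (prod_pou01 mm x).
have oss (x : 'I_k -> R) : 0 <= \sum_a os a * mhat a x <= M.
  rewrite sumr_ge0/= => [|a _]; last by rewrite mulr_ge0.
  apply: (@le_trans _ _ (\sum_(a : {ffun 'I_k -> 'I_(grid_size mm)}) M * mhat a x)); last by rewrite -mulr_sumr ler_piMr.
  by apply: ler_sum => a _; rewrite ler_wpM2r//; case/andP: (os0 a).
have bm_os (c : {ffun 'I_k -> 'I_(grid_size mm)} -> R) d' (T' : measurableType d') (x : T' -> 'I_k -> R) :
    (forall j, measurable_fun setT (x ^~ j)) ->
    bounded_measurable (fun w => \sum_a c a * mhat a (x w)).
  by move=> mx; apply: bm_sum => a; apply: bmM; [exact: bm_cst|exact: bm_mhat].
have bm_err d' (T' : measurableType d') (x : T' -> 'I_k -> R) (b : T' -> R) :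
    (forall j, measurable_fun setT (x ^~ j)) -> bounded_measurable b ->
    bounded_measurable (fun w => \sum_a os a * mhat a (x w) + M * b w
      + M * (1 - \prod_j pou mm (x w j))).
  move=> mx bb; apply: bmD; first apply: bmD.
  - exact: bm_os.
  - by apply: bmM => //; exact: bm_cst.
  apply: bmM; first exact: bm_cst.
  by apply: bmB; [exact: bm_cst|exact: bm_prod_pou].
have err_ge0 d' (T' : measurableType d') (x : T' -> 'I_k -> R) (b : T' -> R) w : 0 <= b w ->
    0 <= \sum_a os a * mhat a (x w) + M * b w + M * (1 - \prod_j pou mm (x w j)).
  move=> b0; have /andP[s0 _] := oss (x w); have /andP[_ p1] := prod_pou01 mm (x w).
  by rewrite !addr_ge0 ?mulr_ge0// subr_ge0.
have Ex_err d' (T' : measurableType d') (Q : probability T' R) (x : T' -> 'I_k -> R) (b : T' -> R) :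
    (forall j, measurable_fun setT (x ^~ j)) -> bounded_measurable b ->
    Ex Q (fun w => \sum_a os a * mhat a (x w) + M * b w + M * (1 - \prod_j pou mm (x w j))) =
    Ex Q (fun w => \sum_a os a * mhat a (x w)) + M * Ex Q b
      + M * Ex Q (fun w => 1 - \prod_j pou mm (x w j)).
  move=> mx bb.
  have b1 : bounded_measurable (fun w => M * b w) by apply: bmM => //; exact: bm_cst.
  have b2 : bounded_measurable (fun w => 1 - \prod_j pou mm (x w j)).
    by apply: bmB; [exact: bm_cst|exact: bm_prod_pou].
  have b3 : bounded_measurable (fun w => M * (1 - \prod_j pou mm (x w j))).
    by apply: bmM => //; exact: bm_cst.
  have b4 : bounded_measurable (fun w => \sum_a os a * mhat a (x w)) by exact: bm_os.
  have b5 := bmD b4 b1.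
  by rewrite ExD// ExD// !ExZ.
(* Cut off on [B], where the step paths selected by the hats need not be close to [X w]. *)
pose G w := (\sum_a os a * mhat a (tv w)) * \1_(~` B) w.
have bG : bounded_measurable G.
  by apply: bmM; [exact: bm_os|apply: bm_indic; exact: measurableC].
have G0 w : 0 <= G w <= M.
  have /andP[s0 s1] := oss (tv w).
  by rewrite /G indicE; case: (_ \in _); rewrite ?mulr1 ?mulr0 ?s0 ?s1 ?lexx ?M0'.
have b1B : bounded_measurable (\1_B : T1 -> R) by exact: bm_indic.
have osG : Ex P1 (fun w => \sum_a os a * mhat a (tv w)) <= Ex P1 G + M * e.
  apply: (@le_trans _ _ (Ex P1 (fun w => G w + M * \1_B w))).
    apply: le_Ex => [||w].
    - exact: bm_os.
    - by apply: bmD => //; apply: bmM => //; exact: bm_cst.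
    have /andP[s0 s1] := oss (tv w).
    rewrite /G !indicE in_setC; case: (w \in B) => /=; rewrite ?mulr1 ?mulr0 ?addr0 ?add0r//.
  rewrite ExD//; last by apply: bmM => //; exact: bm_cst.
  by rewrite lerD2l ExZ// ler_pM2l// Ex_indic.
have small_e : e / 4 + 2 * mm.+1%:R^-1 <= e by move: mme e0; move: (mm.+1%:R^-1) => q; lra.
have close_X w a : ~ B w -> mhat a (tv w) != 0 -> forall t, 0 <= t <= h ->
    `|diagonal_path N (X w) t - (phi a : R -> 'rV[R]_N) t| <= e.
  move=> /notB[W0 nr] ha t ht; rewrite (le_trans (diagonal_dist _ _ _ _ _))//.
  apply: le_trans (target_close nu0 del0 hk W0 nr ha ht) _; apply: le_trans small_e.
  rewrite lerD2r (le_trans _ nue)// mulrC ler_pM2l//.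
exists G; split => //.
  move=> w c c0 hc; rewrite /G indicE; have [/set_mem/= nB|_] := boolP (_ \in _); last by rewrite mulr0.
  rewrite mulr1; apply: (@le_trans _ _ (\sum_(a : {ffun 'I_k -> 'I_(grid_size mm)}) c * mhat a (tv w))); last by rewrite -mulr_sumr ler_piMr.
  apply: ler_sum => a _; have [->|ha] := eqVneq (mhat a (tv w)) 0; first by rewrite !mulr0.
  by rewrite ler_wpM2r//; apply: hc => //; exact: close_X.
(* The number of rough noises dominates the indicator of their union, and its expectation is a sum
   of probabilities. *)
pose bad n (w : T n) : R := \sum_p \1_[set w | rough del nu (h + 2) (@noise n p w)] w.
have mrough n p := rough_measurable del nu (h + 2) (@mnoise n p).
have bbad n : bounded_measurable (@bad n) by apply: bm_sum => p; apply: bm_indic; exact: mrough.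
have bad0 n w : 0 <= @bad n w by apply: sumr_ge0 => p _; rewrite indicE; case: (_ \in _).
have bad_cases n w : @bad n w = 0 /\ (forall p, ~ rough del nu (h + 2) (@noise n p w)) \/ 1 <= @bad n w.
  have [|] := pselect (forall p, ~ rough del nu (h + 2) (@noise n p w)).
    move=> nr; left; split=> //; rewrite /bad big1// => p _.
    by rewrite indicE memNset//; exact: nr.
  move=> /existsNP[p /contrapT r]; right; rewrite /bad (bigD1 p)//= indicE mem_set//= lerDl.
  by apply: sumr_ge0 => p' _; rewrite indicE; case: (_ \in _).
have cf a : 0 <= f (phi a) <= M by exact: fM.
have f_ge0 a : 0 <= f (phi a) by case/andP: (cf a).
exists (fun n w => \sum_a f (phi a) * mhat a (@mv n w)),
  (fun n w => \sum_a os a * mhat a (@mv n w) + M * @bad n w + M * (1 - \prod_j pou mm (@mv n w j))),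
  (fun w => \sum_a f (phi a) * mhat a (tv w)),
  (fun w => \sum_a os a * mhat a (tv w) + M * \1_B w + M * (1 - \prod_j pou mm (tv w j))).
have hcvg mm' (a : {ffun 'I_k -> 'I_(grid_size mm')}) : Ex (P n) (fun w => mhat a (@mv n w)) @[n --> \oo] --> Ex P1 (fun w => mhat a (tv w)).
  exact: mesh_values_cvg.
split.
- by move=> n; split; [exact: bm_os|move=> w; apply: sumr_ge0 => a _; rewrite mulr_ge0].
- by move=> n; split; [exact: bm_err|move=> w; exact: err_ge0].
- split; [exact: bm_os|by move=> w; apply: sumr_ge0 => a _; rewrite mulr_ge0|exact: bm_err|].
  by move=> w; apply: err_ge0; rewrite indicE.
(* The five [M * e]: one from [osG], one from [c1], two from [c2], one from [c3]. *)
- have Me : 0 < M * e by rewrite mulr_gt0.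
  have c1 : \forall n \near \oo, Ex (P n) (fun w => \sum_a os a * mhat a (@mv n w)) <=
      Ex P1 (fun w => \sum_a os a * mhat a (tv w)) + M * e.
    have /cvgrPdist_le/(_ _ Me) := mhat_sum_cvg (c := os) mmv mtv hcvg.
    by apply: filterS => n; rewrite distrC => /(le_trans (ler_norm _)); rewrite lerBlDl.
  have c2 : \forall n \near \oo, Ex (P n) (fun w => 1 - \prod_j pou mm (@mv n w j)) <= e + e.
    have /cvgrPdist_le/(_ _ e0) := prod_pou_cvg (m := mm) mmv mtv hcvg.
    apply: filterS => n; rewrite distrC => /(le_trans (ler_norm _)); rewrite lerBlDl.
    by move=> /le_trans; apply; rewrite lerD2r ltW.
  have c3 : \forall n \near \oo, Ex (P n) (@bad n) <= e.
    have : \forall n \near \oo, forall p,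
        fine (P n [set w | rough (deln p) nu (h + 2) (@noise n p w)]) < e / (N + N)%:R.
      by apply: filter_forall => p; case: (hdeln p).
    apply: filterS => n hn; rewrite /bad Ex_sum; last by move=> p; apply: bm_indic; exact: mrough.
    rewrite (_ : e = \sum_(p < N + N) e / (N + N)%:R); last first.
      by rewrite sumr_const card_ord -[RHS]mulr_natl mulrC divfK// gt_eqF.
    apply: ler_sum => p _; rewrite Ex_indic; last exact: mrough.
    apply: ltW; apply: le_lt_trans (hn p); apply: probability_fine_le.
    - exact: mrough.
    - exact: rough_measurable (@mnoise n p).
    - by move=> w; exact: rough_le.
  have c4 := @prelimit_close nu del h k mm nu0 nu1 del0 del2C h0 hk nub.
  near=> n; split.
    move=> w; apply: mhat_approx => //.
    - by apply: fM; exact: queue_path_cadlag.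
    - by case: (bad_cases n w) => [[-> _]|]; [left|right].
    move=> b0 a ha; apply: (osc_ge fM (cphi a) (@queue_path_cadlag n w)).
    have nr : forall p, ~ rough del nu (h + 2) (@noise n p w).
      by case: (bad_cases n w) => [[]//|]; rewrite b0 ler10.
    move=> t ht; apply: row_norm_le => [|j]; first exact: ltW.
    rewrite !mxE; have c4n : forall w, (forall p, ~ rough del nu (h + 2) (@noise n p w)) ->
      forall a : {ffun 'I_k -> 'I_(grid_size mm)},
      mhat a (mesh_values (del / 2) w) != 0 -> forall t j, 0 <= t <= h ->
      `|(Num.sqrt n%:R)^-1 * (customers (@Z n w t) j)%:R - step_path (del / 2) a t|
        <= nu * noise_gain + 2 * mm.+1%:R^-1 by near: n.
    by apply: le_trans (c4n w nr a ha t j ht) _; apply: le_trans small_e; rewrite lerD2r.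
  rewrite Ex_err//.
  have d1' : Ex (P n) (fun w => \sum_a os a * mhat a (@mv n w)) <=
      Ex P1 (fun w => \sum_a os a * mhat a (tv w)) + M * e by near: n.
  have d2 : M * Ex (P n) (fun w => 1 - \prod_j pou mm (@mv n w j)) <= M * (e + e).
    by rewrite ler_pM2l//; near: n.
  have d3 : M * Ex (P n) (@bad n) <= M * e by rewrite ler_pM2l//; near: n.
  by move: osG; lra.
- split.
  + exact: mhat_sum_cvg.
  + move=> w; apply: mhat_approx => //; first by apply: fM; exact: target_cadlag.
      by rewrite indicE; case: (w \in B); [right|left].
    move=> b0 a ha; apply: (osc_ge fM (cphi a) (target_cadlag w)).
    apply: close_X => // Bw; move: b0; rewrite indicE mem_set//= => /eqP.
    by rewrite oner_eq0.
  + rewrite Ex_err// Ex_indic//; have : M * Ex P1 (fun w => 1 - \prod_j pou mm (tv w j)) <= M * e.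
      by rewrite ler_pM2l// ltW.
    have : M * fine (P1 B) <= M * e by rewrite ler_pM2l.
    have : 0 < M * e by rewrite mulr_gt0.
    by move: osG; lra.
Unshelve. all: by end_near. Qed.

(** Continuity of [f] is used pointwise: around each limit path the oscillations vanish as [e]
    shrinks and [h] grows, and dominated convergence applies to the measurable averages [G i]. *)
Lemma functional_cvg : {within @cadlag R 'rV[R]_N, continuous f} ->
  Ex (P n) (fun w => f (@queue_path n w)) @[n --> \oo] -->
  Ex P1 (fun w => f (diagonal_path N (X w))).
Proof.
move=> cf; have /choice[G hG] := mesh_approx.
have G0 : Ex P1 (G i) @[i --> \oo] --> (0 : R).
  apply: (@Ex_cvg0 _ _ _ _ _ M) => [i|i w|].
  - by case: (hG i).
  - by case: (hG i) => _ /(_ w)/andP[g0 gM] _ _; rewrite ger0_norm.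
  apply: aeW => w; apply/cvgrPdist_le => eta eta0.
  have [h [e [e0 hosc]]] := osc_small cf (target_cadlag w) eta0.
  near=> i; have [_ /(_ w)/andP[g0 _] /(_ w eta (ltW eta0)) hGi _] := hG i.
  rewrite sub0r normrN ger0_norm//; apply: hGi => x cx xX.
  apply: hosc => //; first by near: i; exact: nbhs_infty_ger.
  rewrite invr_ge0 ler0n/= ltW//.
  by near: i; exact: (near_infty_natSinv_lt (PosNum e0)).
apply: (@Ex_cvg_approx _ _ _ _ _ _ _ _ _ M) => [n w|w|eta eta0].
- by apply: fM; exact: queue_path_cadlag.
- by apply: fM; exact: target_cadlag.
have eta20 : 0 < eta / 2 by rewrite divr_gt0.
have [i [Gi ei]] : exists i, Ex P1 (G i) <= eta / 2 /\ 5 * (M * i.+1%:R^-1) <= eta / 2.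
  have q0 : 0 < eta / 2 / (5 * M) by rewrite divr_gt0// mulr_gt0.
  near \oo => i; exists i; split.
    have : `|0 - Ex P1 (G i)| <= eta / 2.
      by near: i; move: G0 => /cvgrPdist_le; exact.
    by rewrite sub0r normrN; apply: le_trans; exact: ler_norm.
  rewrite mulrA mulrC -ler_pdivlMr ?mulr_gt0// ltW//.
  by near: i; exact: (near_infty_natSinv_lt (PosNum q0)).
have [_ _ _ [u [err [v [err' [h1 h2 h3 h4 [h5 h6 h7]]]]]]] := hG i.
have bound : Ex P1 (G i) + 5 * (M * i.+1%:R^-1) <= eta.
  by rewrite [leRHS]splitr lerD.
exists u, err, v, err'; split => //.
  by apply: filterS h4 => n [? hn]; split => //; exact: le_trans hn bound.
by split => //; exact: le_trans h7 bound.
Unshelve. all: by end_near. Qed.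

End functional.

End heavy_traffic.

Theorem theorem2 (R : realType) (N : nat) (hN : (2 <= N)%N)
  (* parameters *)
  (lam mu lamhat sigma gamma : 'I_N -> R) (lamn : nat -> 'I_N -> R)
  (beta : R) (eps : nat -> 'I_N -> R)
  (lam_gt0 : forall i, 0 < lam i) (mu_gt0 : forall i, 0 < mu i)
  (hsigma : forall i, 0 <= sigma i) (hgamma : forall i, 0 <= gamma i)
  (hlamn : forall i,
     (fun n : nat => (lamn n i -
        (lam i * n%:R + Num.sqrt n%:R * lamhat i) : R^o)) =o_\oo
     (fun n : nat => (Num.sqrt n%:R : R^o)))
  (hcrit : \sum_(i < N) lam i / mu i = 1)
  (hbeta : 0 < beta) (heps : forall i, eps n i @[n --> \oo] --> (0 : R))
  (* the n-th system *)
  (d : nat -> measure_display) (T : forall n, measurableType (d n))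
  (P : forall n, probability (T n) R)
  (E S : forall n, 'I_N -> T n -> R -> nat)
  (tie : forall n, T n -> nat -> {set 'I_N} -> 'I_N)
  (Z : forall n, T n -> R -> state N)
  (hsys : forall n, slq_system (P n)
     (fun i => beta * Num.sqrt n%:R + eps n i * Num.sqrt n%:R)
     (E n) (S n) (tie n) (Z n))
  (* limits of the primitives *)
  (d0 : measure_display) (T0 : measurableType d0) (P0 : probability T0 R)
  (Warr Wser : 'I_N -> T0 -> R -> R)
  (hWarr : forall i, brownian_motion P0 0 (lam i * sigma i ^+ 2) (Warr i))
  (hWser : forall i, brownian_motion P0 0 (mu i * gamma i ^+ 2) (Wser i))
  (hE1 : forall i, @cvg_in_distribution R R^o d T P
     (fun n w t => n%:R^-1 * (E n i w t)%:R)
     d0 T0 P0 (fun _ t => lam i * t))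
  (hE2 : forall i, @cvg_in_distribution R R^o d T P
     (fun n w t => (Num.sqrt n%:R)^-1 * ((E n i w t)%:R - lamn n i * t))
     d0 T0 P0 (Warr i))
  (hS1 : forall i, @cvg_in_distribution R R^o d T P
     (fun n w t => n%:R^-1 * (S n i w t)%:R)
     d0 T0 P0 (fun _ t => mu i * t))
  (hS2 : forall i, @cvg_in_distribution R R^o d T P
     (fun n w t => (Num.sqrt n%:R)^-1 * ((S n i w t)%:R - n%:R * mu i * t))
     d0 T0 P0 (Wser i))
  (* the limit *)
  (d1 : measure_display) (T1 : measurableType d1) (P1 : probability T1 R)
  (W X : T1 -> R -> R) :
  let alpha := (\sum_(i < N) (mu i)^-1)^-1 in
  let m := alpha * \sum_(i < N) lamhat i / mu i in
  let A := alpha ^+ 2 *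
    \sum_(i < N) lam i / mu i ^+ 2 * (sigma i ^+ 2 + gamma i ^+ 2) in
  brownian_motion P1 m A W ->
  (forall w, skorohod_map beta (W w) (X w)) ->
  @cvg_in_distribution R 'rV[R]_N d T P
    (fun n w t => \row_i ((Num.sqrt n%:R)^-1 * (customers (Z n w t) i)%:R))
    d1 T1 P1 (fun w t => \row_(i < N) X w t).
Proof.
move=> alpha m A hW hX f cf [M fM].
have N0 : (0 < N)%N by exact: ltnW.
have M1 : 0 < `|M| + 1 by rewrite ltr_wpDl.
(* The squeeze concerns nonnegative functionals. The integral of [f] is by definition the difference
   of those of its positive and negative parts, so these are treated apart. *)
have bound (g : skorohod 'rV[R]_N -> R) : (forall x, `|g x| = `|f x|) ->
    forall x, cadlag x -> 0 <= Num.max (g x) 0 <= `|M| + 1.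
  move=> gf x /fM fx; rewrite le_max lexx orbT ge_max addr_ge0// andbT.
  rewrite (le_trans (ler_norm _))// gf (le_trans fx)// (le_trans (ler_norm _))//.
  by rewrite lerDl.
have fp0 := bound f (fun=> erefl _).
have fn0 := bound (fun x => - f x) (fun x => normrN (f x)).
have cvg (g : skorohod 'rV[R]_N -> R) := @functional_cvg R N lam mu lamhat sigma gamma lamn
  beta eps N0 lam_gt0 mu_gt0 hlamn hcrit hbeta heps d T P E S tie Z hsys d0 T0 P0 Warr Wser
  hWarr hWser hE2 hS2 d1 T1 P1 W X m A (erefl _) (erefl _) hW hX g (`|M| + 1) M1.
have cmax (g : skorohod 'rV[R]_N -> R) : {within @cadlag R 'rV[R]_N, continuous g} ->
    {within @cadlag R 'rV[R]_N, continuous (fun x => Num.max (g x) 0)}.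
  by move=> cg x; apply: continuous_max; [exact: cg|exact: cvg_cst].
have cN : {within @cadlag R 'rV[R]_N, continuous (fun x => - f x)}.
  by move=> x; apply: cvgN; exact: cf.
have EE d' (T' : measurableType d') (Q : probability T' R) (Y : T' -> skorohod 'rV[R]_N) :
    (forall w, cadlag (Y w)) ->
    ('E_Q[f \o Y])%E = (Ex Q (fun w => Num.max (f (Y w)) 0)
      - Ex Q (fun w => Num.max (- f (Y w)) 0))%:E.
  move=> cY; rewrite unlock integralE EFinB; congr (_ - _)%E.
    rewrite /Ex /Rintegral fineK; last first.
      by apply: (@ge0_fin_num_integral _ _ _ _ (`|M| + 1)) => w; exact: fp0.
    by apply: eq_integral => w _; rewrite funeposE -EFin_max.
  rewrite /Ex /Rintegral fineK; last first.
    by apply: (@ge0_fin_num_integral _ _ _ _ (`|M| + 1)) => w; exact: fn0.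
  by apply: eq_integral => w _; rewrite funenegE -EFin_max.
have cvgR := cvgB (cvg _ fp0 (cmax _ cf)) (cvg _ fn0 (cmax _ cN)).
rewrite EE; last by move=> w; apply: cadlag_diagonal; case: (hX w).
have -> : (fun n => ('E_(P n)[f \o (fun w t => \row_i ((Num.sqrt n%:R)^-1 * (customers (@Z n w t) i)%:R)%R)])%E)
  = (fun n => (Ex (P n) (fun w => Num.max (f (queue_path Z w)) 0)
      - Ex (P n) (fun w => Num.max (- f (queue_path Z w)) 0))%:E).
  apply/funext => n; rewrite EE//= => w.
  exact: queue_path_cadlag.
by apply/fine_cvgP; split; [exact: nearW|exact: cvgR].
Qed.
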